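(* Let $P'$ and $E$ be the observed and the noise point clouds in $\mathbb{R}^d$ (with standard Gaussian noise), let $\hat P$ and $\hat E$ be the compressed point clouds of $P'$ and $E$, respectively, by normalized PCA, and let persistence diagrams be computed with the Rips filtration. Then for every integer $N$ with $0\le N\le n-2$, $$d_B\big(\bar{\mathrm D}_N(\hat P),\bar{\mathrm D}_N(\hat E)\big)=o_{\mathbb P}(1)$$ as $d\to\infty$.
   Context: Setting. Fix integers $n>3$ and $1\le s<n$ and let $d>n$ tend to infinity ($n,s$ do not depend on $d$). The original point cloud is $P=\{x_1,\dots,x_n\}\subset\mathbb{R}^d$ with $x_i=(x_{1i},\dots,x_{si},0,\dots,0)^T$, where the numbers $x_{ki}$ are fixed and do not depend on $d$. The noise point cloud is $E=\{e_1,\dots,e_n\}$ with $e_1,\dots,e_n$ i.i.d. following $\mathcal N_d(0,I_d)$. The observed point cloud is $P'=\{x_1',\dots,x_n'\}$, $x_i'=x_i+e_i$. Normalized PCA. For a point cloud $Z=\{z_1,\dots,z_n\}\subset\mathbb{R}^d$ (here $Z=P'$ or $Z=E$) let $\bar z=n^{-1}\sum_iz_i$ and let $S_Z=\frac1{n-1}\sum_i(z_i-\bar z)(z_i-\bar z)^T$, with largest eigenvalues $\lambda_1\ge\lambda_2\ge\cdots$ and corresponding orthonormal eigenvectors $h_1,h_2,\dots$. The compressed point cloud of $Z$ by normalized PCA is $\hat Z=\{\hat z_1,\dots,\hat z_n\}\subset\mathbb{R}^s$, where the $k$-th coordinate of $\hat z_i$ is $\lambda_k^{-1/2}h_k^T(z_i-\bar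 z)$, $k=1,\dots,s$. Equivalently $\hat z_i=\sqrt{n-1}\,(u_{i1},\dots,u_{is})^T$, where $u_k=(u_{1k},\dots,u_{nk})^T$ is the corresponding unit eigenvector for the $k$-th largest eigenvalue of the dual sample covariance matrix $S_{\mathrm D,Z}=\frac1{n-1}(Z-\bar Z)^T(Z-\bar Z)$, with $Z$ viewed as the $d\times n$ matrix $(z_1\cdots z_n)$ and $\bar Z=(\bar z\cdots\bar z)$. Persistence diagrams. For a finite point cloud $X$ in a Euclidean space and $r\ge0$, the Rips complex at parameter $r$ is the set of $\sigma\subseteq X$ such that $B_x(r)\cap B_y(r)\ne\emptyset$ for all $x,y\in\sigma$ (closed balls of radius $r$). $\mathrm D_N(X)$ is the $N$-th persistence diagram of this filtration using reduced homology with coefficients in a fixed field: the multiset of birth-death pairs in $\mathbb{R}_{\ge0}^2$. $\bar{\mathrm D}_N(X)$ is the disjoint union of $\mathrm D_N(X)$ and all points of the diagonal $\{(x,x):x\ge0\}$, each with infinite multiplicity. $d_B(\bar{\mathrm D}_N(X),\bar{\mathrm D}_N(Y))=\inf_\eta\sup_x\|x-\eta(x)\|_\infty$ over all bijections $\eta:\bar{\mathrm D}_N(X)\to\bar{\mathrm D}_N(Y)$. $X_d=o_{\mathbb P}(1)$ means $\mathbb P(|X_d|\le\varepsilon)\to1$ for every $\varepsilon>0$. *)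

(* Defs.v *)
From HB Require Import structures.
From mathcomp Require Import all_boot all_order all_algebra.
From mathcomp Require Import all_classical all_reals all_analysis.

Set Implicit Arguments.
Unset Strict Implicit.
Unset Printing Implicit Defensive.

Import Order.TTheory GRing.Theory Num.Theory.
Import numFieldNormedType.Exports.

Local Open Scope classical_set_scope.
Local Open Scope ring_scope.

(* A point cloud z_1, ..., z_n in R^m is the m x n matrix (z_1 ... z_n). *)

Section NormalizedPCA.
Context {R : realType}.

Definition cloud_mean (m n : nat) (Z : 'M[R]_(m, n)) : 'cV[R]_m :=
  n%:R^-1 *: \sum_(i < n) col i Z.

Definition sample_cov (m n : nat) (Z : 'M[R]_(m, n)) : 'M[R]_m :=
  (n%:R - 1)^-1 *:
    \sum_(i < n) (col i Z - cloud_mean Z) *m (col i Z - cloud_mean Z)^T.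

(* [lam] lists all the eigenvalues of [A] in nonincreasing order, repeated
   according to multiplicity, and [h] is an orthonormal eigenbasis. *)
Definition ordered_eigensystem (m : nat) (A : 'M[R]_m)
    (lam : 'I_m -> R) (h : 'I_m -> 'cV[R]_m) : Prop :=
  [/\ forall k l : 'I_m, (k <= l)%N -> lam l <= lam k,
      forall k l : 'I_m, (h k)^T *m h l = ((k == l)%:R)%:M
    & forall k : 'I_m, A *m h k = lam k *: h k].

(* The compressed cloud is determined only up to the choice of the
   eigenvectors (signs, and bases of multiple eigenspaces), hence a relation.
   [k] and [k'] are the same index, seen in 'I_s and in 'I_m. *)
Definition is_normalized_pca (m s n : nat) (Z : 'M[R]_(m, n))
    (Zhat : 'M[R]_(s, n)) : Prop :=
  exists (lam : 'I_m -> R) (h : 'I_m -> 'cV[R]_m),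
    ordered_eigensystem (sample_cov Z) lam h /\
    forall (k : 'I_s) (k' : 'I_m), k = k' :> nat -> forall i : 'I_n,
      Zhat k i = (Num.sqrt (lam k'))^-1 *
                 ((h k')^T *m (col i Z - cloud_mean Z)) 0 0.

End NormalizedPCA.

Section Homology.
Context (F : fieldType) (n : nat).

(* Simplices are subsets of the vertex set 'I_n; the empty set is the simplex
   of dimension -1, so that the homology below is reduced. *)
Local Notation chain := {ffun {set 'I_n} -> F^o}.

Definition simplex_chain (sigma : {set 'I_n}) : chain :=
  [ffun tau => (tau == sigma)%:R].

(* Each simplex is oriented by the order of 'I_n. *)
Definition simplex_boundary (sigma : {set 'I_n}) : chain :=
  \sum_(i in sigma)
    (-1) ^+ #|[set j in sigma | (j < i)%N]| *: simplex_chain (sigma :\ i)%SET.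

Definition boundary (c : chain) : chain :=
  \sum_(sigma : {set 'I_n}) (c sigma : F) *: simplex_boundary sigma.

Fact boundary_is_linear : linear boundary.
Proof.
move=> a u v; rewrite /boundary scaler_sumr -big_split /=.
by apply: eq_bigr => sigma _; rewrite !ffunE scalerDl scalerA.
Qed.
HB.instance Definition _ :=
  GRing.isLinear.Build F chain chain *:%R boundary boundary_is_linear.

Definition chains (K : {set {set 'I_n}}) (N : nat) : {vspace chain} :=
  <<[seq simplex_chain sigma |
      sigma in [set tau in K | #|tau| == N.+1]%SET]>>%VS.

Definition cycles (K : {set {set 'I_n}}) (N : nat) : {vspace chain} :=
  (chains K N :&: lker (linfun boundary))%VS.

Definition boundaries (K : {set {set 'I_n}}) (N : nat) : {vspace chain} :=
  (linfun boundary @: chains K N.+1)%VS.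

(* For subcomplexes K of L, the rank of the map H_N(K) -> H_N(L) induced by
   inclusion, i.e. the dimension of Z_N(K) / (Z_N(K) :&: B_N(L)). *)
Definition persistent_betti (K L : {set {set 'I_n}}) (N : nat) : nat :=
  (\dim (cycles K N) - \dim (cycles K N :&: boundaries L N))%N.

End Homology.

Section PersistenceDiagram.
Context {R : realType}.

Definition eucl_dist (m : nat) (x y : 'cV[R]_m) : R :=
  Num.sqrt (\sum_(k < m) (x k 0 - y k 0) ^+ 2).

(* Two closed balls of radius r meet iff they have a common point p.
   For r < 0 all balls are empty and the complex is reduced to the empty
   simplex. *)
Definition rips (m n : nat) (X : 'M[R]_(m, n)) (r : R) : {set {set 'I_n}} :=
  [set sigma : {set 'I_n} |
    `[< forall i j : 'I_n, i \in sigma -> j \in sigma ->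
          exists p : 'cV[R]_m,
            eucl_dist (col i X) p <= r /\ eucl_dist (col j X) p <= r >]]%SET.

(* The union of the Rips complexes at parameters < r; as the filtration is
   finite, this is the complex just before r. *)
Definition rips_before (m n : nat) (X : 'M[R]_(m, n)) (r : R) :
    {set {set 'I_n}} :=
  [set sigma : {set 'I_n} | `[< exists2 r', r' < r & sigma \in rips X r' >]]%SET.

(* A multiset of points of the plane is given by its multiplicity function.
   The multiplicity of (b, d), b < d, is the number of independent classes
   born at b and dying at d, i.e.
     (beta(b, d-) - beta(b, d)) - (beta(b-, d-) - beta(b-, d))
   where b-, d- denote the stages just before b and d and beta(b, d) is the
   rank of H_N at b -> H_N at d. There is no point at infinity: for large r
   the complex is a full simplex, whose reduced homology vanishes. *)
Definition persistence_diagram (F : fieldType) (m n : nat) (X : 'M[R]_(m, n))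
    (N : nat) (p : R * R) : nat :=
  let beta := fun K L => persistent_betti F K L N in
  let: (b, d) := p in
  if b < d then
    ((beta (rips X b) (rips_before X d) - beta (rips X b) (rips X d)) -
     (beta (rips_before X b) (rips_before X d) -
      beta (rips_before X b) (rips X d)))%N
  else 0%N.

(* Disjoint union of D and of countably many copies of each point of the
   diagonal: (p, k) is the k-th copy of the point p. *)
Definition extended_diagram (D : R * R -> nat) : set (R * R * nat) :=
  [set q | (q.2 < D q.1)%N] `|` [set q | q.1.1 = q.1.2 /\ 0 <= q.1.1].

Definition linf_dist (p q : R * R) : R :=
  Num.max `|p.1 - q.1| `|p.2 - q.2|.

Definition bottleneck (D D' : R * R -> nat) : \bar R :=
  ereal_inf
    [set ereal_sup [set (linf_dist q.1 (eta q).1)%:E | q in extended_diagram D]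
    | eta in [set eta : R * R * nat -> R * R * nat |
        set_bij (extended_diagram D) (extended_diagram D') eta]].

End PersistenceDiagram.

Section Probability.
Context {R : realType}.

Definition borel_cV (d : nat) := g_sigma_algebraType (@open 'cV[R]_d).

(* Taking some of the [B i] to be the whole space gives the product rule for
   subfamilies. *)
Definition mutually_independent (disp : measure_display)
    (Omega : measurableType disp) (P : probability Omega R)
    (disp' : measure_display) (T : measurableType disp') (n : nat)
    (X : 'I_n -> Omega -> T) : Prop :=
  forall B : 'I_n -> set T, (forall i, measurable (B i)) ->
    P (\bigcap_i (X i @^-1` B i)) = (\prod_(i < n) P (X i @^-1` B i))%E.

(* The law of [e] is N_d(0, I_d): the product of d copies of N(0, 1). *)
Definition standard_gaussian (disp : measure_display)
    (Omega : measurableType disp) (P : probability Omega R)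
    (d : nat) (e : Omega -> 'cV[R]_d) : Prop :=
  forall C : 'I_d -> set R, (forall k, measurable (C k)) ->
    P [set w | forall k, C k (e w k 0)] =
    (\prod_(k < d) normal_prob 0 1 (C k))%E.

Definition iid_standard_gaussian (disp : measure_display)
    (Omega : measurableType disp) (P : probability Omega R)
    (n d : nat) (e : 'I_n -> Omega -> 'cV[R]_d) : Prop :=
  [/\ forall i, measurable_fun setT (e i : Omega -> borel_cV d),
      mutually_independent P (fun i => e i : Omega -> borel_cV d)
    & forall i, standard_gaussian P (e i)].

(* The events {|X_d| <= eps} are not assumed to be measurable: their inner
   probability is required to tend to 1. *)
Definition oP1 (disp : nat -> measure_display)
    (Omega : forall d, measurableType (disp d))
    (P : forall d, probability (Omega d) R)
    (X : forall d, Omega d -> \bar R) : Prop :=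
  forall eps : R, 0 < eps ->
    exists A : forall d, set (Omega d),
      [/\ forall d, measurable (A d),
          forall d, A d `<=` [set w | (`|X d w| <= eps%:E)%E]
        & P d (A d) @[d --> \oo] --> 1%E].

End Probability.

Section Clouds.
Context {R : realType}.

(* x_i = (x_1i, ..., x_si, 0, ..., 0)^T. *)
Definition original_cloud (s n d : nat) (x : 'M[R]_(s, n)) : 'M[R]_(d, n) :=
  \matrix_(k < d, i < n)
    oapp (fun k' : 'I_s => x k' i) 0 (insub (k : nat)).

Definition noise_cloud (Omega : Type) (n d : nat)
    (e : 'I_n -> Omega -> 'cV[R]_d) (w : Omega) : 'M[R]_(d, n) :=
  \matrix_(k < d, i < n) e i w k 0.

Definition observed_cloud (Omega : Type) (s n d : nat) (x : 'M[R]_(s, n))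
    (e : 'I_n -> Omega -> 'cV[R]_d) (w : Omega) : 'M[R]_(d, n) :=
  original_cloud d x + noise_cloud e w.

End Clouds.

(* Main.v *)
Require Import Defs.
From HB Require Import structures.
From mathcomp Require Import all_boot all_order all_algebra.
From mathcomp Require Import all_classical all_reals all_analysis.
From mathcomp Require Import measurable_realfun.
From mathcomp Require Import ring lra zify.

(* Both Rips filtrations are governed by pairwise distances in the compressed
   clouds.  On the segment joining two filtration functions, cut wherever two
   simplices swap order, the diagrams correspond class by class and the bounds
   add up; so the bottleneck distance is at most the largest difference of
   pairwise distances.

   The compressed clouds are leading eigenvectors of the centered Gram matrices
   J W J and J W' J of the two clouds.  The entries of W - v d I are of order
   sqrt d, while those of W' - W are bounded in probability, because the
   original cloud occupies s fixed coordinates.  Hence the eigenvectors are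
   close as soon as the eigenvalues of J (W - v d I) J / sqrt d stay apart,
   that is, as soon as the discriminant of this matrix stays away from 0.

   No limit law is needed for that.  Multiply column i of the noise by
   1 + t i / sqrt d.  The laws of the noise and of the dilated noise are
   contiguous, uniformly in d, by an L^2 bound on the density.  As a function of
   t the discriminant is a polynomial of bounded degree whose values are not all
   small, because for large t the matrix looks like t J diag(1, ..., n) J; so it
   is small at boundedly many of L prescribed values of t only.  Averaging over
   these values, the discriminant of the undilated noise is small with
   probability O(L^(-1/2)). *)

Set Implicit Arguments.
Unset Strict Implicit.
Unset Printing Implicit Defensive.

Import Order.TTheory GRing.Theory Num.Theory.
Import numFieldNormedType.Exports.

Local Open Scope classical_set_scope.
Local Open Scope ring_scope.


(** * Stability of persistence diagrams *)

Section Matching.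
Context {R : realType}.
Implicit Types (D : R * R -> nat) (eps : R).

(** The eigenvectors are determined only up to sign, and pairwise distances do not see signs. So the
    target is that [U *m U'^T], for the two eigenbases, is nearly diagonal. Its (j, l) entry times
    [mu' l - mu j] is an entry of the perturbation in mixed bases: the perturbation stays bounded
    while the gaps grow like sqrt d. The obstacle is a lower bound on the gaps that is uniform in d.
    The dilation by 1 + t i / sqrt d is balanced for it. It moves the diagonal of the Gram matrix by
    about 2 v t i sqrt d, which is the order of the fluctuations, whereas the second moment of the
    density ratio is 1 + O(1/d) per coordinate, so that its d-th power stays bounded. The exponent
    -1/2 comes from Cauchy-Schwarz: P(B)^2 <= C Q(B), where Q is the dilated law and Q(B) is about
    1/L. The discriminant of J A J also involves the eigenvalue 0 carried by the constant vector, so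
    its being away from 0 separates the other eigenvalues from 0 as well. This is why the limit
    matrix must have full rank on the complement of that vector. *)

Definition matched eps D D' : Prop :=
  exists2 eta : R * R * nat -> R * R * nat,
    set_bij (extended_diagram D) (extended_diagram D') eta
  & forall q, extended_diagram D q -> linf_dist q.1 (eta q).1 <= eps.

Lemma linf_dist_triangle (p q r : R * R) :
  linf_dist p r <= linf_dist p q + linf_dist q r.
Proof.
rewrite /linf_dist ge_max; apply/andP; split.
  apply: (le_trans (ler_distD q.1 _ _)).
  by apply: lerD; rewrite le_max lexx.
apply: (le_trans (ler_distD q.2 _ _)).
by apply: lerD; rewrite le_max lexx orbT.
Qed.

Lemma matched_trans eps eps' D D' D'' :
  matched eps D D' -> matched eps' D' D'' -> matched (eps + eps') D D''.
Proof.
move=> [eta bij1 le1] [eta' bij2 le2]; exists (eta' \o eta).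
  exact: set_bij_comp bij1 bij2.
move=> q qD; apply: (le_trans (linf_dist_triangle _ (eta q).1 _)).
apply: lerD; first exact: le1.
by apply: le2; apply: (set_bij_sub bij1); exists q.
Qed.

Lemma bottleneck_le eps D D' : matched eps D D' ->
  (`|bottleneck D D'| <= eps%:E)%E.
Proof.
move=> [eta bij le_eta].
(* The diagonal point (0, 0) lies in every extended diagram, so no supremum is taken over the empty
   set. *)
have ge0 : (0 <= bottleneck D D')%E.
  apply: le_ereal_inf_tmp => _ [eta' _ <-].
  apply: (@le_trans _ _ (linf_dist (0, 0) (eta' ((0, 0), 0%N)).1)%:E).
    by rewrite lee_fin /linf_dist le_max normr_ge0.
  by apply: ereal_sup_ubound; exists ((0, 0), 0%N) => //; right.
rewrite gee0_abs //; apply: ge_ereal_inf.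
exists (ereal_sup [set (linf_dist q.1 (eta q).1)%:E | q in extended_diagram D]).
  by exists eta.
apply: ge_ereal_sup => _ [q qD <-]; rewrite lee_fin; exact: le_eta.
Qed.

Definition point_count (I : finType) (p : I -> R * R) (z : R * R) : nat :=
  #|[set i | p i == z]%SET|.

(* The copies of a diagonal point left free by the points of [p] lying on it are
   renumbered, as in Hilbert's hotel. *)
Definition numbering (I : finType) (p : I -> R * R) (a : I + R * nat) :
    R * R * nat :=
  match a with
  | inl i => (p i, index i (enum [set j | p j == p i]%SET))
  | inr (x, k) => ((x, x), (k + point_count p (x, x))%N)
  end.

Definition above_diagonal (p : R * R) := 0 <= p.1 <= p.2.

Lemma numbering_bij (I : finType) (p : I -> R * R) D :
  (forall i, above_diagonal (p i)) ->
  (forall z, D z = if z.1 < z.2 then point_count p z else 0%N) ->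
  set_bij [set a | if a is inr (x, k) then 0 <= x else True]
          (extended_diagram D) (numbering p).
Proof.
move=> p_above DE.
have idx i : (index i (enum [set j | p j == p i]%SET) < point_count p (p i))%N.
  by rewrite /point_count cardE index_mem mem_enum inE.
split.
- move=> [i|[x k]] /= a_dom; last by right.
  have /andP[p0 ple] := p_above i.
  have [lt_p|ge_p] := ltP (p i).1 (p i).2; first by left; rewrite /= DE lt_p.
  by right; split=> //=; apply/eqP; rewrite eq_le ple.
- move=> [i|[x k]] [j|[y l]] /set_mem /= _ /set_mem /= _.
  + move=> [pij]; rewrite pij => idx_eq; congr inl.
    have im : i \in enum [set j0 | p j0 == p j]%SET by rewrite mem_enum inE pij.
    have jm : j \in enum [set j0 | p j0 == p j]%SET by rewrite mem_enum inE.
    by rewrite -[LHS](nth_index i im) -[RHS](nth_index i jm) idx_eq.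
  + by move=> [pi]; move: (idx i); rewrite pi => /[swap] ->; lia.
  + by move=> [pj]; move: (idx j); rewrite -pj => /[swap] <-; lia.
  + by move=> [-> _] e; congr (inr (_, _)); lia.
- move=> [z k] zk.
  have [k_lt|k_ge] := ltnP k (point_count p z).
    move: (k_lt); rewrite /point_count cardE => k_lt'.
    have [i0 _] : exists i, i \in enum [set i | p i == z]%SET.
      by case: (enum _) k_lt' => // a s _; exists a; rewrite inE eqxx.
    set i := nth i0 (enum [set i | p i == z]%SET) k.
    have := mem_nth i0 k_lt'; rewrite -/i mem_enum inE => /eqP pi.
    by exists (inl i) => //=; rewrite pi index_uniq // enum_uniq.
  have [z_lt|z_diag] := zk; first by move: z_lt; rewrite /= DE; case: ifP; lia.
  case: z z_diag k_ge {zk} => a b /= [<- a0] k_ge.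
  exists (inr (a, (k - point_count p (a, a))%N)) => //=.
  by rewrite subnK.
Qed.

(** Both extended diagrams are numbered by the same set, [I] plus copies of the diagonal, so one
    numbering composed with the inverse of the other is the bijection. A point [p i] may lie on the
    diagonal: it is then an ordinary copy of a diagonal point, available as partner of [q i]. *)
Lemma matched_points (I : finType) (p q : I -> R * R) eps D D' :
  0 <= eps ->
  (forall i, above_diagonal (p i)) -> (forall i, above_diagonal (q i)) ->
  (forall z, D z = if z.1 < z.2 then point_count p z else 0%N) ->
  (forall z, D' z = if z.1 < z.2 then point_count q z else 0%N) ->
  (forall i, linf_dist (p i) (q i) <= eps) -> matched eps D D'.
Proof.
move=> eps0 p_above q_above DE DE' le_pq.
have bp := numbering_bij p_above DE; have bq := numbering_bij q_above DE'.
set A := [set a | _] in bp bq.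
(* The default value is taken only outside the extended diagram. *)
pose inv z := xget (inr (0, 0%N)) [set a | A a /\ numbering p a = z].
have invP z : extended_diagram D z -> A (inv z) /\ numbering p (inv z) = z.
  move=> /(set_bij_surj bp) [a Aa az].
  by rewrite /inv; case: xgetP => [b _ [Ab bz]|/(_ a)[]].
have inv_numbering a : A a -> inv (numbering p a) = a.
  move=> Aa; have ext : extended_diagram D (numbering p a).
    exact: (set_bij_homo bp).
  have [Ai eq_i] := invP _ ext.
  by apply: (set_bij_inj bp) eq_i; apply/mem_set.
have inv_bij : set_bij (extended_diagram D) A inv.
  split.
  - by move=> z zD; case: (invP z zD).
  - move=> z z' /set_mem zD /set_mem zD' e.
    by have [_ <-] := invP z zD; have [_ <-] := invP z' zD'; rewrite e.
  - move=> a Aa; exists (numbering p a); last exact: inv_numbering.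
    exact: (set_bij_homo bp).
exists (numbering q \o inv); first exact: set_bij_comp inv_bij bq.
move=> z zD; have [Ai {1}<-] := invP z zD => /=.
case: (inv z) Ai => [i _|[x k] _] /=; first exact: le_pq.
by rewrite /linf_dist /= subrr normr0 maxxx.
Qed.

End Matching.

(** * Multiplicities as second differences of dimensions *)

Section PersistentRank.
Context (F : fieldType) (n N : nat).
Implicit Types K L : {set {set 'I_n}}.

(** The cycles of K that bound in L. A persistent Betti number is the dimension of the cycles of K
    minus this one, and the first term cancels in differences over L. *)
Definition rank_cap K L : nat :=
  \dim (cycles F K N :&: boundaries F L N)%VS.

Lemma chains_subv K L k : K \subset L -> (chains F K k <= chains F L k)%VS.
Proof.
move=> /fintype.subsetP KL; apply: sub_span => c /mapP[sigma].
rewrite mem_enum inE => /andP[sK ks] ->; apply/mapP; exists sigma => //.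
by rewrite mem_enum inE ks KL.
Qed.

Lemma cycles_subv K L : K \subset L -> (cycles F K N <= cycles F L N)%VS.
Proof. by move=> KL; rewrite capvS ?subvv // chains_subv. Qed.

Lemma boundaries_subv K L :
  K \subset L -> (boundaries F K N <= boundaries F L N)%VS.
Proof. by move=> KL; rewrite limgS // chains_subv. Qed.

Lemma rank_cap_mono K K' L L' : K \subset K' -> L \subset L' ->
  (rank_cap K L <= rank_cap K' L')%N.
Proof.
by move=> KK LL; rewrite dimvS // capvS ?cycles_subv ?boundaries_subv.
Qed.

(** The two spaces on the left both lie in the cycles of K' that bound in L', and they intersect
    exactly in the cycles of K that bound in L. *)
Lemma rank_cap_supermodular K K' L L' : K \subset K' -> L \subset L' ->
  (rank_cap K L' + rank_cap K' L <= rank_cap K' L' + rank_cap K L)%N.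
Proof.
move=> KK LL; rewrite /rank_cap -dimv_sum_cap.
have -> : (cycles F K N :&: boundaries F L' N :&:
    (cycles F K' N :&: boundaries F L N) = cycles F K N :&: boundaries F L N)%VS.
  rewrite -capvA (capvA (boundaries F L' N)) (capvC (boundaries F L' N)).
  rewrite -(capvA (cycles F K' N)) capvA (capv_idPl (cycles_subv KK)).
  by rewrite (capvC (boundaries F L' N)) (capv_idPl (boundaries_subv LL)).
rewrite leq_add2r; apply: dimvS; rewrite subv_add.
by apply/andP; split; apply: capvS; rewrite ?subvv ?cycles_subv ?boundaries_subv.
Qed.

(** None of the truncated subtractions truncates: the inner ones by monotonicity, the outer one by
    supermodularity. *)
Lemma persistent_betti_second_difference K K' L L' :
  K \subset K' -> L \subset L' ->
  ((persistent_betti F K' L N - persistent_betti F K' L' N) -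
   (persistent_betti F K L N - persistent_betti F K L' N))%N%:Z =
  (rank_cap K' L')%:Z - (rank_cap K' L)%:Z
    - ((rank_cap K L')%:Z - (rank_cap K L)%:Z).
Proof.
move=> KK LL; rewrite /persistent_betti -!/(rank_cap _ _).
have le_dim K0 L0 : (rank_cap K0 L0 <= \dim (cycles F K0 N))%N.
  by rewrite dimvS // capvSl.
have := rank_cap_supermodular KK LL.
have := rank_cap_mono (subxx K) LL.
have := rank_cap_mono (subxx K') LL.
have := le_dim K L; have := le_dim K L'.
have := le_dim K' L; have := le_dim K' L'.
lia.
Qed.

End PersistentRank.

Section FunctionDiagram.
Context {R : realType} (F : fieldType) (n N : nat).
Implicit Types f g : {set 'I_n} -> R.

Definition sublevel f (r : R) : {set {set 'I_n}} := [set s | f s <= r]%SET.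
Definition strict_sublevel f (r : R) : {set {set 'I_n}} := [set s | f s < r]%SET.

(** Sublevel sets are treated as plain sets of simplices. Chains, cycles and boundaries make sense
    for them, so that simplices can be added one at a time in any order compatible with [f]. *)
Definition function_diagram f (p : R * R) : nat :=
  let beta := fun K L => persistent_betti F K L N in
  let: (b, d) := p in
  if b < d then
    ((beta (sublevel f b) (strict_sublevel f d) -
      beta (sublevel f b) (sublevel f d)) -
     (beta (strict_sublevel f b) (strict_sublevel f d) -
      beta (strict_sublevel f b) (sublevel f d)))%N
  else 0%N.

Section Chain.
Variable s : seq {set 'I_n}.
Hypotheses (s_uniq : uniq s) (s_all : forall sigma, sigma \in s).

Definition initial (i : nat) : {set {set 'I_n}} :=
  [set sigma | (index sigma s < i)%N]%SET.

(** The multiplicity of (i, j) when one simplex of [s] is added at each stage. It depends on the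
    order alone, so two functions sorted by the same list share it. *)
Definition chain_multiplicity (i j : nat) : int :=
  (rank_cap F N (initial i.+1) (initial j.+1))%:Z
   - (rank_cap F N (initial i.+1) (initial j))%:Z
   - ((rank_cap F N (initial i) (initial j.+1))%:Z
      - (rank_cap F N (initial i) (initial j))%:Z).

Lemma initial_sub i j : (i <= j)%N -> initial i \subset initial j.
Proof.
move=> ij; apply/fintype.subsetP => sigma; rewrite !inE => /leq_trans; exact.
Qed.

Lemma chain_multiplicity_ge0 i j : 0 <= chain_multiplicity i j.
Proof.
have := rank_cap_supermodular F N (initial_sub (leqnSn i))
  (initial_sub (leqnSn j)).
rewrite /chain_multiplicity; lia.
Qed.

Lemma sum_chain_multiplicity a b c e : (a <= b)%N -> (c <= e)%N ->
  \sum_(a <= i < b) \sum_(c <= j < e) chain_multiplicity i j =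
  (rank_cap F N (initial b) (initial e))%:Z
   - (rank_cap F N (initial b) (initial c))%:Z
   - ((rank_cap F N (initial a) (initial e))%:Z
      - (rank_cap F N (initial a) (initial c))%:Z).
Proof.
move=> ab ce.
pose G i j := (rank_cap F N (initial i) (initial j))%:Z.
transitivity (\sum_(a <= i < b) ((G i.+1 e - G i.+1 c) - (G i e - G i c))).
  apply: eq_bigr => i _.
  transitivity (\sum_(c <= j < e) ((G i.+1 j.+1 - G i j.+1) - (G i.+1 j - G i j))).
    by apply: eq_bigr => j _; rewrite /chain_multiplicity /G; lia.
  by rewrite (telescope_sumr (fun j => G i.+1 j - G i j)) //; lia.
by rewrite (telescope_sumr (fun i => G i e - G i c)) //; lia.
Qed.

Section Sorted.
Variable f : {set 'I_n} -> R.
Hypothesis f_sorted : forall i j, (i <= j)%N -> (j < size s)%N ->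
  f (nth finset.set0 s i) <= f (nth finset.set0 s j).

Lemma sublevel_initial r :
  sublevel f r = initial (find (fun sigma => r < f sigma) s).
Proof.
apply/setP => sigma; rewrite !inE.
have sig_s : (index sigma s < size s)%N by rewrite index_mem s_all.
rewrite -{1}(nth_index finset.set0 (s_all sigma)).
case: ltnP => [lt_find|ge_find].
  by have := before_find finset.set0 lt_find; rewrite leNgt => ->.
have hs : has (fun sigma => r < f sigma) s by rewrite has_find (leq_ltn_trans ge_find).
by apply/negbTE; rewrite -ltNge (lt_le_trans (nth_find finset.set0 hs)) // f_sorted.
Qed.

Lemma strict_sublevel_initial r :
  strict_sublevel f r = initial (find (fun sigma => r <= f sigma) s).
Proof.
apply/setP => sigma; rewrite !inE.
have sig_s : (index sigma s < size s)%N by rewrite index_mem s_all.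
rewrite -{1}(nth_index finset.set0 (s_all sigma)).
case: ltnP => [lt_find|ge_find].
  by have := before_find finset.set0 lt_find; rewrite ltNge => ->.
have hs : has (fun sigma => r <= f sigma) s by rewrite has_find (leq_ltn_trans ge_find).
by apply/negbTE; rewrite -leNgt (le_trans (nth_find finset.set0 hs)) // f_sorted.
Qed.

Lemma level_find r i : (i < size s)%N -> (f (nth finset.set0 s i) == r) =
  (find (fun sigma => (r <= f sigma)%R) s <= i
     < find (fun sigma => (r < f sigma)%R) s)%N.
Proof.
move=> i_s; have idx : index (nth finset.set0 s i) s = i by rewrite index_uniq.
have e1 : (f (nth finset.set0 s i) <= r) = (nth finset.set0 s i \in sublevel f r) by rewrite inE.
have e2 : (f (nth finset.set0 s i) < r) = (nth finset.set0 s i \in strict_sublevel f r) by rewrite inE.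
rewrite eq_le e1 [r <= _]leNgt e2 sublevel_initial strict_sublevel_initial !inE idx.
by rewrite -leqNgt andbC.
Qed.

Lemma find_lt_le r : (find (fun sigma => (r <= f sigma)%R) s
  <= find (fun sigma => (r < f sigma)%R) s)%N.
Proof.
elim: (s) => //= sigma s' IH.
by case: ifP => // /negbT; rewrite -ltNge => /ltW; rewrite leNgt => /negbTE ->.
Qed.

(** In a sorted list the simplices of a given value form an interval, and the second difference
    defining the diagram telescopes over the product of two such intervals. *)
Lemma function_diagram_chain b d : b < d ->
  (function_diagram f (b, d))%:Z =
  \sum_(i < size s | f (nth finset.set0 s i) == b)
    \sum_(j < size s | f (nth finset.set0 s j) == d) chain_multiplicity i j.
Proof.
move=> bd; rewrite /function_diagram bd persistent_betti_second_difference; last first.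
- by apply/fintype.subsetP => sigma; rewrite !inE => /ltW.
- by apply/fintype.subsetP => sigma; rewrite !inE => /ltW.
rewrite !sublevel_initial !strict_sublevel_initial.
rewrite -sum_chain_multiplicity ?find_lt_le //.
have level_sum r (G : nat -> int) : \sum_(i < size s | f (nth finset.set0 s i) == r) G i =
    \sum_(find (fun sigma => (r <= f sigma)%R) s <= i
           < find (fun sigma => r < f sigma) s) G i.
  rewrite (big_nat_widen _ _ _ _ _ (find_size _ _)) (big_nat_widenl _ 0%N) //.
  rewrite big_mkord; apply: eq_bigl => i.
  by rewrite level_find //= andbC.
rewrite (level_sum b (fun i => \sum_(j < size s | f (nth finset.set0 s j) == d)
  chain_multiplicity i j)).
by apply: eq_bigr => i _; rewrite (level_sum d (chain_multiplicity i)).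
Qed.

End Sorted.

Lemma matched_chain f g (eps : R) : 0 <= eps ->
  (forall i j, (i <= j)%N -> (j < size s)%N ->
     f (nth finset.set0 s i) <= f (nth finset.set0 s j)) ->
  (forall i j, (i <= j)%N -> (j < size s)%N ->
     g (nth finset.set0 s i) <= g (nth finset.set0 s j)) ->
  (forall sigma, 0 <= f sigma) -> (forall sigma, 0 <= g sigma) ->
  (forall sigma, `|f sigma - g sigma| <= eps) ->
  matched eps (function_diagram f) (function_diagram g).
Proof.
move=> eps0 f_sorted g_sorted f0 g0 fg.
(* Discarding j <= i keeps all points above the diagonal and loses nothing: since the function is
   sorted, values b < d are only reached with i < j. *)
pose mult (ij : 'I_(size s) * 'I_(size s)) :=
  if (ij.1 < ij.2)%N then `|chain_multiplicity ij.1 ij.2|%N else 0%N.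
pose I := {ij : 'I_(size s) * 'I_(size s) & 'I_(mult ij)}.
pose p (h : {set 'I_n} -> R) (x : I) :=
  (h (nth finset.set0 s (tag x).1), h (nth finset.set0 s (tag x).2)).
have lt_tag (x : I) : ((tag x).1 < (tag x).2)%N.
  by case: x => ij [k /=]; rewrite /mult; case: ifP.
have above (h : {set 'I_n} -> R) : (forall i j, (i <= j)%N -> (j < size s)%N ->
     h (nth finset.set0 s i) <= h (nth finset.set0 s j)) -> (forall sigma, 0 <= h sigma) ->
     forall x, above_diagonal (p h x).
  by move=> h_sorted h0 x; rewrite /above_diagonal /= h0 h_sorted // ltnW ?lt_tag.
have diagram (h : {set 'I_n} -> R) : (forall i j, (i <= j)%N -> (j < size s)%N ->
     h (nth finset.set0 s i) <= h (nth finset.set0 s j)) -> forall z, function_diagram h z =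
     if z.1 < z.2 then point_count (p h) z else 0%N.
  move=> h_sorted [b d]; case: ifPn => [/= bd|/negbTE /= nbd]; last by rewrite nbd.
  apply/eqP; rewrite -eqz_nat function_diagram_chain //.
  rewrite pair_big_dep /= /point_count.
  have -> : #|[set x | p h x == (b, d)]%SET| =
      (\sum_(ij : 'I_(size s) * 'I_(size s) | (h (nth finset.set0 s ij.1) == b) && (h (nth finset.set0 s ij.2) == d))
         mult ij)%N.
    rewrite -sum1_card (eq_bigr (fun ij => \sum_(k < mult ij) 1)%N); last first.
      by move=> ij _; rewrite sum1_card card_ord.
    rewrite sig_big_dep /=; apply: eq_bigl => x.
    by rewrite inE /p xpair_eqE /= andbT.
  rewrite (big_morph Posz PoszD (erefl 0%:Z)); apply/eqP; apply: eq_bigr.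
  move=> [i j] /= /andP[/eqP hi /eqP hj]; rewrite /mult /=.
  have -> : (i < j)%N.
    by rewrite ltnNge; apply: contraTN bd => ji; rewrite -leNgt -hi -hj h_sorted.
  by rewrite gez0_abs ?chain_multiplicity_ge0.
apply: (@matched_points _ _ (p f) (p g)) => //; try exact: diagram; try exact: above.
by move=> x; rewrite /linf_dist ge_max !fg.
Qed.

End Chain.
End FunctionDiagram.

(** * Moving from one filtration function to another *)

Section Interpolation.
Context {R : realType} (F : fieldType) (n N : nat).
Implicit Types f g : {set 'I_n} -> R.

Lemma matched_concordant f g (eps : R) : 0 <= eps ->
  (forall s t, f s < f t -> g s <= g t) ->
  (forall s, 0 <= f s) -> (forall s, 0 <= g s) ->
  (forall s, `|f s - g s| <= eps) ->
  matched eps (function_diagram F N f) (function_diagram F N g).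
Proof.
move=> eps0 fg f0 g0 dfg.
(* As no pair is strictly ordered in opposite ways, sorting by the sum sorts both functions; ties of
   one of them are broken by the other. *)
pose leh : rel {set 'I_n} := fun s t => f s + g s <= f t + g t.
pose l := sort leh (enum {set 'I_n}).
have lehf s t : leh s t -> f s <= f t.
  by rewrite /leh !leNgt; apply: contra => /[dup] /fg; lra.
have lehg s t : leh s t -> g s <= g t.
  rewrite /leh => le_h; rewrite leNgt; apply/negP => lt_g.
  have : f t <= f s by rewrite leNgt; apply/negP => /fg; lra.
  lra.
have l_all s : s \in l by rewrite mem_sort mem_enum.
have l_uniq : uniq l by rewrite sort_uniq enum_uniq.
have leh_nth i j : (i <= j)%N -> (j < size l)%N ->
    leh (nth finset.set0 l i) (nth finset.set0 l j).
  move=> ij jl; apply: (@sorted_leq_nth _ leh) => //.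
  - by move=> a b c; rewrite /leh; apply: le_trans.
  - by move=> a; rewrite /leh.
  - by apply: sort_sorted => a b; rewrite /leh; exact: le_total.
  - by rewrite inE (leq_ltn_trans ij).
apply: (@matched_chain _ F n N l) => // i j ij jl.
- by apply: lehf; exact: leh_nth.
- by apply: lehg; exact: leh_nth.
Qed.

Definition discordant f g : {set {set 'I_n} * {set 'I_n}} :=
  [set st | (f st.1 < f st.2) && (g st.2 < g st.1)]%SET.

(* On the segment from [f] to [g], cut at the first time where a discordant pair
   meets, the first piece is concordant and the second one has fewer discordant
   pairs. *)
Lemma matched_function_diagram f g (eps : R) :
  (forall s, 0 <= f s) -> (forall s, 0 <= g s) ->
  (forall s, `|f s - g s| <= eps) ->
  matched eps (function_diagram F N f) (function_diagram F N g).
Proof.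
move: {2}(#|discordant f g|) (leqnn #|discordant f g|) => k.
elim: k f g eps => [|k IH] f g eps disc f0 g0 fg.
  have eps0 : 0 <= eps by apply: le_trans (fg finset.set0).
  apply: matched_concordant => // s t st; rewrite leNgt; apply/negP => ts.
  move: disc; rewrite leqn0 cards_eq0 => /eqP/setP/(_ (s, t)).
  by rewrite !inE /= st ts.
have [disc0|[st0 st0P]] := set_0Vmem (discordant f g).
  by apply: IH => //; rewrite disc0 cards0.
have eps0 : 0 <= eps by apply: le_trans (fg finset.set0).
(* The parameter at which the two simplices of a discordant pair have equal values on the
   segment. *)
pose time (st : {set 'I_n} * {set 'I_n}) :=
  (f st.2 - f st.1) / ((f st.2 - f st.1) + (g st.1 - g st.2)).
have [[s0 t0] st0_disc T_min] :
    exists2 st, st \in discordant f g & forall st', st' \in discordant f g -> time st <= time st'.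
  by case: (@arg_minP _ R _ st0 (fun st => st \in discordant f g) time st0P) => st; exists st.
have /andP[/= f_st g_st] : (f s0 < f t0) && (g t0 < g s0) by move: st0_disc; rewrite inE.
set T := time (s0, t0) in T_min.
have TE : T * ((f t0 - f s0) + (g s0 - g t0)) = f t0 - f s0.
  by rewrite /T /time /= divfK //; lra.
have T0 : 0 < T by apply: divr_gt0 => /=; lra.
have T1 : T < 1 by rewrite /T /time /= ltr_pdivrMr; lra.
pose h s := (1 - T) * f s + T * g s.
have h0 s : 0 <= h s by rewrite addr_ge0 // mulr_ge0 ?f0 ?g0 //; lra.
have fh s : `|f s - h s| <= T * eps.
  rewrite /h (_ : _ - _ = T * (f s - g s)); last by ring.
  by rewrite normrM gtr0_norm // ler_wpM2l // ltW.
have hg s : `|h s - g s| <= (1 - T) * eps.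
  rewrite /h (_ : _ - _ = (1 - T) * (f s - g s)); last by ring.
  by rewrite normrM ger0_norm ?ler_wpM2l //; lra.
rewrite (_ : eps = T * eps + (1 - T) * eps); last by ring.
apply: (@matched_trans _ _ _ _ (function_diagram F N h)).
  apply: matched_concordant => //; first by rewrite mulr_ge0 // ltW.
  move=> s t st; rewrite /h; have [g_le|g_lt] := leP (g s) (g t).
    by rewrite lerD // ler_wpM2l //; lra.
  have := T_min (s, t); rewrite inE /= st g_lt => /(_ isT).
  rewrite /time /= ler_pdivlMr; last by lra.
  nra.
apply: IH => //; rewrite -ltnS; apply: leq_trans disc; apply: proper_card.
apply/properP; split.
  apply/fintype.subsetP => -[s t]; rewrite !inE /= => /andP[h_st lt_g].
  rewrite lt_g andbT ltNge; apply/negP => le_f; move: h_st; rewrite /h.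
  have : T * g t < T * g s by rewrite ltr_pM2l.
  have : (1 - T) * f t <= (1 - T) * f s by rewrite ler_wpM2l //; lra.
  lra.
exists (s0, t0); first by rewrite inE /= f_st.
by rewrite inE negb_and -leNgt /h /=; apply/orP; left; nra.
Qed.

End Interpolation.

(** * From Rips complexes to pairwise distances *)

Section RipsStability.
Context {R : realType}.

(** Half the diameter, the parameter at which a nonempty simplex enters. The empty simplex gets 0
    here but belongs to [rips X r] for every r, even negative. *)
Definition rips_function (m n : nat) (X : 'M[R]_(m, n)) (sigma : {set 'I_n}) : R :=
  \big[Num.max/0]_(i in sigma) \big[Num.max/0]_(j in sigma)
    (eucl_dist (col i X) (col j X) / 2).

Lemma eucl_dist_ge0 m (x y : 'cV[R]_m) : 0 <= eucl_dist x y.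
Proof. exact: sqrtr_ge0. Qed.

Lemma eucl_dist_le m (x y : 'cV[R]_m) (r : R) : 0 <= r ->
  (eucl_dist x y <= r) = (\sum_(k < m) (x k 0 - y k 0) ^+ 2 <= r ^+ 2).
Proof.
move=> r0; rewrite -ler_sqr ?nnegrE ?eucl_dist_ge0 // sqr_sqrtr //.
by apply: sumr_ge0 => k _; exact: sqr_ge0.
Qed.

(** If the balls share p, use |x - y|^2 <= 2 |x - p|^2 + 2 |y - p|^2; conversely the midpoint is a
    common point. *)
Lemma balls_meet m (x y : 'cV[R]_m) (r : R) :
  (exists p : 'cV[R]_m, eucl_dist x p <= r /\ eucl_dist y p <= r) <->
  eucl_dist x y / 2 <= r.
Proof.
split=> [[p [xp yp]]|xy].
  have r0 : 0 <= r by apply: le_trans xp; exact: eucl_dist_ge0.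
  move: xp yp; rewrite ler_pdivrMr // !eucl_dist_le ?mulr_ge0 // => xp yp.
  apply: (@le_trans _ _ (\sum_(k < m)
      (2 * (x k 0 - p k 0) ^+ 2 + 2 * (y k 0 - p k 0) ^+ 2))).
    by apply: ler_sum => k _; have := sqr_ge0 ((x k 0 - p k 0) + (y k 0 - p k 0)); nra.
  by rewrite big_split -!mulr_sumr /=; nra.
have r0 : 0 <= r by apply: le_trans xy; rewrite divr_ge0 ?eucl_dist_ge0.
move: xy; rewrite ler_pdivrMr // eucl_dist_le ?mulr_ge0 // => xy.
have half (z w : 'cV[R]_m) : \sum_(k < m) (z k 0 - (2^-1 *: (z + w)) k 0) ^+ 2 =
    (\sum_(k < m) (z k 0 - w k 0) ^+ 2) / 4.
  by rewrite mulr_suml; apply: eq_bigr => k _; rewrite !mxE; field.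
have sumC : \sum_(k < m) (y k 0 - x k 0) ^+ 2 = \sum_(k < m) (x k 0 - y k 0) ^+ 2.
  by apply: eq_bigr => k _; rewrite -sqrrN opprB.
exists (2^-1 *: (x + y)); rewrite !eucl_dist_le // half; split; first by lra.
by rewrite addrC half sumC; lra.
Qed.

Lemma mem_rips m n (X : 'M[R]_(m, n)) (r : R) (sigma : {set 'I_n}) :
  sigma != finset.set0 -> (sigma \in rips X r) = (rips_function X sigma <= r).
Proof.
case/set0Pn => i0 i0s; rewrite inE; apply/idP/idP.
  move=> /asboolP meet.
  have r0 : 0 <= r.
    have /balls_meet := meet _ _ i0s i0s; apply: le_trans.
    by rewrite divr_ge0 ?eucl_dist_ge0.
  apply: bigmax_le => // i i_s; apply: bigmax_le => // j j_s.
  by apply/balls_meet; exact: meet.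
move=> le_r; apply/asboolP => i j i_s j_s; apply/balls_meet.
apply: le_trans le_r; apply: le_trans (le_bigmax_cond _ _ i_s) => /=.
exact: (le_trans _ (le_bigmax_cond _ _ j_s)).
Qed.

Lemma mem_rips_before m n (X : 'M[R]_(m, n)) (r : R) (sigma : {set 'I_n}) :
  sigma != finset.set0 ->
  (sigma \in rips_before X r) = (rips_function X sigma < r).
Proof.
move=> s0; rewrite inE; apply/asboolP/idP => [[r' r'r]|lt_r].
  by rewrite mem_rips // => /le_lt_trans; apply.
by exists (rips_function X sigma) => //; rewrite mem_rips.
Qed.

(** Chains of degree [k] only involve simplices with [k.+1] vertices, so the empty simplex, on which
    the two descriptions of the Rips filtration disagree, has no effect. *)
Lemma chains_nonempty (F : fieldType) n (K L : {set {set 'I_n}}) k :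
  (forall sigma, sigma != finset.set0 -> (sigma \in K) = (sigma \in L)) ->
  chains F K k = chains F L k.
Proof.
move=> KL; rewrite /chains.
have -> // : [set tau in K | #|tau| == k.+1]%SET = [set tau in L | #|tau| == k.+1]%SET.
apply/setP => sigma; rewrite !inE.
have [->|/KL -> //] := eqVneq sigma finset.set0.
by rewrite cards0 !andbF.
Qed.

Lemma persistent_betti_nonempty (F : fieldType) n N (K K' L L' : {set {set 'I_n}}) :
  (forall sigma, sigma != finset.set0 -> (sigma \in K) = (sigma \in K')) ->
  (forall sigma, sigma != finset.set0 -> (sigma \in L) = (sigma \in L')) ->
  persistent_betti F K L N = persistent_betti F K' L' N.
Proof.
move=> KK LL; rewrite /persistent_betti /cycles /boundaries.
by rewrite (chains_nonempty F N KK) (chains_nonempty F N.+1 LL).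
Qed.

Lemma persistence_diagramE (F : fieldType) m n (X : 'M[R]_(m, n)) N :
  persistence_diagram F X N = function_diagram F N (rips_function X).
Proof.
apply/funext => -[b d]; rewrite /persistence_diagram /function_diagram.
case: ifP => // _.
by congr (_ - _ - (_ - _))%N; apply: persistent_betti_nonempty => sigma s0;
  rewrite ?mem_rips ?mem_rips_before // inE.
Qed.

Lemma bigmax_dist (I : finType) (P : pred I) (a b : I -> R) (eps : R) :
  0 <= eps -> (forall i, P i -> a i <= b i + eps) ->
  \big[Num.max/0]_(i | P i) a i <= \big[Num.max/0]_(i | P i) b i + eps.
Proof.
move=> eps0 ab; apply: bigmax_le => [|i Pi].
  by rewrite addr_ge0 // bigmax_idl le_max lexx.
by apply: (le_trans (ab i Pi)); rewrite lerD2r; exact: le_bigmax_cond.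
Qed.

Lemma bottleneck_rips (F : fieldType) m m' n (X : 'M[R]_(m, n)) (Y : 'M[R]_(m', n)) N
    (eps : R) : 0 <= eps ->
  (forall i j, `|eucl_dist (col i X) (col j X) - eucl_dist (col i Y) (col j Y)|
     <= eps) ->
  (`|bottleneck (persistence_diagram F X N) (persistence_diagram F Y N)|
     <= eps%:E)%E.
Proof.
move=> eps0 XY; apply: bottleneck_le; rewrite !persistence_diagramE.
apply: matched_function_diagram => s.
- by rewrite /rips_function bigmax_idl le_max lexx.
- by rewrite /rips_function bigmax_idl le_max lexx.
rewrite ler_distl lerBlDr; apply/andP; split;
  apply: bigmax_dist => // i _; apply: bigmax_dist => // j _;
  by have := XY i j; rewrite ler_distl => /andP[]; lra.
Qed.

End RipsStability.

(** * The discriminant of a centered Gram matrix *)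

Section Discriminant.
Context {R : realFieldType}.

(* The Hankel determinant of the power sums, which is the discriminant of the
   characteristic polynomial. *)
Definition discr n (A : 'M[R]_n.+1) : R :=
  \det (\matrix_(i < n.+1, j < n.+1) \tr (A ^+ (i + j))).

Lemma expmx_conj n (V A : 'M[R]_n.+1) k : V *m V^T = 1%:M ->
  (V^T *m A *m V) ^+ k = V^T *m A ^+ k *m V.
Proof.
move=> VV; elim: k => [|k IH].
  by rewrite !expr0 mulmx1; rewrite (mulmx1C VV).
by rewrite !exprS -!mulmxE IH !mulmxA -[_ *m V *m V^T]mulmxA VV mulmx1.
Qed.

Lemma expmx_diag n (a : 'rV[R]_n.+1) k :
  diag_mx a ^+ k = diag_mx (\row_i a 0 i ^+ k).
Proof.
elim: k => [|k IH]; apply/matrixP => i j.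
  by rewrite expr0 !mxE expr0.
rewrite exprS IH -mulmxE mul_diag_mx !mxE exprS.
by have [->|] := eqVneq i j; rewrite ?mulr1n // !mulr0n mulr0.
Qed.

(** The Hankel matrix of the power sums is the Vandermonde matrix times its transpose. *)
Lemma discr_diag_conj n (V : 'M[R]_n.+1) (a : 'rV[R]_n.+1) :
  V *m V^T = 1%:M ->
  discr (V^T *m diag_mx a *m V) =
  (\prod_(i < n.+1) \prod_(j < n.+1 | (i < j)%N) (a 0 j - a 0 i)) ^+ 2.
Proof.
move=> VV; rewrite -det_Vandermonde expr2 -{2}det_tr -det_mulmx.
congr (\det _); apply/matrixP => i j; rewrite !mxE expmx_conj // mxtrace_mulC.
rewrite mulmxA VV mul1mx expmx_diag mxtrace_diag.
by apply: eq_bigr => k _; rewrite !mxE exprD.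
Qed.

(** Entry (i, j) is multiplied by c^(i + j), that is, row i by c^i and column j by c^j. *)
Lemma discrZ n (c : R) (A : 'M[R]_n.+1) :
  discr (c *: A) = (\prod_(i < n.+1) c ^+ i) ^+ 2 * discr A.
Proof.
rewrite /discr; set M := (X in _ = _ * \det X).
transitivity (\det (diag_mx (\row_i c ^+ i) *m M *m diag_mx (\row_i c ^+ i))).
  congr (\det _); apply/matrixP => i j; rewrite mul_diag_mx mul_mx_diag !mxE.
  by rewrite exprZn mxtraceZ exprD mulrAC.
rewrite !det_mulmx det_diag expr2.
rewrite (eq_bigr (fun i : 'I_n.+1 => c ^+ i)); last by move=> i _; rewrite mxE.
by rewrite mulrAC.
Qed.

Lemma trmxX n (A : 'M[R]_n.+1) k : (A ^+ k)^T = A^T ^+ k.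
Proof.
elim: k => [|k IH]; first by rewrite !expr0 trmx1.
by rewrite exprS exprSr -!mulmxE trmx_mul IH.
Qed.

(* The matrix in [discr] is the Gram matrix of the powers of [A] for the trace
   form. *)
Lemma discr_sym_neq0 n (A : 'M[R]_n.+1) : A^T = A ->
  (forall p : {poly R}, (size p <= n.+1)%N -> horner_mx A p = 0 -> p = 0) ->
  discr A != 0.
Proof.
move=> symA indep; apply/det0P => -[c c0 cM].
pose p := \poly_(i < n.+1) c 0 (inord i).
have pA : horner_mx A p = \sum_(i < n.+1) c 0 i *: A ^+ i.
  rewrite /p poly_def rmorph_sum; apply: eq_bigr => i _ /=.
  by rewrite inord_val -mul_polyC rmorphM /= horner_mx_C rmorphXn /= horner_mx_X
    -mulmxE mul_scalar_mx.
(* A kernel vector is the coefficient list of a polynomial p with tr(p(A)^2) = 0. As p(A) is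
   symmetric, this trace is the sum of the squares of its entries. *)
have tr0 : \tr (horner_mx A p *m horner_mx A p) = 0.
  have : (c *m (\matrix_(i < n.+1, j < n.+1) \tr (A ^+ (i + j))) *m c^T) 0 0 = 0.
    by rewrite cM mul0mx mxE.
  rewrite pA mulmx_sumr raddf_sum /= => cMc; rewrite -[RHS]cMc mxE.
  apply: eq_bigr => j _; rewrite !mxE mulmx_suml raddf_sum /= mulr_suml.
  apply: eq_bigr => i _; rewrite !mxE -scalemxAl -scalemxAr mulmxE -exprD.
  by rewrite !mxtraceZ mulrAC mulrA.
have symp : (horner_mx A p)^T = horner_mx A p.
  rewrite pA linear_sum /=; apply: eq_bigr => i _.
  by rewrite linearZ /= trmxX symA.
have pA0 : horner_mx A p = 0.
  apply/matrixP => i j; rewrite mxE; apply/eqP; rewrite -sqrf_eq0.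
  move: tr0; rewrite -{1}symp /mxtrace.
  rewrite (eq_bigr (fun k => \sum_l horner_mx A p l k ^+ 2)); last first.
    by move=> k _; rewrite !mxE; apply: eq_bigr => l _; rewrite mxE expr2.
  move/eqP; rewrite psumr_eq0; last by move=> k _; apply: sumr_ge0 => l _; rewrite sqr_ge0.
  move/allP => /(_ j (mem_index_enum _)) /=.
  rewrite psumr_eq0; last by move=> l _; rewrite sqr_ge0.
  by move/allP => /(_ i (mem_index_enum _)).
have p0 : p = 0 by apply: indep => //; exact: size_poly.
move/eqP: c0; apply; apply/rowP => i; rewrite mxE.
by have := congr1 (fun q : {poly R} => q`_i) p0; rewrite coef_poly ltn_ord inord_val coef0.
Qed.

Section Centering.
Variable n : nat.

Definition centering : 'M[R]_n.+1 := 1%:M - const_mx (n.+1%:R^-1).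

Local Notation J := centering.
Local Notation one := (const_mx 1 : 'cV[R]_n.+1).

Lemma const_mx_mul p (c : R) (A : 'M[R]_(n.+1, p)) i j :
  (const_mx c *m A : 'M[R]_(n.+1, p)) i j = c * \sum_k A k j.
Proof. by rewrite mxE mulr_sumr; apply: eq_bigr => k _; rewrite mxE. Qed.

Lemma centering_sym : J^T = J.
Proof. by rewrite /J linearB /= trmx1 trmx_const. Qed.

Lemma centering_one : J *m one = 0.
Proof.
rewrite mulmxBl mul1mx; apply/matrixP => i j; rewrite !mxE.
rewrite (eq_bigr (fun=> n.+1%:R^-1)); last by move=> k _; rewrite !mxE mulr1.
by rewrite sumr_const card_ord -[_^-1 *+ _]mulr_natr mulVf ?subrr ?pnatr_eq0.
Qed.

Lemma centering_mulP p (A : 'M[R]_(n.+1, p)) i j :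
  (J *m A) i j = A i j - n.+1%:R^-1 * \sum_k A k j.
Proof. by rewrite mulmxBl mul1mx mxE [X in _ + X]mxE const_mx_mul. Qed.

Lemma centering_fix p (A : 'M[R]_(n.+1, p)) : one^T *m A = 0 -> J *m A = A.
Proof.
move=> A0; apply/matrixP => i j; rewrite centering_mulP.
have := congr1 (fun M : 'M[R]_(1, p) => M 0 j) A0; rewrite !mxE => sum0.
rewrite (_ : \sum_k A k j = 0) ?mulr0 ?subr0 // -[RHS]sum0.
by apply: eq_bigr => k _; rewrite !mxE mul1r.
Qed.

Lemma one_centering : one^T *m J = 0.
Proof. by rewrite -[LHS]trmxK trmx_mul trmxK centering_sym centering_one trmx0. Qed.

Lemma centering_idem : J *m J = J.
Proof. by rewrite centering_fix // one_centering. Qed.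

Section Krylov.
Variable a : 'rV[R]_n.+1.
Local Notation D := (diag_mx a).

(** On vectors of the form (g(a_i)), the matrix J D multiplies g by X and subtracts a constant, the
    mean. The degree is tracked because g = 0 must force f = 0. *)
Lemma krylov_centered_diag (f : {poly R}) : exists2 g : {poly R},
  size g = size f & forall i, (horner_mx (J *m D) f *m one) i 0 = g.[a 0 i].
Proof.
elim/poly_ind: f => [|f c [g szg gE]].
  by exists 0; rewrite ?size_poly0 // => i; rewrite rmorph0 mul0mx mxE horner0.
pose mean := n.+1%:R^-1 * \sum_k a 0 k * g.[a 0 k].
exists (g * 'X + (c - mean)%:P).
  rewrite !size_MXaddC; have [f0|f0] := eqVneq f 0.
    have g0 : g = 0 by apply/eqP; rewrite -size_poly_eq0 szg f0 size_poly0.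
    rewrite /mean g0 (eq_bigr (fun=> 0)) ?sumr_const ?mul0rn ?mulr0 ?subr0.
      by rewrite f0 eqxx !size_poly0.
    by move=> k _; rewrite horner0 mulr0.
  have -> : (g == 0) = false by rewrite -size_poly_eq0 szg size_poly_eq0 (negbTE f0).
  by rewrite szg.
move=> i; rewrite rmorphD /= rmorphM /= horner_mx_X horner_mx_C.
rewrite -[_ * _]/(horner_mx (J *m D) f *m (J *m D)).
rewrite (comm_horner_mx f (erefl (J *m D *m (J *m D)))).
rewrite mulmxDl mul_scalar_mx hornerD hornerMX hornerC.
rewrite mxE -!mulmxA centering_mulP.
have E k : (D *m (horner_mx (J *m D) f *m one)) k 0 = a 0 k * g.[a 0 k].
  by rewrite mul_diag_mx mxE gE.
rewrite E !mxE mulr1 (eq_bigr (fun k => a 0 k * g.[a 0 k])) => [|k _]; last exact: E.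
by rewrite /mean; ring.
Qed.

End Krylov.
End Centering.
End Discriminant.

Section CenteredDiagonal.
Context {R : realFieldType} (n : nat) (a : 'rV[R]_n.+1).
Hypotheses (a_inj : injective (fun i => a 0 i)) (a_gt0 : forall i, 0 < a 0 i).
Local Notation J := (centering n).
Local Notation D := (diag_mx a).
Local Notation one := (const_mx 1 : 'cV[R]_n.+1).

(** The constant vector is cyclic for J D: the associated g has degree at most n and vanishes at the
    n + 1 distinct a_i. *)
Lemma krylov_inj (f : {poly R}) : (size f <= n.+1)%N ->
  horner_mx (J *m D) f *m one = 0 -> f = 0.
Proof.
move=> szf f0; have [g szg gE] := krylov_centered_diag a f.
apply/eqP; rewrite -size_poly_eq0 -szg size_poly_eq0; apply/eqP.
apply: (@roots_geq_poly_eq0 _ g (codom (fun i => a 0 i))).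
- by apply/allP => _ /codomP[i ->]; rewrite /root -gE f0 mxE.
- by rewrite /codom map_inj_uniq ?enum_uniq.
- by rewrite size_codom card_ord szg.
Qed.

(** On the image of J the form y^T J D y equals y^T D y, which is positive definite. *)
Lemma centered_diag_inj (y : 'cV[R]_n.+1) :
  J *m y = y -> J *m (D *m y) = 0 -> y = 0.
Proof.
move=> Jy JDy; have : (y^T *m (D *m y)) 0 0 = 0.
  by rewrite -{1}Jy trmx_mul centering_sym -mulmxA JDy mulmx0 mxE.
rewrite mxE => /eqP; rewrite (eq_bigr (fun i => a 0 i * y i 0 ^+ 2)); last first.
  by move=> i _; rewrite mul_diag_mx !mxE; ring.
rewrite psumr_eq0; last by move=> i _; rewrite mulr_ge0 ?sqr_ge0 // ltW.
move/allP => y0; apply/colP => i; rewrite mxE.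
have := y0 i (mem_index_enum _); rewrite mulf_eq0 gt_eqF //= sqrf_eq0.
by move/eqP.
Qed.

(** The constant vector is cyclic for B = J D but killed by A = J D J, whence a detour. The identity
    A B = B B turns p(A) = 0 into B p(B) = 0. Since A kills the constant vector, p(0) = 0, so p(B)
    maps that vector into the image of J, where B is injective; cyclicity then gives p = 0. *)
Lemma discr_centered_diag_neq0 : discr (J *m D *m J) != 0.
Proof.
set A := J *m D *m J; set B := J *m D.
apply: discr_sym_neq0 => [|p szp pA0].
  by rewrite /A !trmx_mul centering_sym tr_diag_mx mulmxA.
have AB : A *m B = B *m B.
  by rewrite /A /B !mulmxA -[_ *m J *m J]mulmxA centering_idem.
have horner_AB q : horner_mx A q *m B = B *m horner_mx B q.
  elim/poly_ind: q => [|q c IH]; first by rewrite !rmorph0 mul0mx mulmx0.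
  rewrite !rmorphD /= !rmorphM /= !horner_mx_X !horner_mx_C mulmxDl mulmxDr.
  rewrite -!mulmxE -(mulmxA _ A B) AB (mulmxA _ B B) IH -(mulmxA B); congr (_ + _).
  by rewrite mul_scalar_mx mul_mx_scalar.
have A1 : A *m one = 0 by rewrite /A -mulmxA centering_one mulmx0.
have [q [c pE]] : exists q, exists c, p = q * 'X + c%:P.
  by elim/poly_ind: (p) => [|q c _]; [exists 0, 0; rewrite mul0r add0r|exists q, c].
have c0 : c = 0.
  have := congr1 (fun M => (M *m one) 0 0) pA0.
  rewrite pE rmorphD /= rmorphM /= horner_mx_X horner_mx_C -mulmxE mulmxDl.
  by rewrite -mulmxA A1 mulmx0 add0r mul_scalar_mx mul0mx !mxE mulr1.
set y := horner_mx B p *m one.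
have Jy : J *m y = y.
  rewrite /y pE c0 addr0 rmorphM /= horner_mx_X -mulmxE.
  rewrite (comm_horner_mx q (erefl (B *m B))) !mulmxA.
  by rewrite centering_idem.
have y0 : y = 0.
  apply: centered_diag_inj => //.
  by rewrite !mulmxA -/B -horner_AB pA0 !mul0mx.
exact: krylov_inj y0.
Qed.

End CenteredDiagonal.

(** * Polynomial dependence on a parameter *)

Section PolynomialFunctions.
Context {R : comNzRingType}.

Definition poly_fun (k : nat) (f : R -> R) : Prop :=
  exists2 p : {poly R}, (size p <= k.+1)%N & forall t, f t = p.[t].

Lemma poly_funW k l f : (k <= l)%N -> poly_fun k f -> poly_fun l f.
Proof. by move=> kl [p szp pE]; exists p => //; apply: leq_trans szp _. Qed.

Lemma poly_fun_cst c : poly_fun 0 (fun=> c).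
Proof. by exists c%:P => [|t]; rewrite ?hornerC ?size_polyC_leq1. Qed.

Lemma poly_fun_id : poly_fun 1 id.
Proof. by exists 'X => [|t]; rewrite ?hornerX ?size_polyX. Qed.

Lemma poly_funD k f g :
  poly_fun k f -> poly_fun k g -> poly_fun k (fun t => f t + g t).
Proof.
move=> [p szp pE] [q szq qE]; exists (p + q) => [|t]; last by rewrite hornerD pE qE.
by rewrite (leq_trans (size_polyD _ _)) // geq_max szp.
Qed.

Lemma poly_funM k l f g :
  poly_fun k f -> poly_fun l g -> poly_fun (k + l) (fun t => f t * g t).
Proof.
move=> [p szp pE] [q szq qE]; exists (p * q) => [|t]; last by rewrite hornerM pE qE.
rewrite (leq_trans (size_polyMleq _ _)) //; lia.
Qed.

Lemma poly_fun_sum (I : Type) (r : seq I) (P : pred I) k (F : I -> R -> R) :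
  (forall i, poly_fun k (F i)) -> poly_fun k (fun t => \sum_(i <- r | P i) F i t).
Proof.
move=> FP; elim: r => [|i r IH].
  by apply: (@poly_funW 0) => //; have [p ? pE] := poly_fun_cst 0; exists p => // t; rewrite big_nil.
have [p szp pE] : poly_fun k (fun t => (if P i then F i t else 0) + \sum_(j <- r | P j) F j t).
  apply: poly_funD => //; case: (P i) => //.
  by apply: (@poly_funW 0) => //; exact: poly_fun_cst.
by exists p => // t; rewrite big_cons -pE; case: (P i); rewrite ?add0r.
Qed.

Lemma poly_fun_prod (m : nat) k (F : 'I_m -> R -> R) :
  (forall i, poly_fun k (F i)) -> poly_fun (m * k) (fun t => \prod_(i < m) F i t).
Proof.
elim: m F => [|m IH] F FP.
  by have [p ? pE] := poly_fun_cst 1; exists p => // t; rewrite big_ord0.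
have [p szp pE] := poly_funM (FP ord0) (IH (fun i => F (lift ord0 i)) (fun i => FP _)).
by exists p => // t; rewrite big_ord_recl pE.
Qed.

End PolynomialFunctions.

Section PolynomialDiscriminant.
Context {R : realFieldType}.

Lemma poly_fun_expmx n k (A : R -> 'M[R]_n.+1) m :
  (forall i j, poly_fun k (fun t => A t i j)) ->
  forall i j, poly_fun (m * k) (fun t => (A t ^+ m) i j).
Proof.
move=> AP; elim: m => [|m IH] i j.
  have [p ? pE] := @poly_fun_cst R ((i == j)%:R); exists p => // t.
  by rewrite expr0 mxE -pE.
have [p szp pE] := poly_fun_sum (index_enum 'I_n.+1) xpredT
  (fun l => poly_funM (AP i l) (IH l j)).
by exists p => // t; rewrite exprS -mulmxE mxE pE.
Qed.

(** The entries are traces of powers with exponent at most 2n, and the determinant multiplies n + 1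
    of them. *)
Lemma poly_fun_discr n k (A : R -> 'M[R]_n.+1) :
  (forall i j, poly_fun k (fun t => A t i j)) ->
  poly_fun (n.+1 * ((2 * n) * k)) (fun t => discr (A t)).
Proof.
move=> AP; have entry i j : poly_fun ((2 * n) * k)
    (fun t => (\matrix_(i < n.+1, j < n.+1) \tr (A t ^+ (i + j))) i j).
  have [p szp pE] : poly_fun ((2 * n) * k) (fun t => \tr (A t ^+ (i + j))).
    apply: poly_fun_sum => l; apply: poly_funW (poly_fun_expmx (i + j) AP l l).
    by rewrite leq_mul2r mulSn mul1n leq_add ?orbT // -ltnS ltn_ord.
  by exists p => // t; rewrite mxE pE.
rewrite /discr /determinant.
apply: poly_fun_sum => s; rewrite -[X in poly_fun X]add0n.
by apply: poly_funM; [exact: poly_fun_cst|exact: poly_fun_prod].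
Qed.

(** The value at t is a linear combination of the values at the nodes, with weights [u] solving a
    Vandermonde system. The constant is the sum of the absolute values of the weights, so it does
    not depend on the polynomial. *)
Lemma interpolation_bound (I : finType) (tau : I -> R) (t : R) :
  injective tau -> exists2 c : R, 0 <= c &
  forall (p : {poly R}) (e : R), (size p <= #|I|)%N ->
    (forall i, `|p.[tau i]| <= e) -> `|p.[t]| <= c * e.
Proof.
move=> tau_inj; set k := #|I|.
pose r : 'rV[R]_k := \row_j tau (enum_val j).
have uV : Vandermonde k r \in unitmx.
  rewrite unitmxE det_Vandermonde unitfE; apply/prodf_neq0 => i _.
  apply/prodf_neq0 => j ij; rewrite !mxE subr_eq0; apply/eqP => /tau_inj/enum_val_inj eij.
  by rewrite eij ltnn in ij.
pose u : 'cV[R]_k := invmx (Vandermonde k r) *m \col_i t ^+ i.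
have uE (i : 'I_k) : t ^+ i = \sum_j r 0 j ^+ i * u j 0.
  have : (Vandermonde k r *m u) i 0 = t ^+ i by rewrite mulKVmx // mxE.
  by rewrite mxE => <-; apply: eq_bigr => j _; rewrite mxE.
exists (\sum_j `|u j 0|) => [|p e szp pe]; first by apply: sumr_ge0.
have -> : p.[t] = \sum_j u j 0 * p.[r 0 j].
  rewrite (horner_coef_wide _ szp) (eq_bigr (fun i : 'I_k => \sum_j u j 0 * (p`_i * r 0 j ^+ i))).
    rewrite exchange_big /=; apply: eq_bigr => j _.
    by rewrite (horner_coef_wide _ szp) mulr_sumr.
  by move=> i _; rewrite uE mulr_sumr; apply: eq_bigr => j _; ring.
rewrite mulr_suml; apply: (le_trans (ler_norm_sum _ _ _)); apply: ler_sum => j _.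
by rewrite normrM ler_wpM2l // mxE.
Qed.

End PolynomialDiscriminant.

Section EntrywiseBounds.
Context {R : realFieldType}.

Lemma norm_mulmx3_le p q l k (P : 'M[R]_(p, q)) (N : 'M[R]_(q, l)) (Q : 'M[R]_(l, k))
    (e : R) i j :
  (forall i j, `|P i j| <= 1) -> (forall i j, `|N i j| <= e) ->
  (forall i j, `|Q i j| <= 1) -> `|(P *m N *m Q) i j| <= q%:R * l%:R * e.
Proof.
move=> P1 Ne Q1; rewrite mxE; apply: (le_trans (ler_norm_sum _ _ _)).
have term (x : 'I_l) : `|(P *m N) i x * Q x j| <= q%:R * e.
  rewrite normrM; apply: (@le_trans _ _ (`|(P *m N) i x| * 1)).
    by rewrite ler_wpM2l.
  rewrite mulr1 mxE; apply: (le_trans (ler_norm_sum _ _ _)).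
  have : \sum_(y < q) `|P i y * N y x| <= \sum_(y < q) e.
    apply: ler_sum => y _; rewrite normrM -[e]mul1r.
    by apply: ler_pM.
  by rewrite sumr_const card_ord -[e *+ q]mulr_natl.
apply: (@le_trans _ _ (\sum_(x < l) (q%:R * e))); first exact: ler_sum.
by rewrite sumr_const card_ord -[_ *+ l]mulr_natl mulrCA mulrA.
Qed.

Lemma mulmx3B_entry p q l k (P : 'M[R]_(p, q)) (N N' : 'M[R]_(q, l)) (Q : 'M[R]_(l, k)) i j :
  (P *m (N - N') *m Q) i j = (P *m N *m Q) i j - (P *m N' *m Q) i j.
Proof.
by rewrite mulmxBr mulmxBl; move: (P *m N *m Q) (P *m N' *m Q) => x y; rewrite !mxE.
Qed.

Lemma centering_entry_le1 n i j : `|(centering n : 'M[R]_n.+1) i j| <= 1.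
Proof.
have n0 : 0 < (n.+1%:R : R) by rewrite ltr0n.
have n1 : (n.+1%:R : R)^-1 <= 1 by rewrite invf_le1 // ler1n.
have n_ge0 : 0 <= (n.+1%:R : R)^-1 by rewrite invr_ge0 ltW.
rewrite !mxE ler_norml; move: (n.+1%:R^-1) n1 n_ge0 => x n1 n_ge0; apply/andP.
by case: (i == j); rewrite ?mulr1n ?mulr0n; split; lra.
Qed.

End EntrywiseBounds.

Section DiscriminantContinuity.
Context {R : realType} (n : nat).

Lemma cvg_sumr (T I : Type) (G : set_system T) (r : seq I) (f : I -> T -> R) (l : I -> R) :
  Filter G -> (forall i, f i @ G --> l i) ->
  (fun x => \sum_(i <- r) f i x) @ G --> \sum_(i <- r) l i.
Proof.
move=> FG fl; apply: (@cvg_big R _ _ _ _ _ T G r f l) => // x.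
by apply: cvgD; [exact: cvg_fst|exact: cvg_snd].
Qed.

Lemma cvg_prodr (T I : Type) (G : set_system T) (r : seq I) (f : I -> T -> R) (l : I -> R) :
  Filter G -> (forall i, f i @ G --> l i) ->
  (fun x => \prod_(i <- r) f i x) @ G --> \prod_(i <- r) l i.
Proof.
move=> FG fl; apply: (@cvg_big R _ _ _ _ _ T G r f l) => // x.
by apply: cvgM; [exact: cvg_fst|exact: cvg_snd].
Qed.

Lemma continuous_expmx_entry k (M : 'M[R]_n.+1) i j :
  (fun A : 'M[R]_n.+1 => (A ^+ k) i j) @ M --> (M ^+ k) i j.
Proof.
elim: k i j => [|k IH] i j.
  have /funext -> : (fun A : 'M[R]_n.+1 => (A ^+ 0) i j) =1 fun=> (M ^+ 0) i j.
    by move=> A; rewrite !expr0.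
  exact: (@cvg_cst (R : topologicalType) ((M ^+ 0) i j) _ (nbhs M)).
have E (A : 'M[R]_n.+1) : (A ^+ k.+1) i j = \sum_l A i l * (A ^+ k) l j.
  by rewrite exprS -mulmxE mxE.
rewrite (funext E) E.
apply: (@cvg_sumr _ _ (nbhs M) _ (fun l (A : 'M[R]_n.+1) => A i l * (A ^+ k) l j)) => l.
by apply: (@cvgM _ _ (nbhs M)); [exact: coord_continuous|exact: IH].
Qed.

Lemma continuous_discr : continuous (@discr R n).
Proof.
move=> M; have entry i j :
    (fun A : 'M[R]_n.+1 => (\matrix_(i < n.+1, j < n.+1) \tr (A ^+ (i + j))) i j) @ M
    --> (\matrix_(i < n.+1, j < n.+1) \tr (M ^+ (i + j))) i j.
  have E (A : 'M[R]_n.+1) :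
      (\matrix_(i < n.+1, j < n.+1) \tr (A ^+ (i + j))) i j = \tr (A ^+ (i + j)).
    by rewrite mxE.
  rewrite (funext E) E.
  apply: (@cvg_sumr _ _ (nbhs M) _ (fun l (A : 'M[R]_n.+1) => (A ^+ (i + j)) l l)) => l.
  exact: continuous_expmx_entry.
rewrite /discr /determinant.
apply: (@cvg_sumr _ _ (nbhs M) _ (fun s (A : 'M[R]_n.+1) => _)) => s.
apply: (@cvgM _ _ (nbhs M)); first exact: (@cvg_cst (R : topologicalType) _ _ (nbhs M)).
apply: (@cvg_prodr _ _ (nbhs M) _ (fun i (A : 'M[R]_n.+1) => _)) => i.
exact: entry.
Qed.

Lemma discr_near (M : 'M[R]_n.+1) : discr M != 0 -> exists2 rho : R, 0 < rho &
  forall A : 'M[R]_n.+1, (forall i j, `|A i j - M i j| < rho) ->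
    `|discr M| / 2 <= `|discr A|.
Proof.
move=> M0; have e0 : 0 < `|discr M| / 2 by rewrite divr_gt0 ?normr_gt0.
have /cvgrPdist_lt /(_ _ e0) /nbhs_ballP [rho rho0 rhoP] := @continuous_discr M.
exists rho => // A AM; have /rhoP : ball M rho A.
  by split=> // i j; rewrite /ball /= distrC.
rewrite /=; have := lerB_dist (discr M) (discr A); lra.
Qed.

End DiscriminantContinuity.

(** * Gram matrices of dilated clouds *)

Section RescaledGram.
Context {R : realType} (n : nat).
Implicit Types (W : 'M[R]_n.+1) (v r t : R).
Local Notation J := (centering n : 'M[R]_n.+1).

(** Here r stands for sqrt d, so that [v * r ^+ 2] is the expected diagonal of W and r the order of
    the fluctuations. *)
Definition normalized_gram v r W : 'M[R]_n.+1 :=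
  r^-1 *: (J *m (W - (v * r ^+ 2)%:M) *m J).

(** The factors 1, ..., n + 1 are distinct and positive, as required of the limiting diagonal
    matrix. *)
Definition dilation r t (i : 'I_n.+1) : R := 1 + t * i.+1%:R / r.

Definition rescale r t W : 'M[R]_n.+1 :=
  \matrix_(i, j) (dilation r t i * dilation r t j * W i j).

Lemma poly_fun_normalized v r W i j :
  poly_fun 2 (fun t => normalized_gram v r (rescale r t W) i j).
Proof.
have dil k : poly_fun 1 (fun t => dilation r t k).
  apply: poly_funD; first exact: poly_funW (poly_fun_cst 1).
  have [p szp pE] := poly_funM (@poly_fun_id R) (poly_fun_cst (k.+1%:R / r)).
  by exists p => // t; rewrite -pE mulrA.
have mid k l : poly_fun 2 (fun t => (rescale r t W - (v * r ^+ 2)%:M) k l).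
  have [p szp pE] := poly_funD (poly_funM (poly_funM (dil k) (dil l)) (poly_fun_cst (W k l)))
    (poly_funW (leq0n 2) (poly_fun_cst (- (v * r ^+ 2)%:M k l))).
  by exists p => // t; rewrite -pE !mxE.
have left k l : poly_fun 2 (fun t => (J *m (rescale r t W - (v * r ^+ 2)%:M)) k l).
  have [p szp pE] := poly_fun_sum (index_enum 'I_n.+1) xpredT
    (fun x => poly_funM (poly_fun_cst (J k x)) (mid x l)).
  by exists p => // t; rewrite -pE mxE.
have right k l : poly_fun 2 (fun t => (J *m (rescale r t W - (v * r ^+ 2)%:M) *m J) k l).
  have [p szp pE] := poly_fun_sum (index_enum 'I_n.+1) xpredT
    (fun x => poly_funM (left k x) (poly_fun_cst (J x l))).
  by exists p => // t; rewrite -pE mxE.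
have [p szp pE] := poly_funM (poly_fun_cst r^-1) (right i j).
by exists p => // t; rewrite -pE mxE.
Qed.

(** The first-order term in t: for k = i + 1, dilation adds v r^2 ((1 + t k / r)^2 - 1) = 2 v t k r
    + v t^2 k^2 to the diagonal, which is then divided by r and t. *)
Let a v : 'rV[R]_n.+1 := \row_i (2 * v * i.+1%:R).

(* As [t] grows, [t^-1 A(t)] tends to [J diag(a) J], whose discriminant does not
   vanish. *)
Lemma normalized_rescale_near v K rho : 0 < v -> 0 < rho -> exists2 t : R, 1 <= t &
  exists2 c : R, 0 < c & forall r W, c <= r ->
    (forall i j, `|W i j - (v * r ^+ 2) *+ (i == j)| <= K * r) ->
    forall i j, `|(t^-1 *: normalized_gram v r (rescale r t W)) i j -
                  (J *m diag_mx (a v) *m J) i j| < rho.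
Proof.
move=> v0 rho0.
pose m : R := n.+1%:R.
have m1 : 1 <= m by rewrite ler1n.
pose K' := Num.max K 0.
have K'0 : 0 <= K' by rewrite le_max lexx orbT.
have KK' : K <= K' by rewrite le_max lexx.
(* Chosen so that the dilated fluctuations, at most 4 K' / t, stay below rho / (4 m^2). *)
pose t : R := 1 + 16 * K' * m ^+ 2 / rho.
have t1 : 1 <= t by rewrite lerDl divr_ge0 ?mulr_ge0 ?sqr_ge0 // ltW.
have t0 : 0 < t by lra.
(* The first term keeps the dilation factors between 1 and 2; the second makes the second-order term
   v t k^2 / r at most rho / (4 m^2). *)
pose c := t * m + 4 * v * t * m ^+ 4 / rho + 1.
have c0 : 0 < c.
  have : 0 <= t * m by rewrite mulr_ge0 //; lra.
  have : 0 <= 4 * v * t * m ^+ 4 / rho.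
    by rewrite divr_ge0 ?mulr_ge0 ?exprn_ge0 //; lra.
  rewrite /c; lra.
exists t => //; exists c => // r W cr WK i j.
have r0 : 0 < r by lra.
set N := t^-1 *: (r^-1 *: (rescale r t W - (v * r ^+ 2)%:M)).
have -> : t^-1 *: normalized_gram v r (rescale r t W) = J *m N *m J.
  by rewrite /N /normalized_gram -!scalemxAr -!scalemxAl.
rewrite -mulmx3B_entry.
have tm_r : t * m <= r.
  have : 0 <= 4 * v * t * m ^+ 4 / rho by rewrite divr_ge0 ?mulr_ge0 ?exprn_ge0 //; lra.
  move: cr; rewrite /c; lra.
have km (k : 'I_n.+1) : 1 <= (k.+1%:R : R) <= m by rewrite ler1n ler_nat ltn_ord.
(* Multiplying by J on both sides costs a factor m^2. *)
pose e := rho / (2 * m ^+ 2).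
have e0 : 0 < e by rewrite divr_gt0 // mulr_gt0 // exprn_gt0; lra.
apply: (@le_lt_trans _ _ (n.+1%:R * n.+1%:R * e)); last first.
  rewrite -/m /e (_ : m * m * _ = rho / 2); first lra.
  by field; lra.
apply: norm_mulmx3_le; try exact: centering_entry_le1.
move=> k l.
pose x := t * k.+1%:R / r; pose y := t * l.+1%:R / r.
have x01 : 0 <= x <= 1.
  have /andP[k1 km'] := km k.
  rewrite divr_ge0 ?mulr_ge0 //=; try lra.
  by rewrite ler_pdivrMr // mul1r (le_trans _ tm_r) // ler_wpM2l //; lra.
have y01 : 0 <= y <= 1.
  have /andP[k1 km'] := km l.
  rewrite divr_ge0 ?mulr_ge0 //=; try lra.
  by rewrite ler_pdivrMr // mul1r (le_trans _ tm_r) // ler_wpM2l //; lra.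
pose h := (W k l - (v * r ^+ 2) *+ (k == l)) / r.
have hK : `|h| <= K'.
  rewrite normrM [`|r^-1|]gtr0_norm ?invr_gt0 // ler_pdivrMr //.
  by apply: (le_trans (WK k l)); rewrite ler_wpM2r // ltW.
have WE : W k l = (v * r ^+ 2) *+ (k == l) + h * r by rewrite /h; field; lra.
have -> : (N - diag_mx (a v)) k l =
    (v * t * k.+1%:R ^+ 2 / r) *+ (k == l) + (1 + x) * (1 + y) * h / t.
  rewrite !mxE /dilation -/x -/y WE; have [kl|_] := eqVneq k l.
    by rewrite !mulr1n /y -kl -/x /x; field; rewrite !gt_eqF.
  by rewrite !mulr0n; field; rewrite !gt_eqF.
have b1 : `|(v * t * k.+1%:R ^+ 2 / r) *+ (k == l)| <= e / 2.
  apply: (@le_trans _ _ (v * t * k.+1%:R ^+ 2 / r)).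
    have q0 : 0 <= v * t * k.+1%:R ^+ 2 / r.
      by rewrite divr_ge0 ?mulr_ge0 ?sqr_ge0 // ltW.
    by case: (k == l); rewrite ?mulr1n ?mulr0n ?normr0 // ger0_norm.
  have /andP[k1 km'] := km k.
  apply: (@le_trans _ _ (v * t * m ^+ 2 / r)).
    rewrite ler_pM2r ?invr_gt0 // ler_pM2l ?mulr_gt0 //.
    by rewrite lerXn2r ?nnegrE //; lra.
  rewrite ler_pdivrMr // /e.
  have : 4 * v * t * m ^+ 4 / rho <= r.
    have : 0 <= t * m by rewrite mulr_ge0 //; lra.
    move: cr; rewrite /c; lra.
  rewrite ler_pdivrMr // => big.
  rewrite (_ : rho / (2 * m ^+ 2) / 2 * r = r * rho / (4 * m ^+ 2)); last by field; lra.
  rewrite ler_pdivlMr; last by rewrite mulr_gt0 // exprn_gt0; lra.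
  by apply: le_trans big; rewrite le_eqVlt; apply/orP; left; apply/eqP; ring.
have b2 : `|(1 + x) * (1 + y) * h / t| <= e / 2.
  rewrite normrM [`|t^-1|]gtr0_norm ?invr_gt0 // ler_pdivrMr //.
  rewrite normrM ger0_norm; last by apply: mulr_ge0; lra.
  apply: (@le_trans _ _ (4 * K')).
    apply: ler_pM => //; first by apply: mulr_ge0; lra.
    nra.
  have : 16 * K' * m ^+ 2 / rho <= t by rewrite /t; lra.
  rewrite ler_pdivrMr // /e => big.
  rewrite (_ : rho / (2 * m ^+ 2) / 2 * t = t * rho / (4 * m ^+ 2)); last by field; lra.
  rewrite ler_pdivlMr; last by rewrite mulr_gt0 // exprn_gt0; lra.
  by apply: le_trans big; rewrite le_eqVlt; apply/orP; left; apply/eqP; ring.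
by apply: (le_trans (ler_normD _ _)); lra.
Qed.

Definition discr_degree : nat := n.+1 * ((2 * n) * 2).

(** If the discriminant were small at more nodes than its degree in t, interpolation would make it
    small at the large t where it is close to that of a nondegenerate limit. *)
Lemma card_small_discr v K (L : nat) (tau : 'I_L -> R) : 0 < v -> injective tau ->
  exists2 eta : R, 0 < eta & exists2 c : R, 0 < c & forall r W, c <= r ->
    (forall i j, `|W i j - (v * r ^+ 2) *+ (i == j)| <= K * r) ->
    (#|[set j | (`|discr (normalized_gram v r (rescale r (tau j) W))| < eta)%R]%SET|
      <= discr_degree)%N.
Proof.
move=> v0 tau_inj.
have disc0 : discr (J *m diag_mx (a v) *m J) != 0.
  apply: discr_centered_diag_neq0 => [i j|i].
    rewrite !mxE => /mulfI; rewrite !mulf_neq0 ?gt_eqF // => /(_ isT)/eqP.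
    by rewrite eqr_nat eqSS => /eqP/val_inj.
  by rewrite mxE !mulr_gt0.
have [rho rho0 near] := discr_near disc0.
have [t t1 [c c0 close]] := normalized_rescale_near K v0 rho0.
set low := `|discr (J *m diag_mx (a v) *m J)| / 2 in near.
have low0 : 0 < low by rewrite divr_gt0 ?normr_gt0.
have bound (S : {set 'I_L}) : exists C : R, 0 <= C /\
    forall (p : {poly R}) (e : R), (size p <= #|S|)%N ->
    (forall j, j \in S -> `|p.[tau j]| <= e) -> `|p.[t]| <= C * e.
  have inj : injective (fun j : {j | j \in S} => tau (val j)).
    by move=> j l /tau_inj/val_inj.
  have [C C0 CP] := interpolation_bound t inj.
  exists C; split=> // p e szp pe; apply: CP; first by rewrite card_sig.
  by move=> [j jS] /=; exact: pe.
have [C CP] := choice bound.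
(* The set of bad nodes depends on W; summing the constants of all subsets gives an [eta] that does
   not. *)
pose Ctot := \sum_S C S.
have C_le S : C S <= Ctot.
  by rewrite /Ctot (bigD1 S) //= lerDl sumr_ge0 // => S' _; case: (CP S').
have Ctot0 : 0 <= Ctot by apply: sumr_ge0 => S _; case: (CP S).
exists (low / (Ctot + 1)); first by rewrite divr_gt0 //; lra.
exists c => // r W cr WK; rewrite leqNgt; apply/negP => big.
set S := [set j | _]%SET in big.
have [p szp pE] := poly_fun_discr (poly_fun_normalized v r W).
have [CS0 /(_ p (low / (Ctot + 1)))] := CP S.
move=> /(_ (leq_trans szp big)) le_p.
have : `|p.[t]| <= C S * (low / (Ctot + 1)).
  by apply: le_p => j; rewrite inE -pE => /ltW.
apply/negP; rewrite -ltNge -pE.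
have t0 : t != 0 by rewrite gt_eqF //; lra.
(* Undoing the division by t >= 1 can only increase the absolute value of the discriminant. *)
rewrite -[normalized_gram _ _ _](scalerKV t0) discrZ normrM.
apply: (@lt_le_trans _ _ low).
  rewrite mulrA ltr_pdivrMr; last lra.
  by have := C_le S; nra.
apply: (le_trans (near _ (close r W cr WK))).
rewrite ler_peMl // ger0_norm ?sqr_ge0 // -[leLHS](expr1n _ 2).
rewrite lerXn2r ?nnegrE //; first by apply: prodr_ge0 => i _; rewrite exprn_ge0; lra.
by elim/big_rec: _ => // i x _ x1; rewrite mulr_ege1 ?exprn_ege1.
Qed.

End RescaledGram.

(** * Normalized PCA and the dual covariance matrix *)

Section EigenvaluePerturbation.
Context {R : realFieldType}.

(** Used to solve fewer than m linear conditions in m unknowns: the columns are the conditions, and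
    a column left at zero makes the matrix singular. *)
Lemma kernel_of_zero_col m (C : 'M[R]_m) (k : 'I_m) :
  (forall i, C i k = 0) -> exists2 v : 'rV[R]_m, v != 0 & v *m C = 0.
Proof.
move=> Ck; apply/det0P; rewrite (expand_det_col _ k); apply/eqP.
by apply: big1 => i _; rewrite Ck mul0r.
Qed.

(* Weyl's inequality: some vector is spanned by the first [k + 1] eigenvectors of
   one matrix and orthogonal to the first [k] ones of the other. *)
Lemma weyl_le m (O : 'M[R]_m) (mu mu' : 'I_m -> R) (e : R) :
  O *m O^T = 1%:M ->
  (forall k l : 'I_m, (k <= l)%N -> mu l <= mu k) ->
  (forall k l : 'I_m, (k <= l)%N -> mu' l <= mu' k) ->
  (forall j l, `|O j l * (mu' l - mu j)| <= e) ->
  forall k, mu' k <= mu k + m%:R * e.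
Proof.
move=> OO mu_dec mu'_dec Oe k.
have OO' : O^T *m O = 1%:M := mulmx1C OO.
(* The columns before k ask that [O *m v] vanish there, those after k that v vanish there; column k
   is the free one. *)
pose C : 'M[R]_m := \matrix_(i, j)
  if (j < k)%N then O j i else if (k < j)%N then (i == j)%:R else 0.
have [u u0 uC] : exists2 u : 'rV[R]_m, u != 0 & u *m C = 0.
  by apply: (@kernel_of_zero_col _ C k) => i; rewrite mxE ltnn.
pose v := u^T; pose y := O *m v.
have vE i : v i 0 = u 0 i by rewrite mxE.
have v_gt (l : 'I_m) : (k < l)%N -> v l 0 = 0.
  move=> kl; have := congr1 (fun N : 'M[R]_(1, m) => N 0 l) uC; rewrite !mxE.
  rewrite (bigD1 l) //= mxE ltnNge ltnW //= kl eqxx mulr1 big1 ?addr0 => [|i il].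
    by rewrite ?vE.
  by rewrite mxE ltnNge ltnW //= kl (negbTE il) mulr0.
have y_lt (j : 'I_m) : (j < k)%N -> y j 0 = 0.
  move=> jk; have := congr1 (fun N : 'M[R]_(1, m) => N 0 j) uC; rewrite !mxE => eq0.
  by rewrite -[RHS]eq0; apply: eq_bigr => i _; rewrite !mxE jk mulrC.
have yv : O^T *m y = v by rewrite mulmxA OO' mul1mx.
pose S := \sum_l v l 0 ^+ 2.
have S_y : \sum_j y j 0 ^+ 2 = S.
  transitivity ((y^T *m y) 0 0).
    by rewrite [RHS]mxE; apply: eq_bigr => j _; rewrite [y^T _ _]mxE expr2.
  transitivity ((v^T *m v) 0 0); last first.
    by rewrite [LHS]mxE; apply: eq_bigr => j _; rewrite [v^T _ _]mxE expr2.
  by rewrite trmx_mul -!mulmxA yv.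
have S0 : 0 < S.
  rewrite lt_neqAle sumr_ge0 ?andbT => [|l _]; last exact: sqr_ge0.
  apply: contra u0; rewrite eq_sym psumr_eq0; last by move=> l _; exact: sqr_ge0.
  move=> /allP v0; apply/eqP/rowP => l; rewrite mxE -vE.
  by have := v0 l (mem_index_enum _); rewrite sqrf_eq0 => /eqP.
(* The quadratic form of the perturbation at one vector, with coordinates y in one eigenbasis and v
   in the other. It is the difference of the two diagonal forms. *)
pose T := \sum_j \sum_l y j 0 * (O j l * (mu' l - mu j)) * v l 0.
have T1 : T = \sum_l mu' l * v l 0 ^+ 2 - \sum_j mu j * y j 0 ^+ 2.
  transitivity (\sum_j \sum_l (mu' l * v l 0) * (O j l * y j 0) -
                \sum_j \sum_l (mu j * y j 0) * (O j l * v l 0)).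
    rewrite -sumrB; apply: eq_bigr => j _; rewrite -sumrB; apply: eq_bigr => l _.
    by ring.
  congr (_ - _).
    rewrite exchange_big /=; apply: eq_bigr => l _; rewrite -mulr_sumr expr2 mulrA.
    congr (_ * _); transitivity ((O^T *m y) l 0); last by rewrite yv.
    by rewrite [RHS]mxE; apply: eq_bigr => j _; rewrite [X in _ = X * _]mxE.
  apply: eq_bigr => j _; rewrite -mulr_sumr expr2 mulrA.
  by congr (_ * _); rewrite /y [RHS]mxE.
have T_ge : (mu' k - mu k) * S <= T.
  rewrite T1 mulrBl; apply: lerB.
    rewrite mulr_sumr; apply: ler_sum => l _.
    have [kl|lk] := ltnP k l; first by rewrite v_gt // expr0n /= !mulr0.
    by rewrite ler_wpM2r ?sqr_ge0 // mu'_dec.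
  rewrite -S_y mulr_sumr; apply: ler_sum => j _.
  have [jk|kj] := ltnP j k; first by rewrite y_lt // expr0n /= !mulr0.
  by rewrite ler_wpM2r ?sqr_ge0 // mu_dec.
have T_le : T <= m%:R * e * S.
  apply: (@le_trans _ _ (\sum_j \sum_l e * ((y j 0 ^+ 2 + v l 0 ^+ 2) / 2))).
    apply: ler_sum => j _; apply: ler_sum => l _.
    apply: (le_trans (ler_norm _)); rewrite !normrM -normrM mulrAC mulrC.
    apply: (@le_trans _ _ (e * (`|y j 0| * `|v l 0|))).
      by rewrite ler_wpM2r ?mulr_ge0.
    rewrite ler_wpM2l //; first by apply: le_trans (Oe j l).
    rewrite -(normr_id (y j 0)) -(normr_id (v l 0)) -[y j 0 ^+ 2]real_normK ?num_real //.
    rewrite -[v l 0 ^+ 2]real_normK ?num_real // !normr_id.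
    by have := sqr_ge0 (`|y j 0| - `|v l 0|); nra.
  rewrite le_eqVlt; apply/orP; left; apply/eqP.
  transitivity (\sum_(j < m) (e * (m%:R * y j 0 ^+ 2 + S) / 2)).
    apply: eq_bigr => j _; rewrite -mulr_sumr -mulr_suml big_split /= sumr_const.
    by rewrite card_ord -[_ *+ m]mulr_natl mulrA.
  rewrite -mulr_suml -mulr_sumr big_split /= -mulr_sumr S_y sumr_const card_ord.
  by rewrite -[S *+ m]mulr_natl; field.
by rewrite -lerBlDl -(ler_pM2r S0) (le_trans T_ge).
Qed.

End EigenvaluePerturbation.

Section DualPCA.
Context {R : realType}.

Local Notation one n := (const_mx 1 : 'cV[R]_n).

Definition centered_gram d m (Z : 'M[R]_(d, m.+1)) : 'M[R]_m.+1 :=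
  centering m *m (Z^T *m Z) *m centering m.

(** There are m + 1 points and a centered Gram matrix kills the constant vector, so only the m
    eigenvectors orthogonal to it are listed. *)
Definition dual_eigensystem m (G : 'M[R]_m.+1) (U : 'M[R]_(m, m.+1)) (mu : 'I_m -> R) :=
  [/\ U *m U^T = 1%:M, U *m one m.+1 = 0,
      forall k l : 'I_m, (k <= l)%N -> mu l <= mu k
    & U *m G = diag_mx (\row_k mu k) *m U].

(** The scores [w] have orthogonal rows of squared norm m lam_k, and normalizing them gives the dual
    eigenvectors. Definiteness makes the first m eigenvalues positive, so that no inverse is taken
    at 0. *)
Lemma pca_dual d m s (Z : 'M[R]_(d, m.+1)) (Zhat : 'M[R]_(s, m.+1)) :
  (0 < m)%N -> (m <= d)%N -> is_normalized_pca Z Zhat ->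
  (forall x : 'rV[R]_m.+1, x != 0 -> x *m one m.+1 = 0 ->
     x *m centered_gram Z *m x^T != 0) ->
  exists U mu, dual_eigensystem (centered_gram Z) U mu /\
    forall (k : 'I_s) (k' : 'I_m), k = k' :> nat -> forall i,
      Zhat k i = Num.sqrt m%:R * U k' i.
Proof.
move=> m0 md [lam [h [[lam_dec h_orth h_eig] ZhatE]]] G_def.
have [Y YE] : exists Y, Y = Z *m (centering m : 'M[R]_m.+1) by eexists.
have mean_col i : col i Z - cloud_mean Z = col i Y.
  apply/colP => k; rewrite YE /centering mulmxBr mulmx1 !mxE summxE.
  congr (_ - _); rewrite mulr_sumr; apply: eq_bigr => j _.
  by rewrite !mxE mulrC.
pose mR : R := m%:R.
have mR0 : 0 < mR by rewrite ltr0n.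
have cov : sample_cov Z = mR^-1 *: (Y *m Y^T).
  rewrite /sample_cov (_ : m.+1%:R - 1 = mR); last by rewrite -natr1 addrK.
  congr (_ *: _); apply/matrixP => k l; rewrite summxE mxE; apply: eq_bigr => i _.
  by rewrite mean_col mxE big_ord1 !mxE.
pose H : 'M[R]_d := \matrix_(k, i) h k i 0.
have rowH k : row k H = (h k)^T by apply/rowP => i; rewrite !mxE.
have HH : H *m H^T = 1%:M.
  apply/matrixP => k l; have := congr1 (fun N : 'M[R]_1 => N 0 0) (h_orth k l).
  rewrite !mxE eqxx mulr1n => <-; apply: eq_bigr => i _; by rewrite !mxE.
have HS : H *m (Y *m Y^T) = diag_mx (\row_k (mR * lam k)) *m H.
  have symS : (Y *m Y^T)^T = Y *m Y^T by rewrite trmx_mul trmxK.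
  apply: trmx_inj; rewrite trmx_mul symS trmx_mul tr_diag_mx.
  apply/matrixP => i k; rewrite mul_mx_diag [RHS]mxE.
  have := congr1 (fun N : 'cV[R]_d => N i 0) (h_eig k).
  rewrite cov -scalemxAl [LHS]mxE [RHS]mxE => eq_k.
  have -> : (Y *m Y^T *m H^T) i k = (Y *m Y^T *m h k) i 0.
    by rewrite [LHS]mxE [RHS]mxE; apply: eq_bigr => j _; rewrite !mxE.
  rewrite !mxE mulrC -mulrA -eq_k mulrA divff ?gt_eqF // mul1r.
  by rewrite mxE.
have [w wdef] : exists w, w = H *m Y by eexists.
have wE k i : w k i = ((h k)^T *m (col i Z - cloud_mean Z)) 0 0.
  by rewrite mean_col wdef !mxE; apply: eq_bigr => j _; rewrite !mxE.
have ww : w *m w^T = diag_mx (\row_k (mR * lam k)).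
  by rewrite wdef trmx_mul mulmxA -(mulmxA H) HS -mulmxA HH mulmx1.
have GE : centered_gram Z = Y^T *m Y.
  by rewrite /centered_gram YE trmx_mul centering_sym !mulmxA.
have wG : w *m centered_gram Z = diag_mx (\row_k (mR * lam k)) *m w.
  by rewrite GE wdef !mulmxA -(mulmxA H) HS -!mulmxA.
have w_tr : w^T *m w = centered_gram Z.
  by rewrite GE wdef trmx_mul mulmxA -(mulmxA _ H^T) (mulmx1C HH) mulmx1.
have ww_entry k l : \sum_i w k i * w l i = (mR * lam k) *+ (k == l).
  have := congr1 (fun N : 'M[R]_d => N k l) ww; rewrite !mxE => <-.
  by apply: eq_bigr => i _; rewrite mxE.
have w_one k : \sum_i w k i = 0.
  transitivity ((w *m one m.+1) k 0).
    by rewrite mxE; apply: eq_bigr => i _; rewrite mxE mulr1.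
  by rewrite wdef YE -!mulmxA centering_one !mulmx0 mxE.
(* Otherwise all score rows from k on vanish, and a nonzero x orthogonal to the constant vector and
   to the k first rows contradicts definiteness. *)
have lam_gt0 (k : 'I_d) : (k < m)%N -> 0 < lam k.
  move=> km; rewrite ltNge; apply/negP => lam_le0.
  (* These are k + 1 <= m conditions on m + 1 unknowns: column k encodes orthogonality to the
     constant vector, and the last column is zero because k < m. *)
  pose C : 'M[R]_m.+1 := \matrix_(i, j)
    if (insub (j : nat) : option 'I_d) is Some l then
      if (l < k)%N then w l i else if l == k then 1 else 0
    else 0.
  have [x x0 xC] : exists2 x : 'rV[R]_m.+1, x != 0 & x *m C = 0.
    apply: (@kernel_of_zero_col _ _ C ord_max) => i; rewrite mxE.
    case: insubP => //= l _ lm; rewrite lm ltnNge ltnW //=.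
    by case: eqP => // lk; move: km; rewrite -lk lm ltnn.
  have xC_col (l : 'I_d) : (l <= k)%N ->
      \sum_i x 0 i * (if (l < k)%N then w l i else if l == k then 1 else 0) = 0.
    move=> lk; have lm : (l < m.+1)%N by rewrite ltnS (leq_trans lk) // ltnW.
    have := congr1 (fun N : 'rV[R]_m.+1 => N 0 (Ordinal lm)) xC; rewrite !mxE => sum0.
    rewrite -[RHS]sum0; apply: eq_bigr => i _; rewrite mxE.
    case: insubP => [l' _ /= ll'|]; last by rewrite /= ltn_ord.
    by have -> : l' = l by apply: val_inj.
  have x_one : x *m one m.+1 = 0.
    apply/matrixP => i j; rewrite !ord1 mxE [RHS]mxE -[RHS](xC_col k (leqnn k)).
    by apply: eq_bigr => l _; rewrite mxE ltnn eqxx.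
  have wx : w *m x^T = 0.
    apply/colP => l; rewrite !mxE; have [lk|kl] := ltnP l k.
      rewrite -[RHS](xC_col l (ltnW lk)); apply: eq_bigr => i _.
      by rewrite lk mxE mulrC.
    have : \sum_i w l i ^+ 2 = 0.
      apply/eqP; rewrite eq_le sumr_ge0 ?andbT => [|i _]; last exact: sqr_ge0.
      have -> : \sum_i w l i ^+ 2 = mR * lam l.
        by have := ww_entry l l; rewrite eqxx mulr1n => <-; apply: eq_bigr => i _; rewrite expr2.
      by rewrite pmulr_rle0 // (le_trans (lam_dec _ _ kl)).
    move/eqP; rewrite psumr_eq0 => [/allP w0|i _]; last exact: sqr_ge0.
    apply: big1 => i _; have := w0 i (mem_index_enum _).
    by rewrite sqrf_eq0 => /eqP ->; rewrite mul0r.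
  move: (G_def x x0 x_one); rewrite -w_tr mulmxA -mulmxA wx mulmx0.
  by rewrite eqxx.
pose emb (k : 'I_m) : 'I_d := widen_ord md k.
have emb_gt0 k : 0 < mR * lam (emb k) by rewrite mulr_gt0 // lam_gt0 //=.
pose U : 'M[R]_(m, m.+1) := \matrix_(k, i) (w (emb k) i / Num.sqrt (mR * lam (emb k))).
exists U, (fun k => mR * lam (emb k)); split.
  split.
  - apply/matrixP => k l; rewrite !mxE.
    transitivity ((\sum_i w (emb k) i * w (emb l) i) /
        (Num.sqrt (mR * lam (emb k)) * Num.sqrt (mR * lam (emb l)))).
      by rewrite mulr_suml; apply: eq_bigr => i _; rewrite !mxE invfM; ring.
    rewrite ww_entry; have -> : (emb k == emb l) = (k == l) by [].
    have [->|_] := eqVneq k l; last by rewrite mulr0n mul0r.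
    by rewrite mulr1n -expr2 sqr_sqrtr ?divff ?gt_eqF // ltW.
  - apply/colP => k; rewrite !mxE.
    transitivity ((\sum_i w (emb k) i) / Num.sqrt (mR * lam (emb k))).
      by rewrite mulr_suml; apply: eq_bigr => i _; rewrite !mxE mulr1.
    by rewrite w_one mul0r.
  - by move=> k l kl; rewrite ler_pM2l // lam_dec.
  - apply/matrixP => k i; rewrite mul_diag_mx !mxE.
    have := congr1 (fun N : 'M[R]_(d, m.+1) => N (emb k) i) wG.
    rewrite mul_diag_mx [LHS]mxE [RHS]mxE [X in _ = X * _ -> _]mxE => wGk.
    rewrite mulrA -wGk mulr_suml. apply: eq_bigr => j _.
    by rewrite !mxE mulrAC.
move=> k k' kk' i; rewrite (ZhatE k (emb k')) // -wE mxE.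
by rewrite sqrtrM ?ltW // invfM; field; rewrite !gt_eqF ?sqrtr_gt0 ?lam_gt0 //=.
Qed.

End DualPCA.

Section SpectralGap.
Context {R : realType}.
Local Notation one n := (const_mx 1 : 'cV[R]_n).
Local Notation J m := (centering m : 'M[R]_m.+1).

Lemma prod_le_expn (I : finType) (P : pred I) (x : I -> R) (C : R) : 1 <= C ->
  (forall i, P i -> 0 <= x i <= C) -> \prod_(i | P i) x i <= C ^+ #|I|.
Proof.
move=> C1 xC; apply: (@le_trans _ _ (\prod_(i | P i) C)); first exact: ler_prod.
by rewrite prodr_const ler_weXn2l // max_card.
Qed.

Section Basis.
Variables (m : nat) (U : 'M[R]_(m, m.+1)).
Hypotheses (UU : U *m U^T = 1%:M) (U1 : U *m one m.+1 = 0).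

Definition full_basis : 'M[R]_m.+1 :=
  col_mx (const_mx (Num.sqrt m.+1%:R)^-1 : 'rV[R]_m.+1) U.

Lemma full_basis_orth : full_basis *m full_basis^T = 1%:M.
Proof.
rewrite /full_basis; set c : 'rV[R]_m.+1 := const_mx _.
have cc : c *m c^T = 1%:M.
  apply/matrixP => i j; rewrite !ord1 mxE (eq_bigr (fun=> (m.+1%:R : R)^-1)) => [|k _].
    by rewrite sumr_const card_ord -[_^-1 *+ _]mulr_natr mulVf ?pnatr_eq0 // mxE.
  by rewrite !mxE -invfM -expr2 sqr_sqrtr.
have Uc : U *m c^T = 0.
  have -> : c^T = (Num.sqrt m.+1%:R)^-1 *: one m.+1.
    by apply/matrixP => i j; rewrite !mxE mulr1.
  by rewrite -scalemxAr U1 scaler0.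
have cU : c *m U^T = 0 by rewrite -[LHS]trmxK trmx_mul trmxK Uc trmx0.
rewrite (tr_col_mx c U) (mul_col_row c U c^T U^T) cc cU Uc UU.
by rewrite -scalar_mx_block.
Qed.

(** A square matrix with orthonormal rows has orthonormal columns; the row added in [full_basis]
    accounts for the constant matrix. *)
Lemma basis_complete : U^T *m U = J m.
Proof.
have := mulmx1C full_basis_orth; rewrite /full_basis; set c : 'rV[R]_m.+1 := const_mx _.
rewrite (tr_col_mx c U) (mul_row_col c^T U^T c U).
move=> /(canRL (addKr _)) ->; rewrite addrC /centering; congr (_ - _).
apply/matrixP => i j; rewrite /c !mxE big_ord1 !mxE -invfM -expr2 sqr_sqrtr //.
Qed.

Lemma basis_entry_le1 k i : `|U k i| <= 1.
Proof.
rewrite -(@expr_le1 _ 2) // real_normK ?num_real //.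
have := congr1 (fun N : 'M[R]_m => N k k) UU; rewrite !mxE eqxx mulr1n => <-.
by rewrite (bigD1 i) //= !mxE -expr2 lerDl sumr_ge0 // => j _; rewrite !mxE -expr2 sqr_ge0.
Qed.

(** The root of the discriminant is the product of all eigenvalue differences. Bounding every factor
    but one by a constant C >= 1 bounds that one from below. The exponent counts generously: m + 1
    for the row of the chosen pair, (m + 1)^2 for the other rows. *)
Lemma gap_of_discr (A : 'M[R]_m.+1) (alpha : 'I_m -> R) (eta b : R) :
  A *m one m.+1 = 0 -> (one m.+1)^T *m A = 0 ->
  U *m A = diag_mx (\row_k alpha k) *m U ->
  (forall i j, `|A i j| <= b) -> 0 <= eta -> eta <= `|discr A| ->
  forall j l, j != l ->
  Num.sqrt eta <=
    `|alpha j - alpha l| * (2 * (m%:R + 1) ^+ 2 * b + 1) ^+ (m.+1 + m.+1 * m.+1).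
Proof.
move=> A1 oneA UA Ab eta0 eta_le.
(* The leading 0 is the eigenvalue of the constant vector. *)
pose a : 'rV[R]_m.+1 := row_mx (0 : 'M[R]_1) (\row_k alpha k).
have VA : full_basis *m A = diag_mx a *m full_basis.
  rewrite /full_basis /a; set c : 'rV[R]_m.+1 := const_mx _.
  rewrite (mul_col_mx c U A) (diag_mx_row (0 : 'rV[R]_1) (\row_k alpha k)).
  rewrite (mul_block_col (diag_mx (0 : 'rV[R]_1)) 0 0 (diag_mx (\row_k alpha k)) c U).
  have cE : c = (Num.sqrt m.+1%:R)^-1 *: (one m.+1)^T.
    by apply/matrixP => i j; rewrite !mxE mulr1.
  have cA : c *m A = 0 by rewrite cE -scalemxAl oneA scaler0.
  have c0 : diag_mx (0 : 'rV[R]_1) *m c = 0.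
    by apply/matrixP => i j; rewrite mul_diag_mx !mxE mul0r.
  by rewrite UA cA c0 !mul0mx !add0r.
have V1 := full_basis_orth.
have AE : A = full_basis^T *m diag_mx a *m full_basis.
  by rewrite -mulmxA -VA mulmxA (mulmx1C V1) mul1mx.
set C := 2 * _ * b + 1.
have b0 : 0 <= b by apply: le_trans (Ab ord0 ord0).
have alpha_b k : `|alpha k| <= (m%:R + 1) ^+ 2 * b.
  have -> : alpha k = (U *m A *m U^T) k k.
    rewrite UA -mulmxA UU mulmx1 !mxE eqxx mulr1n //.
  have -> : (m%:R + 1) ^+ 2 = m.+1%:R * m.+1%:R :> R by rewrite -natr1 expr2.
  by apply: norm_mulmx3_le => // i j; rewrite ?mxE; exact: basis_entry_le1.
have m0 : 0 <= (m%:R + 1) ^+ 2 * b by rewrite mulr_ge0 ?sqr_ge0.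
have aE k : a 0 (lift ord0 k) = alpha k.
  rewrite /a mxE; case: splitP => [[l l1]|l] /=; rewrite /bump /= => e; first lia.
  by rewrite mxE; congr alpha; apply: val_inj; move: e; rewrite /=; lia.
have a0E : a 0 ord0 = 0.
  by rewrite /a mxE; case: splitP => [l|l] /= e; [rewrite mxE|lia].
have a_b i : `|a 0 i| <= (m%:R + 1) ^+ 2 * b.
  by case: (unliftP ord0 i) => [k|] ->; rewrite ?aE ?a0E ?normr0.
have C1 : 1 <= C by rewrite /C -mulrA; lra.
have a_C i j : 0 <= `|a 0 i - a 0 j| <= C.
  rewrite normr_ge0 (le_trans (ler_normB _ _)) //= /C -mulrA.
  by have := a_b i; have := a_b j; lra.
have gap (i j : 'I_m.+1) : (i < j)%N ->
    Num.sqrt eta <= `|a 0 j - a 0 i| * C ^+ (m.+1 + m.+1 * m.+1).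
  move=> ij; rewrite AE discr_diag_conj // in eta_le.
  rewrite ger0_norm ?sqr_ge0 // in eta_le.
  have := ler_wsqrtr eta_le; rewrite sqrtr_sqr => /le_trans; apply.
  rewrite normr_prod (bigD1 i) //= exprD mulrA.
  apply: ler_pM => //; first by apply: prodr_ge0.
    rewrite normr_prod (bigD1 j) //=; apply: ler_pM => //.
      by apply: prodr_ge0.
    apply: (le_trans (prod_le_expn C1 _)) => [k _|]; first exact: a_C.
    by rewrite card_ord.
  have Cn : 1 <= C ^+ m.+1 by rewrite exprn_ege1.
  apply: (le_trans (prod_le_expn Cn _)) => [k _|]; last by rewrite card_ord exprM.
  rewrite normr_ge0 normr_prod /= -[in leRHS](card_ord m.+1).
  by apply: prod_le_expn => // l _; exact: a_C.
move=> j l jl.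
rewrite -!aE; have [lj|jl'|/val_inj e] := ltngtP j l; last by rewrite e eqxx in jl.
  by rewrite distrC; apply: gap; rewrite /= /bump /=; lia.
by apply: gap; rewrite /= /bump /=; lia.
Qed.

End Basis.

Lemma sqrt_dist (x y e : R) : 0 <= x -> 0 <= y -> 0 <= e -> `|x - y| <= e ^+ 2 ->
  `|Num.sqrt x - Num.sqrt y| <= e.
Proof.
move=> x0 y0 e0; rewrite !ler_distl => /andP[h1 h2].
have half (z t : R) : 0 <= z -> 0 <= t -> z <= t + e ^+ 2 -> Num.sqrt z <= Num.sqrt t + e.
  move=> z0 t0 zt; have st0 := sqrtr_ge0 t.
  rewrite -ler_sqr ?nnegrE ?addr_ge0 ?sqrtr_ge0 // sqr_sqrtr // sqrrD sqr_sqrtr //.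
  have : 0 <= Num.sqrt t * e by exact: mulr_ge0.
  by rewrite -mulr_natl; lra.
rewrite lerBlDr; apply/andP; split; apply: half => //; lra.
Qed.

(** Orthogonality of [O] and small off-diagonal entries force its diagonal entries close to 1 or -1;
    the signs disappear in squared coordinate differences. The square root being Hölder of exponent
    1/2, the condition involves [eps ^+ 2]. *)
Lemma dist_of_close_bases m s (U U' : 'M[R]_(m, m.+1)) (X X' : 'M[R]_(s, m.+1)) (rho eps : R) :
  (0 < m)%N -> (s <= m)%N -> U *m U^T = 1%:M -> U *m one m.+1 = 0 ->
  U' *m U'^T = 1%:M -> U' *m one m.+1 = 0 ->
  (forall (k : 'I_s) (k' : 'I_m), k = k' :> nat -> forall i,
     X k i = Num.sqrt m%:R * U k' i) ->
  (forall (k : 'I_s) (k' : 'I_m), k = k' :> nat -> forall i,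
     X' k i = Num.sqrt m%:R * U' k' i) ->
  (forall j l, j != l -> `|(U *m U'^T) j l| <= rho) ->
  0 <= rho <= 1 -> 0 <= eps -> 16 * m%:R ^+ 4 * rho <= eps ^+ 2 ->
  forall i j, `|eucl_dist (col i X') (col j X') - eucl_dist (col i X) (col j X)| <= eps.
Proof.
move=> m_gt0 sm UU U1 UU' U1' XE XE' Orho /andP[rho0 rho1] eps0 rho_eps i j.
set O := U *m U'^T in Orho.
have OO : O^T *m O = 1%:M.
  rewrite /O trmx_mul trmxK -mulmxA [U^T *m _]mulmxA basis_complete // mulmxA.
  rewrite -mulmxA (centering_fix (A := U'^T)) //.
  by rewrite -[LHS]trmxK trmx_mul !trmxK U1' trmx0.
have U'E : U' = O^T *m U.
  rewrite /O trmx_mul trmxK -mulmxA basis_complete // -[LHS]trmxK -[RHS]trmxK trmx_mul.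
  rewrite centering_sym; congr (_^T); rewrite centering_fix //.
  by rewrite -[LHS]trmxK trmx_mul !trmxK U1' trmx0.
pose a k := U k i - U k j; pose a' k := U' k i - U' k j.
have a2 k : `|a k| <= 2.
  by rewrite (le_trans (ler_normB _ _)) //; have := basis_entry_le1 UU k i;
    have := basis_entry_le1 UU k j; lra.
have m1 : 1 <= (m%:R : R) by rewrite ler1n.
have mrho0 : 0 <= m%:R * rho by rewrite mulr_ge0.
have a'E k : exists2 r, `|r| <= 2 * m%:R * rho & a' k = O k k * a k + r.
  exists (\sum_(l | l != k) O l k * a l).
    apply: (le_trans (ler_norm_sum _ _ _)).
    apply: (@le_trans _ _ (\sum_(l < m) (2 * rho))); last first.
      by rewrite sumr_const card_ord -[_ *+ m]mulr_natl; lra.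
    rewrite [leRHS](bigID (fun l => l != k)) /= -[leLHS]addr0; apply: lerD.
      by apply: ler_sum => l lk; rewrite normrM mulrC ler_pM // Orho.
    by apply: sumr_ge0 => l _; rewrite mulr_ge0.
  rewrite /a' U'E !mxE -sumrB (bigD1 k) //=; congr (_ + _).
    by rewrite !mxE -mulrBr.
  by apply: eq_bigr => l _; rewrite !mxE -mulrBr.
have O2 k : 1 - m%:R * rho <= O k k ^+ 2 <= 1.
  have : \sum_l O l k ^+ 2 = 1.
    have := congr1 (fun N : 'M[R]_m => N k k) OO; rewrite !mxE eqxx mulr1n => <-.
    by apply: eq_bigr => l _; rewrite !mxE expr2.
  rewrite (bigD1 k) //= => sum1.
  have : 0 <= \sum_(l | l != k) O l k ^+ 2 by apply: sumr_ge0 => l _; exact: sqr_ge0.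
  have : \sum_(l | l != k) O l k ^+ 2 <= m%:R * rho.
    apply: (@le_trans _ _ (\sum_(l < m) rho)); last first.
      by rewrite sumr_const card_ord -[_ *+ m]mulr_natl.
    rewrite [leRHS](bigID (fun l => l != k)) /= -[leLHS]addr0; apply: lerD.
      apply: ler_sum => l lk; have := Orho l k lk => O_le.
      rewrite -real_normK ?num_real // expr2.
      apply: (@le_trans _ _ (rho * 1)); last by rewrite mulr1.
      by apply: ler_pM => //; apply: le_trans rho1.
    by apply: sumr_ge0 => l _.
  by move=> sum_le sum_ge; apply/andP; split; lra.
have aa' k : `|a' k ^+ 2 - a k ^+ 2| <= 16 * m%:R ^+ 2 * rho.
  have [r r_le ->] := a'E k; have /andP[lo2 hi2] := O2 k.
  have o_le1 : `|O k k| <= 1 by rewrite -(@expr_le1 _ 2) // real_normK ?num_real.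
  have -> : (O k k * a k + r) ^+ 2 - a k ^+ 2 =
     (O k k ^+ 2 - 1) * a k ^+ 2 + 2 * (O k k * (a k * r)) + r * r by ring.
  (* The three terms contribute 4 m rho, 8 m rho and 4 m^2 rho, whence the constant 16 m^2 rho. *)
  have t1 : `|(O k k ^+ 2 - 1) * a k ^+ 2| <= m%:R * rho * 4.
    rewrite normrM; apply: ler_pM => //; first by rewrite ler_norml; apply/andP; split; lra.
    by rewrite normrX (_ : 4 = 2 ^+ 2); [rewrite lerXn2r ?nnegrE|ring].
  have ar : `|a k * r| <= 2 * (2 * m%:R * rho) by rewrite normrM ler_pM.
  have t2 : `|2 * (O k k * (a k * r))| <= 2 * (1 * (2 * (2 * m%:R * rho))).
    by rewrite normrM ger0_norm // ler_wpM2l // normrM ler_pM.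
  have t3 : `|r * r| <= (2 * m%:R * rho) * (2 * m%:R * 1).
    rewrite normrM; apply: ler_pM => //; apply: (le_trans r_le).
    by rewrite ler_wpM2l // mulr_ge0.
  apply: (le_trans (ler_normD _ _)).
  have := ler_normD ((O k k ^+ 2 - 1) * a k ^+ 2) (2 * (O k k * (a k * r))).
  have : m%:R * rho <= m%:R ^+ 2 * rho by rewrite ler_wpM2r // expr2 ler_peMl //; lra.
  nra.
apply: sqrt_dist => //.
- by apply: sumr_ge0 => k _; exact: sqr_ge0.
- by apply: sumr_ge0 => k _; exact: sqr_ge0.
apply: le_trans rho_eps; rewrite -sumrB; apply: (le_trans (ler_norm_sum _ _ _)).
apply: (@le_trans _ _ (\sum_(k < s) (m%:R * (16 * m%:R ^+ 2 * rho)))).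
  apply: ler_sum => k _; pose k' : 'I_m := widen_ord sm k.
  have -> : (col i X' k 0 - col j X' k 0) ^+ 2 - (col i X k 0 - col j X k 0) ^+ 2 =
      m%:R * (a' k' ^+ 2 - a k' ^+ 2).
    rewrite !mxE !(XE k k') // !(XE' k k') // -!mulrBr !exprMn sqr_sqrtr //.
    by rewrite /a /a'; ring.
  by rewrite normrM ger0_norm // ler_wpM2l.
rewrite sumr_const card_ord -[_ *+ s]mulr_natl.
apply: (@le_trans _ _ (m%:R * (m%:R * (16 * m%:R ^+ 2 * rho)))).
  rewrite ler_wpM2r ?ler_nat // mulr_ge0 // mulr_ge0 // mulr_ge0 // sqr_ge0.
by rewrite le_eqVlt; apply/orP; left; apply/eqP; ring.
Qed.

End SpectralGap.

(** * Comparison of the two compressed clouds *)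

Section CloseClouds.
Context {R : realType}.
Local Notation one n := (const_mx 1 : 'cV[R]_n).
Local Notation J m := (centering m : 'M[R]_m.+1).

Lemma quadratic_form_le n (x : 'rV[R]_n) (B : 'M[R]_n) (b : R) :
  (forall i j, `|B i j| <= b) -> 0 <= b ->
  `|(x *m B *m x^T) 0 0| <= n%:R * b * \sum_i x 0 i ^+ 2.
Proof.
move=> Bb b0.
have -> : (x *m B *m x^T) 0 0 = \sum_j \sum_i x 0 i * B i j * x 0 j.
  by rewrite mxE; apply: eq_bigr => j _; rewrite !mxE mulr_suml.
apply: (le_trans (ler_norm_sum _ _ _)).
apply: (@le_trans _ _ (\sum_j \sum_i b * ((x 0 i ^+ 2 + x 0 j ^+ 2) / 2))).
  apply: ler_sum => j _; apply: (le_trans (ler_norm_sum _ _ _)).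
  apply: ler_sum => i _; rewrite !normrM [`|x 0 i| * _]mulrC -mulrA.
  apply: ler_pM; rewrite ?mulr_ge0 //.
  rewrite -[x 0 i ^+ 2]real_normK ?num_real // -[x 0 j ^+ 2]real_normK ?num_real //.
  by have := sqr_ge0 (`|x 0 i| - `|x 0 j|); nra.
rewrite le_eqVlt; apply/orP; left; apply/eqP.
set S := \sum_i x 0 i ^+ 2.
transitivity (\sum_(j < n) (b * (S + n%:R * x 0 j ^+ 2) / 2)).
  apply: eq_bigr => j _; rewrite -mulr_sumr -mulr_suml big_split /= sumr_const.
  by rewrite card_ord -[_ *+ n]mulr_natl mulrA.
rewrite -mulr_suml -mulr_sumr big_split /= -mulr_sumr -/S sumr_const card_ord.
by rewrite -[S *+ n]mulr_natl; field.
Qed.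

Lemma centered_gram_sym d m (Z : 'M[R]_(d, m.+1)) :
  (centered_gram Z)^T = centered_gram Z.
Proof.
by rewrite /centered_gram !trmx_mul trmxK centering_sym !mulmxA.
Qed.

Lemma centered_gramE d m (Z : 'M[R]_(d, m.+1)) (v r : R) : r != 0 ->
  centered_gram Z =
  (v * r ^+ 2) *: J m + r *: normalized_gram v r (Z^T *m Z).
Proof.
move=> r0; rewrite /normalized_gram scalerA divff // scale1r.
rewrite (mulmxBr (J m) (Z^T *m Z)) (mulmxBl (J m *m (Z^T *m Z)) _ (J m)).
rewrite mul_mx_scalar -scalemxAl centering_idem addrC subrK //.
Qed.

Lemma row_sqr_gt0 n (x : 'rV[R]_n) : x != 0 -> 0 < \sum_i x 0 i ^+ 2.
Proof.
move=> x0; rewrite lt_neqAle sumr_ge0 ?andbT => [|i _]; last exact: sqr_ge0.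
apply: contra x0; rewrite eq_sym psumr_eq0 => [/allP s0|i _]; last exact: sqr_ge0.
apply/eqP/rowP => i; rewrite mxE; have := s0 i (mem_index_enum _).
by rewrite sqrf_eq0 => /eqP.
Qed.

(** Orthogonally to the constant vector the form is g |x|^2 plus an error of at most (m + 1) b
    |x|^2. *)
Lemma perturbed_definite m (G D : 'M[R]_m.+1) (g b : R) :
  G = g *: J m + D -> (forall i j, `|D i j| <= b) -> 0 <= b -> m.+1%:R * b < g ->
  forall x : 'rV[R]_m.+1, x != 0 -> x *m one m.+1 = 0 -> x *m G *m x^T != 0.
Proof.
move=> GE Db b0 bg x x0 x1; apply/eqP => /(congr1 (fun N : 'M[R]_1 => N 0 0)).
have xJ : x *m J m = x.
  rewrite -[RHS]trmxK -(@centering_fix _ _ _ x^T); first by rewrite trmx_mul trmxK centering_sym.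
  by rewrite -[LHS]trmxK trmx_mul !trmxK x1 trmx0.
have S0 := row_sqr_gt0 x0.
have := quadratic_form_le x Db b0; rewrite GE mulmxDr mulmxDl -scalemxAr xJ -scalemxAl.
set q := x *m D *m x^T; rewrite ler_norml => /andP[q_ge _].
rewrite mxE [X in X + _]mxE [X in _ * X]mxE [RHS]mxE.
rewrite (eq_bigr (fun i => x 0 i ^+ 2)); last by move=> i _; rewrite mxE expr2.
move=> eq0; move: q_ge; rewrite leNgt => /negP; apply.
have : m.+1%:R * b * \sum_i x 0 i ^+ 2 < g * \sum_i x 0 i ^+ 2 by rewrite ltr_pM2r.
lra.
Qed.

(** A Davis-Kahan argument: [O j l * (mu' l - mu j)] is an entry of [U *m D *m U'^T], hence bounded,
    while for j != l the second factor is at least of order r. *)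
Lemma distance_close m s (v K M eta eps : R) :
  (0 < m)%N -> (s <= m)%N -> 0 < v -> 0 <= K -> 0 <= M -> 0 < eta -> 0 < eps ->
  exists c : R, forall r d (Z Z' : 'M[R]_(d, m.+1)) (Zhat Zhat' : 'M[R]_(s, m.+1)),
    c <= r -> (m <= d)%N ->
    eta <= `|discr (normalized_gram v r (Z^T *m Z))| ->
    (forall i j, `|(Z^T *m Z) i j - (v * r ^+ 2) *+ (i == j)| <= K * r) ->
    (forall i j, `|(Z'^T *m Z' - Z^T *m Z) i j| <= M) ->
    is_normalized_pca Z Zhat -> is_normalized_pca Z' Zhat' ->
    forall i j, `|eucl_dist (col i Zhat') (col j Zhat') -
                  eucl_dist (col i Zhat) (col j Zhat)| <= eps.
Proof.
move=> m_gt0 sm v0 K0 M0 eta0 eps0.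
pose n2 : R := m.+1%:R * m.+1%:R.
have n2_ge1 : 1 <= n2 by rewrite /n2 mulr_ege1 ?ler1n.
have m1 : 1 <= (m%:R : R) by rewrite ler1n.
pose KA := n2 * K; pose MD := n2 * M.
have KA0 : 0 <= KA by rewrite mulr_ge0 //; lra.
have MD0 : 0 <= MD by rewrite mulr_ge0 //; lra.
pose C := (2 * (m%:R + 1) ^+ 2 * KA + 1) ^+ (m.+1 + m.+1 * m.+1).
have C0 : 0 < C.
  by rewrite exprn_gt0 // ltr_wpDl // !mulr_ge0 ?sqr_ge0.
pose delta := Num.sqrt eta / C.
have delta0 : 0 < delta by rewrite divr_gt0 ?sqrtr_gt0.
pose rho := Num.min 1 (eps ^+ 2 / (16 * m%:R ^+ 4)).
have m4 : 0 < 16 * (m%:R : R) ^+ 4 by rewrite mulr_gt0 ?exprn_gt0 //; lra.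
have rho0 : 0 < rho by rewrite lt_min ltr01 divr_gt0 ?exprn_gt0.
have rho1 : rho <= 1 by rewrite ge_min lexx.
have rho_eps : 16 * m%:R ^+ 4 * rho <= eps ^+ 2.
  by rewrite mulrC -ler_pdivlMr // ge_min lexx orbT.
(* The added 1 makes [e1] positive, for the cancellation that bounds the off-diagonal entries of
   [O]. *)
pose e1 := m.+1%:R * m.+1%:R * MD + 1.
have e10 : 0 < e1 by rewrite ltr_wpDl // !mulr_ge0.
(* The second term makes both Gram forms definite; the third leaves a gap above [e1 / rho] after the
   displacement of the eigenvalues allowed by Weyl's inequality. *)
pose c := 1 + m.+1%:R * (KA + MD) / v + (e1 / rho + m%:R * e1) / delta + 1 / delta.
exists c => r d Z Z' Zhat Zhat' cr md eta_le WK W'M pcaZ pcaZ'.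
have c_parts : [/\ 1 <= r, m.+1%:R * (KA + MD) / v < r
    & (e1 / rho + m%:R * e1) / delta < r].
  have p1 : 0 <= m.+1%:R * (KA + MD) / v by rewrite divr_ge0 ?mulr_ge0 ?addr_ge0 // ltW.
  have p2 : 0 <= (e1 / rho + m%:R * e1) / delta.
    by rewrite divr_ge0 ?addr_ge0 ?mulr_ge0 ?invr_ge0 // ltW.
  have p3 : 0 < 1 / delta by rewrite divr_gt0.
  by move: cr; rewrite /c => cr; split; lra.
have [r1 r_def r_gap] := c_parts.
have r0 : 0 < r by lra.
set A := normalized_gram v r (Z^T *m Z) in eta_le.
have A_K i j : `|A i j| <= KA.
  rewrite /A /normalized_gram mxE normrM gtr0_norm ?invr_gt0 // mulrC ler_pdivrMr //.
  rewrite /KA -mulrA; apply: norm_mulmx3_le; try exact: centering_entry_le1.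
  by move=> k l; rewrite !mxE; have := WK k l; rewrite !mxE.
pose D := centered_gram Z' - centered_gram Z.
have D_M i j : `|D i j| <= MD.
  rewrite /D /centered_gram mxE [X in _ + X]mxE -mulmx3B_entry.
  by apply: norm_mulmx3_le => //; exact: centering_entry_le1.
have rN0 : r != 0 by rewrite gt_eqF.
have GE := centered_gramE Z v rN0.
have rA_K i j : `|(r *: A) i j| <= r * KA by rewrite mxE normrM gtr0_norm // ler_wpM2l // ltW.
have vr : m.+1%:R * (r * KA + MD) < v * r ^+ 2.
  move: r_def; rewrite ltr_pdivrMr // => r_def.
  apply: (@le_lt_trans _ _ (r * (m.+1%:R * (KA + MD)))).
    rewrite (_ : r * (m.+1%:R * (KA + MD)) = m.+1%:R * (r * KA + r * MD)); last by ring.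
    by rewrite ler_wpM2l // lerD2l ler_peMl.
  by rewrite (_ : v * r ^+ 2 = r * (r * v)); [rewrite ltr_pM2l|ring].
have defZ : forall x : 'rV[R]_m.+1, x != 0 -> x *m one m.+1 = 0 ->
    x *m centered_gram Z *m x^T != 0.
  apply: (perturbed_definite GE rA_K); first by rewrite mulr_ge0 // ltW.
  by apply: le_lt_trans vr; rewrite ler_wpM2l // lerDl.
have defZ' : forall x : 'rV[R]_m.+1, x != 0 -> x *m one m.+1 = 0 ->
    x *m centered_gram Z' *m x^T != 0.
  apply: (@perturbed_definite _ _ (r *: A + D) (v * r ^+ 2) (r * KA + MD)) => //.
  - by rewrite addrA -GE /D addrC subrK.
  - by move=> i j; rewrite mxE; apply: (le_trans (ler_normD _ _)); exact: lerD.
  - by rewrite addr_ge0 // mulr_ge0 // ltW.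
have [U [mu [[UU U1 mu_dec UG] ZhatE]]] := pca_dual m_gt0 md pcaZ defZ.
have [U' [mu' [[UU' U1' mu'_dec UG'] ZhatE']]] := pca_dual m_gt0 md pcaZ' defZ'.
pose alpha k := (mu k - v * r ^+ 2) / r.
have UA : U *m A = diag_mx (\row_k alpha k) *m U.
  have UJ : U *m J m = U by rewrite -(basis_complete UU U1) mulmxA UU mul1mx.
  have : r *: (U *m A) = U *m centered_gram Z - (v * r ^+ 2) *: U.
    by rewrite GE mulmxDr -!scalemxAr UJ addrAC subrr add0r.
  move=> /(congr1 ( *:%R r^-1)); rewrite scalerA mulVf // scale1r UG => ->.
  by apply/matrixP => k i; rewrite !mul_diag_mx !mxE /alpha; field.
have gap j l : j != l -> r * delta <= `|mu j - mu l|.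
  move=> jl.
  have A1 : A *m one m.+1 = 0 by rewrite /A /normalized_gram -scalemxAl -mulmxA centering_one mulmx0 scaler0.
  have oneA : (one m.+1)^T *m A = 0.
    by rewrite /A /normalized_gram -scalemxAr !mulmxA one_centering !mul0mx scaler0.
  have := gap_of_discr UU U1 A1 oneA UA A_K (ltW eta0) eta_le jl.
  rewrite -/C -ler_pdivrMr // -/delta.
  have -> : alpha j - alpha l = (mu j - mu l) / r by rewrite /alpha; field; lra.
  by rewrite normrM [`|r^-1|]gtr0_norm ?invr_gt0 // ler_pdivlMr // mulrC.
pose O := U *m U'^T.
have OO : O *m O^T = 1%:M.
  rewrite /O trmx_mul trmxK mulmxA -(mulmxA U) (basis_complete UU' U1').
  by rewrite -(basis_complete UU U1) mulmxA UU mul1mx UU.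
have Oe j l : `|O j l * (mu' l - mu j)| <= e1.
  have -> : O j l * (mu' l - mu j) = (U *m D *m U'^T) j l.
    have -> : U *m D *m U'^T = O *m diag_mx (\row_k mu' k) - diag_mx (\row_k mu k) *m O.
      rewrite /D mulmxBr mulmxBl UG -mulmxA; congr (_ - _); last by rewrite mulmxA.
      rewrite -[centered_gram Z']centered_gram_sym -trmx_mul UG' trmx_mul tr_diag_mx.
      by rewrite mulmxA.
    by rewrite mul_mx_diag mul_diag_mx; move: (O) => O'; rewrite !mxE; ring.
  apply: (@le_trans _ _ (m.+1%:R * m.+1%:R * MD)); last by rewrite lerDl.
  apply: norm_mulmx3_le => // k i; first exact: basis_entry_le1.
  by rewrite mxE; exact: basis_entry_le1.
have weyl k : `|mu' k - mu k| <= m%:R * e1.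
  have := weyl_le OO mu_dec mu'_dec Oe k.
  have Oe' j l : `|O^T j l * (mu l - mu' j)| <= e1.
    by rewrite mxE -normrN -mulrN opprB.
  have OO' : O^T *m O^T^T = 1%:M by rewrite trmxK; exact: mulmx1C.
  have := weyl_le OO' mu'_dec mu_dec Oe' k.
  by rewrite ler_distl => h1 h2; apply/andP; split; lra.
have Orho j l : j != l -> `|O j l| <= rho.
  move=> jl; have := gap _ _ jl; have := weyl l; have := Oe j l.
  rewrite normrM => Ojl wl gap_jl.
  have far : r * delta - m%:R * e1 <= `|mu' l - mu j|.
    have := ler_distD (mu' l) (mu j) (mu l); rewrite [`|mu j - mu' l|]distrC; lra.
  move: r_gap; rewrite ltr_pdivrMr // => r_gap.
  have e1rho : e1 / rho < r * delta - m%:R * e1 by lra.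
  have : `|O j l| * (e1 / rho) <= e1.
    by apply: le_trans Ojl; rewrite ler_wpM2l //; lra.
  by rewrite mulrCA -ler_pdivlMl // mulVf ?gt_eqF // ler_pdivrMr // mul1r.
apply: (@dist_of_close_bases _ _ _ U U' _ _ rho) => //; last exact: ltW.
by rewrite ltW.
Qed.

End CloseClouds.

(** * Products of Gaussian measures *)

Section Density.
Import HBNNSimple.
Context {R : realType} d (T : measurableType d) (mu nu : {measure set T -> \bar R}).
Local Open Scope ereal_scope.

(** Monotone approximation of f by simple functions reduces the claim to indicators, where it is the
    hypothesis on [nu]. *)
Lemma ge0_integral_density (g : T -> R) (f : T -> \bar R) :
  measurable_fun setT g -> (forall x, 0 <= g x)%R ->
  (forall A, measurable A -> nu A = \int[mu]_(x in A) (g x)%:E) ->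
  measurable_fun setT f -> (forall x, 0 <= f x) ->
  \int[nu]_x f x = \int[mu]_x (f x * (g x)%:E).
Proof.
move=> mg g0 nuE mf f0.
have mgE : measurable_fun setT (EFin \o g) by exact/measurable_EFinP.
pose h := nnsfun_approx measurableT mf.
have -> : \int[nu]_x f x = lim (\int[nu]_x (EFin \o h n) x @[n --> \oo]).
  have fE x : setT x -> f x = lim ((EFin \o h n) x @[n --> \oo]).
    by move=> Ex; apply/esym/cvg_lim => //; exact: cvg_nnsfun_approx.
  under eq_integral => x /[!inE] /fE -> //.
  apply: monotone_convergence => //.
  - move=> n; apply/measurable_EFinP.
    by apply: (measurable_funS measurableT) => //; exact/measurable_funP.
  - by move=> n x Ex //=; rewrite lee_fin.
  - by move=> x Ex a b ab; rewrite lee_fin; exact/lefP/nd_nnsfun_approx.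
have -> : \int[mu]_x (f x * (g x)%:E) =
    lim (\int[mu]_x ((EFin \o h n) x * (g x)%:E) @[n --> \oo]).
  have fg x : setT x -> f x * (g x)%:E = lim (((EFin \o h n) x * (g x)%:E) @[n --> \oo]).
    by move=> Ex; apply/esym/cvg_lim => //; apply: cvgeZr => //; exact: cvg_nnsfun_approx.
  under eq_integral => x /[!inE] /fg -> //.
  apply: monotone_convergence => //.
  - by move=> n; apply/emeasurable_funM => //; exact/measurable_EFinP.
  - by move=> n x Ex /=; rewrite mule_ge0 ?lee_fin.
  - by move=> x Ex a b ab/=; rewrite lee_wpmul2r ?lee_fin//; exact/lefP/nd_nnsfun_approx.
suff suf n : \int[nu]_x (EFin \o h n) x = \int[mu]_x ((EFin \o h n) x * (g x)%:E).
  by under eq_fun do rewrite suf.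
transitivity (\int[nu]_x
   (\sum_(y \in range (h n)) (y * \1_(h n @^-1` [set y]) x)%:E)).
  by apply: eq_integral => t tE; rewrite /= fimfunE -fsumEFin.
have indich m r : measurable_fun setT (fun x => (r * \1_(h m @^-1` [set r]) x)%:E).
  by apply: (measurable_comp measurableT) => //; exact: measurable_funM.
rewrite ge0_integral_fsum//; last by move=> m y Ey; exact: nnfun_muleindic_ge0.
transitivity (\int[mu]_x (\sum_(y \in range (h n))
    (y * \1_(h n @^-1` [set y]) x)%:E * (g x)%:E)); last first.
  apply: eq_integral => x xE.
  rewrite -ge0_mule_fsuml => [|y]; last exact: nnfun_muleindic_ge0.
  by rewrite fsumEFin // -(fimfunE _ x).
rewrite ge0_integral_fsum//; last 2 first.
  - by move=> y; apply: emeasurable_funM.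
  - by move=> m y Ey; apply: mule_ge0; [exact: nnfun_muleindic_ge0|rewrite lee_fin].
apply: eq_fsbigr => r rhn.
under eq_integral do rewrite EFinM.
rewrite integralZl_indic_nnsfun => //.
under [RHS]eq_integral do rewrite EFinM -muleA.
have r0 : (0 <= r)%R by move: rhn; rewrite inE => -[x _ <-].
rewrite ge0_integralZl//; last 2 first.
- by apply: emeasurable_funM => //; exact/measurable_EFinP.
- by move=> x _; rewrite mule_ge0 // lee_fin.
congr (_ * _); rewrite integral_indic // setIT nuE // integral_mkcond.
by apply: eq_integral => x _; rewrite epatch_indic muleC.
Qed.

End Density.

Section SquareDomination.
Context {R : realType}.
Local Open Scope ereal_scope.

(* This holds with [c] the integral of [(dmu / dnu) ^ 2] against [nu], and the
   constants multiply on products. *)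
Definition square_dominated d (T : measurableType d)
    (mu nu : {measure set T -> \bar R}) (c : R) : Prop :=
  forall f : T -> \bar R, measurable_fun setT f -> (forall x, 0 <= f x) ->
    (\int[mu]_x f x) * (\int[mu]_x f x) <= c%:E * \int[nu]_x (f x * f x).

(** Stated with test functions, the bound tensorizes by Tonelli: apply it to the inner integral as a
    function of the first variable, then to f in the second variable. *)
Lemma square_dominated_prod d1 d2 (T1 : measurableType d1) (T2 : measurableType d2)
    (mu1 nu1 : probability T1 R) (mu2 nu2 : probability T2 R) (c1 c2 : R) :
  (0 <= c1)%R -> (0 <= c2)%R ->
  square_dominated mu1 nu1 c1 -> square_dominated mu2 nu2 c2 ->
  square_dominated (mu1 \x mu2) (nu1 \x nu2) (c1 * c2).
Proof.
move=> c10 c20 dom1 dom2 f mf f0.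
have mff : measurable_fun setT (fun x => f x * f x) by exact: emeasurable_funM.
have ff0 x : 0 <= f x * f x by exact: mule_ge0.
rewrite !fubini_tonelli1 //.
apply: (le_trans (dom1 _ _ _)).
- exact: measurable_fun_fubini_tonelli_F.
- by move=> x; apply: integral_ge0 => y _.
rewrite EFinM -muleA; apply: lee_wpmul2l; first by rewrite lee_fin.
rewrite -ge0_integralZl //.
- apply: ge0_le_integral => //.
  + by move=> x _; apply: mule_ge0; apply: integral_ge0.
  + by apply: emeasurable_funM; exact: measurable_fun_fubini_tonelli_F.
  + apply: emeasurable_funM => //.
    exact: (@measurable_fun_fubini_tonelli_F _ _ _ _ _ nu2 (fun x => f x * f x)).
  + move=> x _; apply: dom2 => //.
    exact: measurableT_comp mf (measurable_pair1 _).
- exact: (@measurable_fun_fubini_tonelli_F _ _ _ _ _ nu2 (fun x => f x * f x)).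
- by move=> x _; apply: integral_ge0.
Qed.

End SquareDomination.

Section IteratedProduct.
Context {R : realType} d (T : measurableType d).
Local Open Scope ereal_scope.

Definition tuple_cons m (p : T * m.-tuple T) : m.+1.-tuple T := [tuple of p.1 :: p.2].

Lemma measurable_tuple_cons m : measurable_fun setT (@tuple_cons m).
Proof. exact: measurable_cons. Qed.

HB.instance Definition _ m :=
  isMeasurableFun.Build _ _ _ _ (@tuple_cons m) (@measurable_tuple_cons m).

(** The measures are indexed by [nat] rather than by ['I_m], so that the recursion is a mere
    shift. *)
Fixpoint iterated_product (m : nat) (mu : nat -> probability T R) :
    probability (m.-tuple T) R :=
  match m return probability (m.-tuple T) R with
  | 0 => dirac [tuple]
  | m'.+1 => distribution (mu 0%N \x iterated_product m' (fun k => mu k.+1))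
               (@tuple_cons m')
  end.

Lemma integral_iterated_product0 mu (f : 0.-tuple T -> \bar R) :
  (forall t, 0 <= f t) ->
  \int[iterated_product 0 mu]_t f t = f [tuple].
Proof.
move=> f0; rewrite /= integral_dirac //; last first.
  move=> _ A mA; rewrite setTI.
  have [fA|nfA] := pselect (A (f [tuple])).
    rewrite (_ : _ @^-1` _ = setT) //; apply/seteqP; split=> // t _ /=.
    by rewrite (tuple0 t).
  rewrite (_ : _ @^-1` _ = set0) //; apply/seteqP; split=> // t /=.
  by rewrite (tuple0 t).
by rewrite diracT mul1e.
Qed.

Lemma integral_iterated_productS m mu (f : m.+1.-tuple T -> \bar R) :
  measurable_fun setT f -> (forall t, 0 <= f t) ->
  \int[iterated_product m.+1 mu]_t f t =
  \int[mu 0%N]_x \int[iterated_product m (fun k => mu k.+1)]_t f (tuple_cons (x, t)).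
Proof.
move=> mf f0; rewrite /= ge0_integral_distribution // fubini_tonelli1 //.
  exact: measurableT_comp mf (@measurable_tuple_cons m).
by move=> x; exact: f0.
Qed.

Lemma square_dominated_iterated m (mu nu : nat -> probability T R) (c : nat -> R) :
  (forall k, 0 <= c k)%R -> (forall k, square_dominated (mu k) (nu k) (c k)) ->
  square_dominated (iterated_product m mu) (iterated_product m nu) (\prod_(k < m) c k).
Proof.
elim: m mu nu c => [|m IH] mu nu c c0 dom f mf f0.
  rewrite !integral_iterated_product0 // ?big_ord0 ?mul1e // => t; exact: mule_ge0.
rewrite big_ord_recl /= !ge0_integral_distribution //; last 2 first.
- exact: emeasurable_funM.
- by move=> t; exact: mule_ge0.
apply: (square_dominated_prod (c0 0%N) _ (dom 0%N) (IH _ _ (fun k => c k.+1) _ _)) => //.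
- by apply: prodr_ge0.
- exact: measurableT_comp mf (@measurable_tuple_cons m).
- by move=> x; exact: f0.
Qed.

End IteratedProduct.

Section RealMeasures.
Context {R : realType}.
Local Open Scope ereal_scope.
Local Notation mu := (@lebesgue_measure R).

Lemma measure_ocitv_unique (m1 m2 : {measure set (measurableTypeR R) -> \bar R}) :
  (forall a b : R, (a < b)%R -> m1 `]a, b]%classic = m2 `]a, b]%classic) ->
  (forall a b : R, m1 `]a, b]%classic < +oo) ->
  forall A, measurable A -> m1 A = m2 A.
Proof.
move=> m12 fin A mA.
apply: (@measure_unique _ R (measurableTypeR R) (@ocitv R) (fun k => `](- k%:R)%R, k%:R%R]%classic)) => //.
- by move=> X Y; exact: ocitvI.
- by move=> k; exists (- k%:R, k%:R)%R.
- apply/seteqP; split=> // x _; exists (Num.bound `|x|) => //=.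
  rewrite in_itv /=; have := archi_boundP (normr_ge0 x); rewrite ltr_norml => /andP[-> h] /=.
  exact: ltW.
- move=> _ [[a b] _ <-] /=; have [ab|ba] := ltP a b; first exact: m12.
  by rewrite set_itv_ge ?measure0 // bnd_simp -leNgt.
Qed.

Lemma integral_normal_itv (m s a b : R) : (s != 0)%R ->
  normal_prob m s `]a, b]%classic = \int[mu]_(x in `[a, b]) (normal_pdf m s x)%:E.
Proof.
move=> s0; rewrite /normal_prob integral_itv_obnd_cbnd //.
by apply/measurable_EFinP; apply: measurable_funTS; exact: measurable_normal_pdf.
Qed.

Lemma normal_pdf_scale (s x : R) : (0 < s)%R ->
  normal_pdf 0 s x = (normal_pdf 0 1 (x / s) / s)%R.
Proof.
move=> s0; rewrite !normal_pdfE ?gt_eqF ?oner_neq0 //= /normal_peak /normal_fun.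
rewrite !subr0 expr1n mul1r -mulrnAr sqrtrM ?sqr_ge0 // sqrtr_sqr gtr0_norm // invfM.
have -> : (- (x / s) ^+ 2 / (1 *+ 2) = - x ^+ 2 / (s ^+ 2 *+ 2))%R by field; rewrite gt_eqF.
by ring.
Qed.

Lemma normal_prob_scale (s : R) (A : set R) : (0 < s)%R -> measurable A ->
  normal_prob 0 1 [set x | A (s * x)%R] = normal_prob 0 s A.
Proof.
move=> s0 mA.
have ms : measurable_fun [set: measurableTypeR R] (( *%R s) : measurableTypeR R -> measurableTypeR R).
  exact: (measurable_funM (measurable_cst s) (@measurable_id _ R setT)).
pose h : {mfun (measurableTypeR R) >-> (measurableTypeR R)} := HB.pack ( *%R s) (isMeasurableFun.Build _ _ _ _ _ ms).
have eq_itv (a b : R) : (a < b)%R ->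
    distribution (normal_prob 0 1) h `]a, b]%classic = normal_prob 0 s `]a, b]%classic.
  move=> ab; transitivity (normal_prob 0 1 `](a / s)%R, (b / s)%R]%classic).
    congr (normal_prob 0 1 _); apply/seteqP; split=> x /=;
      by rewrite !in_itv /= ltr_pdivrMr // ler_pdivlMr // mulrC.
  have one0 : (1 : R)%R != 0%R by exact: oner_neq0.
  have sn0 : s != 0%R by rewrite gt_eqF.
  rewrite (integral_normal_itv _ _ _ one0) (integral_normal_itv _ _ _ sn0).
  pose F (x : R^o) := (x / s)%R.
  have Fderivable (x : R) : derivable F x 1%R by apply: derivableM.
  have dF : F^`()%classic = cst (s^-1)%R.
    apply/funext => x; rewrite /F derive1E deriveM // derive_cst scaler0 add0r.
    by rewrite derive_id scaler1.
  rewrite -/(F a) -/(F b) integration_by_substitution_increasing //.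
  - apply: eq_integral => x _; rewrite dF /=.
    by rewrite [in RHS]normal_pdf_scale.
  - exact: ltW.
  - by move=> x y _ _ xy; rewrite /F ltr_pM2r // invr_gt0.
  - by rewrite dF => x _; exact: cvg_cst.
  - by rewrite dF; exact: is_cvg_cst.
  - by rewrite dF; exact: is_cvg_cst.
  - split=> //.
    + by apply: cvg_at_right_filter; apply: differentiable_continuous; apply/derivable1_diffP.
    + by apply: cvg_at_left_filter; apply: differentiable_continuous; apply/derivable1_diffP.
  - by apply: continuous_subspaceT; exact: continuous_normal_pdf.
have fin (a b : R) : distribution (normal_prob 0 1) h `]a, b]%classic < +oo.
  by rewrite ltey_eq fin_num_measure.
exact: (measure_ocitv_unique eq_itv fin mA).
Qed.

Lemma normal_prob_opp (A : set R) : measurable A ->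
  normal_prob 0 1 [set x | A (- x)%R] = normal_prob 0 1 A.
Proof.
move=> mA.
have ms : measurable_fun [set: measurableTypeR R] (-%R : measurableTypeR R -> measurableTypeR R).
  exact: (measurable_funN (@measurable_id _ R setT)).
pose h : {mfun (measurableTypeR R) >-> (measurableTypeR R)} :=
  HB.pack (-%R : R -> R) (isMeasurableFun.Build _ _ _ _ _ ms).
have one0 : (1 : R)%R != 0%R by exact: oner_neq0.
have eq_itv (a b : R) : (a < b)%R ->
    distribution (normal_prob 0 1) h `]a, b]%classic = normal_prob 0 1 `]a, b]%classic.
  move=> ab; transitivity (normal_prob 0 1 `[(- b)%R, (- a)%R[%classic).
    congr (normal_prob 0 1 _); apply/seteqP; split=> x /=;
      by rewrite !in_itv /= lerNl ltrNr andbC.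
  rewrite (integral_normal_itv _ _ _ one0) /normal_prob integral_itv_bndo_bndc; last first.
    by apply/measurable_EFinP; apply: measurable_funTS; exact: measurable_normal_pdf.
  rewrite integration_by_substitution_oppr; last 2 first.
  - exact: ltW.
  - by apply: continuous_subspaceT; exact: continuous_normal_pdf.
  apply: eq_integral => x _; congr EFin.
  by rewrite /= !normal_pdfE // /normal_fun !subr0 sqrrN.
have fin (a b : R) : distribution (normal_prob 0 1) h `]a, b]%classic < +oo.
  by rewrite ltey_eq fin_num_measure.
exact: (measure_ocitv_unique eq_itv fin mA).
Qed.

End RealMeasures.

(** * Comparison of centered normal laws *)

Section GaussianIntegrals.
Context {R : realType}.
Local Open Scope ereal_scope.
Local Notation mu := (@lebesgue_measure R).
Local Notation gauss := (normal_prob (0 : R) (1 : R)).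

Lemma ge0_integral_normal (s : R) (f : measurableTypeR R -> \bar R) :
  measurable_fun setT f -> (forall x, 0 <= f x) ->
  \int[normal_prob 0 s]_x f x = \int[mu]_x (f x * (normal_pdf 0 s x)%:E).
Proof.
move=> mf f0.
apply: (@ge0_integral_density R _ (measurableTypeR R) mu (normal_prob 0 s)) => //.
- exact: measurable_normal_pdf.
- by move=> x; exact: normal_pdf_ge0.
Qed.

Lemma normal_pdf_gt0 (s x : R) : (0 < s)%R -> (0 < normal_pdf 0 s x)%R.
Proof.
move=> s0; rewrite normal_pdfE ?gt_eqF // mulr_gt0 ?normal_peak_gt0 ?gt_eqF //.
exact: expR_gt0.
Qed.

(** Cauchy-Schwarz in its linear form, optimized at t = c / X. Linear bounds hold pointwise and can
    be integrated term by term, infinite values included. *)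
Lemma square_le_of_linear_bounds (X I : \bar R) (c : R) : (0 < c)%R -> 0 <= X -> 0 <= I ->
  (forall t : R, (0 < t)%R -> X <= (t / 2)%:E * I + (c / (2 * t))%:E) ->
  X * X <= c%:E * I.
Proof.
move=> c0; case: I => [i| |] // X0 I0 XI; last by rewrite gt0_muley ?lte_fin // leey.
case: X X0 XI => [x| |] // X0 XI; last by have := XI 1%R ltr01; rewrite leye_eq.
move: X0 I0; rewrite !lee_fin => x0 i0.
have [->|xn0] := eqVneq x 0%R; first by rewrite !mul0r mulr_ge0 // ltW.
have x_gt0 : (0 < x)%R by rewrite lt_neqAle eq_sym xn0.
have := XI (c / x)%R (divr_gt0 c0 x_gt0); rewrite lee_fin.
have -> : (c / (2 * (c / x)) = x / 2)%R by field; rewrite !gt_eqF.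
move=> h; have : (x / 2 <= c * i / (2 * x))%R.
  rewrite (_ : (c * i / (2 * x) = c / x / 2 * i)%R); last by field; rewrite gt_eqF.
  lra.
rewrite ler_pdivlMr ?mulr_gt0 // => {}h.
by apply: le_trans h; rewrite le_eqVlt; apply/orP; left; apply/eqP; field.
Qed.

(* With [s] the scale and [u^2 = s^2 / (2 s^2 - 1)], the quotient of the density of
   N(0, 1) squared by the density of N(0, s^2) is [s u] times the density of
   N(0, u^2). *)
Lemma normal_pdf_quotient (s u x : R) : (0 < s)%R -> (0 < u)%R ->
  (u ^+ 2 * (2 * s ^+ 2 - 1) = s ^+ 2)%R ->
  (normal_pdf 0 1 x ^+ 2 / normal_pdf 0 s x = s * u * normal_pdf 0 u x)%R.
Proof.
move=> s0 u0 usE.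
apply: (mulIf (lt0r_neq0 (normal_pdf_gt0 x s0))); rewrite divfK ?gt_eqF ?normal_pdf_gt0 //.
rewrite (normal_pdf_scale x s0) (normal_pdf_scale x u0).
rewrite (_ : (s * u * (normal_pdf 0 1 (x / u) / u) * (normal_pdf 0 1 (x / s) / s) =
  normal_pdf 0 1 (x / u) * normal_pdf 0 1 (x / s))%R); last first.
  by field; rewrite !gt_eqF.
rewrite !normal_pdfE ?oner_neq0 //= /normal_fun !subr0 expr1n.
have n1 : (2 * s ^+ 2 - 1 != 0)%R.
  by apply/eqP => e; move: usE; rewrite e mulr0 => /esym/eqP; rewrite sqrf_eq0 gt_eqF.
have E : (expR (- x ^+ 2 / (1 *+ 2)) ^+ 2 =
    expR (- (x / u) ^+ 2 / (1 *+ 2)) * expR (- (x / s) ^+ 2 / (1 *+ 2)))%R.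
  rewrite expr2 -!expRD; congr expR.
  rewrite !expr_div_n (_ : (u ^+ 2 = s ^+ 2 / (2 * s ^+ 2 - 1))%R); last first.
    by apply: (mulIf n1); rewrite usE divfK.
  by field; rewrite n1 gt_eqF.
by rewrite exprMn E; ring.
Qed.

(** The natural constant is s u, with (s u)^2 = s^4 / (2 s^2 - 1) = 1 + (4 tau^2 + 4 tau^3 + tau^4)
    / (2 s^2 - 1), which is at most 1 + 9 tau^2. The absence of a linear term in tau is what allows
    tau of order d^(-1/2) in each of d coordinates. *)
Lemma normal_square_dominated (tau : R) : (0 <= tau <= 1)%R ->
  square_dominated gauss (normal_prob 0 (1 + tau)) (1 + 9 * tau ^+ 2).
Proof.
move=> /andP[tau0 tau1]; set s := (1 + tau)%R.
have s1 : (1 <= s)%R by rewrite /s lerDl.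
have s0 : (0 < s)%R by lra.
pose q := (2 * s ^+ 2 - 1)%R.
have q1 : (1 <= q)%R by rewrite /q; nra.
pose u := Num.sqrt (s ^+ 2 / q).
have u0 : (0 < u)%R by rewrite sqrtr_gt0 divr_gt0 ?exprn_gt0 //; lra.
have usE : (u ^+ 2 * (2 * s ^+ 2 - 1) = s ^+ 2)%R.
  rewrite sqr_sqrtr; last by rewrite divr_ge0 ?sqr_ge0 //; lra.
  by rewrite -/q divfK // gt_eqF //; lra.
have su_le : (s * u <= 1 + 9 * tau ^+ 2)%R.
  rewrite -ler_sqr ?nnegrE ?mulr_ge0 ?addr_ge0 ?mulr_ge0 ?sqr_ge0 ?(ltW s0) ?(ltW u0) //.
  rewrite exprMn -(ler_pM2r (_ : 0 < q)%R); last lra.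
  rewrite -mulrA usE /q /s; have : (0 <= tau ^+ 2)%R := sqr_ge0 tau.
  have : (0 <= tau ^+ 3)%R by rewrite exprn_ge0.
  have : (0 <= tau ^+ 4)%R by rewrite exprn_ge0.
  have : (0 <= tau ^+ 5)%R by rewrite exprn_ge0.
  have : (0 <= tau ^+ 6)%R by rewrite exprn_ge0.
  have : (tau ^+ 3 <= tau ^+ 2)%R by rewrite exprS ler_piMl ?sqr_ge0.
  have : (tau ^+ 4 <= tau ^+ 2)%R.
    by rewrite (exprD tau 2 2) ler_piMl ?sqr_ge0 // expr_le1.
  nra.
move=> f mf f0.
have su0 : (0 < s * u)%R by rewrite mulr_gt0.
have mff : measurable_fun setT (fun x => f x * f x) by exact: emeasurable_funM.
have ff0 x : 0 <= f x * f x by exact: mule_ge0.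
apply: (@le_trans _ _ ((s * u)%:E * \int[normal_prob 0 s]_x (f x * f x))); last first.
  by rewrite lee_wpmul2r ?lee_fin // integral_ge0.
apply: square_le_of_linear_bounds => //; try exact: integral_ge0.
move=> t t0; rewrite !ge0_integral_normal //.
have mpdf v : measurable_fun [set: measurableTypeR R] (fun x => (normal_pdf 0 v x)%:E).
  by apply/measurable_EFinP; exact: measurable_normal_pdf.
have pdf0 v x : 0 <= (normal_pdf 0 v x : R)%:E by rewrite lee_fin normal_pdf_ge0.
rewrite -ge0_integralZl //; last 3 first.
- exact: emeasurable_funM.
- by move=> x _; exact: mule_ge0.
- by rewrite lee_fin divr_ge0 // ltW.
have -> : (s * u / (2 * t))%:E = \int[mu]_x ((s * u / (2 * t))%:E * (normal_pdf 0 u x)%:E).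
  rewrite ge0_integralZl ?integral_normal_pdf ?mule1 //; try by move=> x _; exact: pdf0.
  by rewrite lee_fin divr_ge0 ?mulr_ge0 ?(ltW s0) ?(ltW u0) ?(ltW t0).
have t2 : 0 <= (t / 2)%:E by rewrite lee_fin divr_ge0 // ltW.
have c2 : 0 <= (s * u / (2 * t))%:E.
  by rewrite lee_fin divr_ge0 ?mulr_ge0 ?(ltW s0) ?(ltW u0) ?(ltW t0).
rewrite -ge0_integralD //; last 4 first.
- by move=> x _; rewrite !mule_ge0.
- by apply: emeasurable_funM => //; exact: emeasurable_funM.
- by move=> x _; rewrite mule_ge0.
- by apply: emeasurable_funM.
apply: ge0_le_integral => //.
- by move=> x _; rewrite mule_ge0.
- by apply: emeasurable_funM.
- apply: emeasurable_funD; apply: emeasurable_funM => //.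
  by apply: emeasurable_funM.
move=> x _; set a := normal_pdf 0 1 x; set b := normal_pdf 0 s x.
have b0 : (0 < b)%R by exact: normal_pdf_gt0.
have a0 : (0 < a)%R by exact: normal_pdf_gt0.
have := f0 x; case: (f x) => [y| |] //.
  rewrite !lee_fin => y0.
  have -> : (s * u / (2 * t) * normal_pdf 0 u x = a ^+ 2 / b / (2 * t))%R.
    by rewrite (normal_pdf_quotient x s0 u0 usE); field; rewrite gt_eqF.
  (* Completing the square gives the pointwise inequality. *)
  have -> : (t / 2 * (y * y * b) + a ^+ 2 / b / (2 * t) =
    y * a + (t * y * b - a) ^+ 2 / (2 * t * b))%R by field; rewrite !gt_eqF.
  by rewrite lerDl divr_ge0 ?sqr_ge0 // !mulr_ge0 // ltW.
move=> _; rewrite (_ : (t / 2)%:E * _ = +oo) ?addye ?leey //.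
by rewrite mulyy gt0_mulye ?lte_fin // gt0_muley // lte_fin divr_gt0.
Qed.

(** Comparison with the density of variance 2: with z = x^2 / 4, x^4 = 16 z^2 <= 64 (1 + z / 2)^2 <=
    64 e^z. *)
Lemma normal_moment4_lty : \int[gauss]_x (x ^+ 4)%:E < +oo.
Proof.
have mx4 : measurable_fun [set: measurableTypeR R] (fun x : R => (x ^+ 4)%:E).
  by apply/measurable_EFinP; exact: measurable_funX.
have x40 (x : R) : (0 <= x ^+ 4)%R by rewrite (exprM x 2 2) sqr_ge0.
rewrite ge0_integral_normal //.
pose s : R := Num.sqrt 2.
have s0 : (0 < s)%R by rewrite sqrtr_gt0.
apply: (@le_lt_trans _ _ (\int[mu]_x ((64 * s)%:E * (normal_pdf 0 s x)%:E))); last first.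
  rewrite ge0_integralZl ?integral_normal_pdf ?mule1 ?ltry //.
  - by apply/measurable_EFinP; exact: measurable_normal_pdf.
  - by move=> x _; rewrite lee_fin normal_pdf_ge0.
  - by rewrite lee_fin mulr_ge0 // ltW.
apply: ge0_le_integral => //.
- by move=> x _; rewrite -EFinM lee_fin mulr_ge0 ?normal_pdf_ge0.
- apply: emeasurable_funM => //.
  by apply/measurable_EFinP; exact: measurable_normal_pdf.
- apply: emeasurable_funM => //.
  by apply/measurable_EFinP; exact: measurable_normal_pdf.
move=> x _; rewrite -!EFinM lee_fin (normal_pdf_scale x s0).
rewrite (_ : (64 * s * _ = 64 * normal_pdf 0 1 (x / s))%R); last by field; rewrite gt_eqF.
rewrite !normal_pdfE ?oner_neq0 //= /normal_fun !subr0 expr1n.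
have pk : (0 <= normal_peak (1 : R))%R by exact: normal_peak_ge0.
rewrite mulrCA [leRHS]mulrCA ler_wpM2l //.
pose z := (x ^+ 2 / 4)%R.
have -> : (- (x / s) ^+ 2 / (1 *+ 2) = z + - x ^+ 2 / (1 *+ 2))%R.
  by rewrite expr_div_n sqr_sqrtr // /z; field.
rewrite expRD mulrA ler_wpM2r ?expR_ge0 //.
have -> : (x ^+ 4 = 16 * z ^+ 2)%R by rewrite /z; field.
have z0 : (0 <= z)%R by rewrite divr_ge0 ?sqr_ge0.
have ez : (expR z = expR (z / 2) * expR (z / 2))%R by rewrite -expRD; congr expR; field.
have h := expR_ge1Dx (z / 2)%R.
have : ((1 + z / 2) * (1 + z / 2) <= expR z)%R.
  by rewrite ez; apply: ler_pM => //; lra.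
nra.
Qed.

End GaussianIntegrals.

Lemma integral_probability_cst {R : realType} d (T : measurableType d)
    (mu : probability T R) (c : R) : (\int[mu]_x c%:E = c%:E)%E.
Proof.
rewrite integral_cst //; set t := (X in (_ * X)%E); have -> : t = 1%E by exact: probability_setT.
by rewrite mule1.
Qed.

Section GaussianMoments.
Context {R : realType}.
Local Open Scope ereal_scope.
Local Notation gauss := (normal_prob (0 : R) (1 : R)).

Let mX k : measurable_fun [set: measurableTypeR R] (fun x : R => (x ^+ k)%:E).
Proof. by apply/measurable_EFinP; exact: measurable_funX. Qed.

Let x4_ge0 (x : R) : (0 <= x ^+ 4)%R.
Proof. by rewrite (exprM x 2 2) sqr_ge0. Qed.

Definition gauss_moment2 : R := fine (\int[gauss]_x (x ^+ 2)%:E).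
Definition gauss_moment4 : R := fine (\int[gauss]_x (x ^+ 4)%:E).

Local Notation v := gauss_moment2.
Local Notation k4 := gauss_moment4.

Lemma integral_gauss_moment4 : \int[gauss]_x (x ^+ 4)%:E = k4%:E.
Proof.
rewrite fineK // ge0_fin_numE ?normal_moment4_lty //.
by apply: integral_ge0 => x _; rewrite lee_fin.
Qed.

Lemma integral_gauss_moment2 : \int[gauss]_x (x ^+ 2)%:E = v%:E.
Proof.
rewrite fineK // ge0_fin_numE; last by apply: integral_ge0 => x _; rewrite lee_fin sqr_ge0.
apply: (@le_lt_trans _ _ (\int[gauss]_x (1 + (x ^+ 4)%:E))).
  apply: ge0_le_integral => //.
  - by move=> x _; rewrite lee_fin sqr_ge0.
  - by apply: emeasurable_funD => //; exact: (mX 4).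
  - move=> x _; rewrite -EFinD lee_fin (exprM x 2 2).
    by have := sqr_ge0 (x ^+ 2 - 1)%R; have := sqr_ge0 x; nra.
rewrite ge0_integralD //; first by rewrite integral_gauss_moment4 integral_probability_cst -EFinD ltry.
by move=> x _; rewrite lee_fin.
Qed.

(** Otherwise x^2 would vanish almost everywhere, whereas {0} is a null set. *)
Lemma gauss_moment2_gt0 : (0 < v)%R.
Proof.
rewrite lt_neqAle; apply/andP; split; last first.
  by apply: fine_ge0; apply: integral_ge0 => x _; rewrite lee_fin sqr_ge0.
apply/negP => /eqP v0.
have /ae_eq_integral_abs : \int[gauss]_x `|(x ^+ 2)%:E| = 0.
  rewrite [RHS](_ : _ = v%:E); last by rewrite -v0.
  rewrite -integral_gauss_moment2; apply: eq_integral => x _.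
  by rewrite gee0_abs // lee_fin sqr_ge0.
move=> /(_ measurableT (mX 2)) [B [mB B0 subB]].
have N0 : gauss [set 0%R] = 0 by rewrite /normal_prob integral_set1.
have : gauss setT <= gauss (B `|` [set 0%R]).
  apply: le_measure; rewrite ?inE //; first exact: measurableU.
  move=> x _; have [->|x0] := eqVneq x 0%R; [by right|left].
  apply: subB => /= /(_ I) /eqP; rewrite eqe sqrf_eq0; exact/negP.
have le0 : gauss (B `|` [set 0%R]) <= 0.
  apply: (le_trans (measureU2 _ _ _)) => //.
  by rewrite -[leRHS]adde0; apply: leeD; rewrite le_eqVlt; apply/orP; left; apply/eqP.
move=> /le_trans /(_ le0); rewrite (@probability_setT _ _ R gauss).
by rewrite lee_fin ler10.
Qed.

Lemma integral_gauss_opp (f : measurableTypeR R -> \bar R) :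
  measurable_fun setT f -> (forall x, 0 <= f x) ->
  \int[gauss]_x f (- x)%R = \int[gauss]_x f x.
Proof.
move=> mf f0.
have ms : measurable_fun [set: measurableTypeR R] (-%R : measurableTypeR R -> measurableTypeR R).
  exact: (measurable_funN (@measurable_id _ R setT)).
pose h : {mfun (measurableTypeR R) >-> (measurableTypeR R)} :=
  HB.pack (-%R : R -> R) (isMeasurableFun.Build _ _ _ _ _ ms).
transitivity (\int[distribution gauss h]_x f x); first by rewrite ge0_integral_distribution.
by apply: eq_measure_integral => A mA _; exact: normal_prob_opp.
Qed.

(** Adding the integral for -a, equal by symmetry, removes the cross term without integrating a
    signed function. *)
Lemma integral_gauss_affine_sqr (a c : R) :
  \int[gauss]_x ((c + a * x) ^+ 2)%:E = (c ^+ 2 + a ^+ 2 * v)%:E.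
Proof.
have msq b : measurable_fun [set: measurableTypeR R] (fun x : R => ((c + b * x) ^+ 2)%:E).
  by apply/measurable_EFinP; apply: measurable_funX; apply: measurable_funD => //;
    exact: measurable_funM.
have sq0 b x : 0 <= ((c + b * x) ^+ 2)%:E :> \bar R by rewrite lee_fin sqr_ge0.
have sum_eq : \int[gauss]_x ((c + a * x) ^+ 2)%:E + \int[gauss]_x ((c + - a * x) ^+ 2)%:E
    = (2 * (c ^+ 2 + a ^+ 2 * v))%:E.
  rewrite -ge0_integralD //.
  transitivity (\int[gauss]_x ((2 * c ^+ 2)%:E + (2 * a ^+ 2)%:E * (x ^+ 2)%:E)).
    by apply: eq_integral => x _; rewrite -EFinM -!EFinD; congr EFin; ring.
  have x20 x : 0 <= (x ^+ 2)%:E :> \bar R by rewrite lee_fin sqr_ge0.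
  have a20 : 0 <= (2 * a ^+ 2)%:E by rewrite lee_fin; apply: mulr_ge0; rewrite ?sqr_ge0.
  have c20 : 0 <= (2 * c ^+ 2)%:E by rewrite lee_fin; apply: mulr_ge0; rewrite ?sqr_ge0.
  have m2 := mX 2.
  rewrite ge0_integralD //; last 2 first.
  - by move=> x _; rewrite mule_ge0.
  - exact: emeasurable_funM.
  rewrite ge0_integralZl // integral_probability_cst integral_gauss_moment2 -EFinM -EFinD.
  by congr EFin; ring.
have sym : \int[gauss]_x ((c + - a * x) ^+ 2)%:E = \int[gauss]_x ((c + a * x) ^+ 2)%:E.
  rewrite -[RHS]integral_gauss_opp //; apply: eq_integral => x _.
  by congr EFin; ring.
move: sum_eq; rewrite sym; case: (\int[gauss]_x _) => [y| |] //.
by rewrite -EFinD => -[e]; congr EFin; lra.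
Qed.

Lemma integral_gauss_centered_sqr (c : R) :
  \int[gauss]_x ((c + (x ^+ 2 - v)) ^+ 2)%:E = (c ^+ 2 + (k4 - v ^+ 2))%:E.
Proof.
have mc : measurable_fun [set: measurableTypeR R]
    (fun x : R => ((c + (x ^+ 2 - v)) ^+ 2)%:E).
  apply/measurable_EFinP; apply: measurable_funX; apply: measurable_funD => //.
  by apply: measurable_funB => //; exact: measurable_funX.
have c0 x : 0 <= ((c + (x ^+ 2 - v)) ^+ 2)%:E :> \bar R by rewrite lee_fin sqr_ge0.
have x20 x : 0 <= (x ^+ 2)%:E :> \bar R by rewrite lee_fin sqr_ge0.
have x40 x : 0 <= (x ^+ 4)%:E :> \bar R by rewrite lee_fin.
(* The expansion is sorted so that only nonnegative functions are integrated. *)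
have poly (b1 b2 : R) : (0 <= b1)%R -> (0 <= b2)%R -> (b1 - b2 = 2 * (c - v))%R ->
    \int[gauss]_x ((c + (x ^+ 2 - v)) ^+ 2)%:E + (b2 * v)%:E =
    (k4 + b1 * v + (c - v) ^+ 2)%:E.
  move=> b10 b20 b12.
  have -> : (b2 * v)%:E = \int[gauss]_x (b2%:E * (x ^+ 2)%:E).
    by rewrite ge0_integralZl // ?integral_gauss_moment2 ?EFinM ?lee_fin //; exact: mX.
  rewrite -ge0_integralD //; last 2 first.
  - by move=> x _; rewrite mule_ge0 // lee_fin.
  - by apply: emeasurable_funM => //; exact: mX.
  transitivity (\int[gauss]_x (((x ^+ 4)%:E + b1%:E * (x ^+ 2)%:E) + ((c - v) ^+ 2)%:E)).
    apply: eq_integral => x _; rewrite -!EFinM -!EFinD; congr EFin.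
    by rewrite (_ : b1 = b2 + 2 * (c - v))%R; [ring|lra].
  have b1x x : 0 <= b1%:E * (x ^+ 2)%:E :> \bar R by rewrite mule_ge0 // lee_fin.
  rewrite ge0_integralD //; last 2 first.
  - by move=> x _; rewrite adde_ge0.
  - by apply: emeasurable_funD; [exact: mX|apply: emeasurable_funM => //; exact: mX].
  have m2 := mX 2; have m4 := mX 4.
  have mb : measurable_fun [set: measurableTypeR R] (fun x : R => b1%:E * (x ^+ 2)%:E).
    exact: emeasurable_funM.
  rewrite ge0_integralD // ge0_integralZl // ?lee_fin //.
  by rewrite integral_gauss_moment2 integral_gauss_moment4 integral_probability_cst -EFinM -!EFinD.
have [cv|vc] := leP v c.
  have := @poly (2 * (c - v))%R 0%R; rewrite mul0r adde0 => -> //; last by rewrite subr0.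
    by congr EFin; ring.
  by rewrite mulr_ge0 // subr_ge0.
have := @poly 0%R (2 * (v - c))%R (lexx _); rewrite mulr_ge0 ?subr_ge0 ?(ltW vc) //.
move=> /(_ isT); rewrite (_ : (0 - _ = 2 * (c - v))%R) => [/(_ erefl)|]; last by ring.
case: (\int[gauss]_x _) => [y| |] //.
by rewrite -EFinD => -[e]; congr EFin; nra.
Qed.

End GaussianMoments.

Section IteratedSums.
Context {R : realType} d (T : measurableType d).
Local Open Scope ereal_scope.

Lemma measurable_tuple_sum m (f : nat -> T -> R) :
  (forall k, measurable_fun setT (f k)) ->
  measurable_fun setT (fun t : m.-tuple T => \sum_(k < m) f k (tnth t k))%R.
Proof.
move=> mf; apply: measurable_sum => k.
exact: measurableT_comp (mf k) (measurable_tnth k).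
Qed.

Lemma sum_tuple_cons m (f : nat -> T -> R) x (t : m.-tuple T) :
  (\sum_(k < m.+1) f k (tnth (tuple_cons (x, t)) k) =
   f 0%N x + \sum_(k < m) f k.+1 (tnth t k))%R.
Proof.
rewrite big_ord_recl; congr (_ + _)%R; apply: eq_bigr => k _.
by rewrite /tuple_cons tnthS.
Qed.

(** The hypothesis for all c encodes that f_k has mean 0 and variance q_k, through nonnegative
    integrals only. In the induction c absorbs the terms whose variable is held fixed. *)
Lemma integral_iterated_sqr_sum m (mu : nat -> probability T R) (f : nat -> T -> R)
    (q : nat -> R) :
  (forall k, measurable_fun setT (f k)) ->
  (forall k c, \int[mu k]_x ((c + f k x) ^+ 2)%:E = (c ^+ 2 + q k)%:E) ->
  forall c : R, \int[iterated_product m mu]_t ((c + \sum_(k < m) f k (tnth t k)) ^+ 2)%:E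
    = (c ^+ 2 + \sum_(k < m) q k)%:E.
Proof.
elim: m mu f q => [|m IH] mu f q mf fq c.
  rewrite integral_iterated_product0 => [|t]; last by rewrite lee_fin sqr_ge0.
  by rewrite !big_ord0 !addr0.
have q0 k : (0 <= q k)%R.
  have := fq k 0%R; rewrite expr0n /= add0r => e; rewrite -lee_fin -e.
  by apply: integral_ge0 => x _; rewrite lee_fin sqr_ge0.
rewrite integral_iterated_productS; last 2 first.
- apply/measurable_EFinP; apply: measurable_funX; apply: measurable_funD => //.
  exact: measurable_tuple_sum.
- by move=> t; rewrite lee_fin sqr_ge0.
transitivity (\int[mu 0%N]_x (((c + f 0%N x) ^+ 2)%:E + (\sum_(k < m) q k.+1)%:E)).
  apply: eq_integral => x _; rewrite -EFinD.
  rewrite -(IH (fun k => mu k.+1) (fun k => f k.+1) (fun k => q k.+1)) //.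
  by apply: eq_integral => t _; rewrite sum_tuple_cons addrA.
rewrite ge0_integralD //.
- by rewrite fq integral_probability_cst -EFinD big_ord_recl addrA.
- by move=> x _; rewrite lee_fin sqr_ge0.
- apply/measurable_EFinP; apply: measurable_funX; exact: measurable_funD.
- by move=> x _; rewrite lee_fin sumr_ge0.
Qed.

Lemma integral_iterated_sum m (mu : nat -> probability T R) (f : nat -> T -> R)
    (q : nat -> R) :
  (forall k, measurable_fun setT (f k)) -> (forall k x, 0 <= f k x)%R ->
  (forall k, \int[mu k]_x (f k x)%:E = (q k)%:E) ->
  forall c : R, (0 <= c)%R ->
  \int[iterated_product m mu]_t (c + \sum_(k < m) f k (tnth t k))%:E
    = (c + \sum_(k < m) q k)%:E.
Proof.
elim: m mu f q => [|m IH] mu f q mf f0 fq c c0.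
  rewrite integral_iterated_product0 => [|t]; last by rewrite big_ord0 addr0 lee_fin.
  by rewrite !big_ord0 !addr0.
have q0 k : (0 <= q k)%R.
  by rewrite -lee_fin -fq; apply: integral_ge0 => x _; rewrite lee_fin.
rewrite integral_iterated_productS; last 2 first.
- by apply/measurable_EFinP; apply: measurable_funD => //; exact: measurable_tuple_sum.
- by move=> t; rewrite lee_fin addr_ge0 // sumr_ge0.
transitivity (\int[mu 0%N]_x ((f 0%N x)%:E + (c + \sum_(k < m) q k.+1)%:E)).
  apply: eq_integral => x _; rewrite -EFinD.
  rewrite addrCA addrA -(IH (fun k => mu k.+1) (fun k => f k.+1) (fun k => q k.+1)) //.
    by apply: eq_integral => t _; rewrite sum_tuple_cons addrA.
  by rewrite addr_ge0.
rewrite ge0_integralD //.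
- by rewrite fq integral_probability_cst -EFinD big_ord_recl; congr EFin; rewrite addrCA.
- by move=> x _; rewrite lee_fin.
- exact/measurable_EFinP.
- by move=> x _; rewrite lee_fin addr_ge0 // sumr_ge0.
Qed.

End IteratedSums.

Section IteratedProductLaw.
Context {R : realType} d (T : measurableType d).
Local Open Scope ereal_scope.

Definition rectangle m (C : 'I_m -> set T) : set (m.-tuple T) :=
  [set t | forall k, C k (tnth t k)].

Lemma measurable_rectangle m (C : 'I_m -> set T) :
  (forall k, measurable (C k)) -> measurable (rectangle C).
Proof.
move=> mC; rewrite (_ : rectangle C =
    \big[setI/setT]_(k <- enum 'I_m) (@tnth _ T ^~ k @^-1` C k)); last first.
  apply/seteqP; split=> t; rewrite -bigcap_seq => Ct k; first by move=> _; exact: Ct.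
  by apply: Ct; rewrite /= mem_enum.
apply: bigsetI_measurable => k _; rewrite -[X in measurable X]setTI.
exact: measurable_tnth.
Qed.

Lemma iterated_product_rectangle m (mu : nat -> probability T R) (C : 'I_m -> set T) :
  (forall k, measurable (C k)) ->
  iterated_product m mu (rectangle C) = \prod_(k < m) mu k (C k).
Proof.
elim: m mu C => [|m IH] mu C mC.
  rewrite big_ord0 /= diracE mem_set //; by case.
rewrite big_ord_recl /=.
transitivity ((mu 0%N \x iterated_product m (fun k => mu k.+1))
    (C ord0 `*` rectangle (fun k => C (lift ord0 k)))).
  congr (_ _); apply/seteqP; split=> -[x t] /=.
    move=> Ct; split=> [|k].
      by have := Ct ord0; rewrite /tuple_cons tnth0.
    by have := Ct (lift ord0 k); rewrite /tuple_cons tnthS.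
  move=> [Cx Ct] k; case: (unliftP ord0 k) => [j|] ->.
    by rewrite /tuple_cons tnthS; exact: Ct.
  by rewrite /tuple_cons tnth0.
rewrite product_measure1E //; last exact: measurable_rectangle.
by congr (_ * _); exact: (IH (fun k => mu k.+1)).
Qed.

Lemma measure_rectangle_unique m (m1 m2 : {measure set (m.-tuple T) -> \bar R}) :
  m1 setT < +oo ->
  (forall C : 'I_m -> set T, (forall k, measurable (C k)) ->
    m1 (rectangle C) = m2 (rectangle C)) ->
  forall A, measurable A -> m1 A = m2 A.
Proof.
move=> m1fin m12 A mA.
pose G := [set B : set (m.-tuple T) |
  exists2 C : 'I_m -> set T, (forall k, measurable (C k)) & B = rectangle C].
have GT : G setT.
  by exists (fun=> setT) => //; apply/seteqP; split.
apply: (measure_unique G (fun=> setT)) => //.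
- apply/seteqP; split.
    apply: smallest_sub; first exact: smallest_sigma_algebra.
    move=> B; rewrite -bigcup_seq /= => -[i _ [C mC <-]]; apply: sub_sigma_algebra.
    exists (fun k => if k == i then C else setT) => [k|]; first by case: ifP.
    rewrite setTI; apply/seteqP; split=> t /=.
      by move=> Ct k; case: eqP => // ->.
    by move=> /(_ i); rewrite eqxx.
  apply: smallest_sub; first exact: sigma_algebra_measurable.
  by move=> _ [C mC ->]; exact: measurable_rectangle.
- move=> _ _ [C1 mC1 ->] [C2 mC2 ->]; exists (fun k => C1 k `&` C2 k) => [k|].
    exact: measurableI.
  by apply/seteqP; split=> t; [move=> [t1 t2] k; split|move=> t12; split=> k; have [] := t12 k].
- by apply/seteqP; split=> // t _; exists 0%N.
- by move=> _ [C mC ->]; exact: m12.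
Qed.

Section Law.
Context d' (Omega : measurableType d') (Q : {measure set Omega -> \bar R}).
Context (m : nat) (X : 'I_m -> Omega -> T) (mu : nat -> probability T R).
Hypothesis mX : forall k, measurable_fun setT (X k).
Hypothesis XQ : forall C : 'I_m -> set T, (forall k, measurable (C k)) ->
  Q [set w | forall k, C k (X k w)] = \prod_(k < m) mu k (C k).

Let Y w : m.-tuple T := [tuple X k w | k < m].

Lemma measurable_tuple_of_coords : measurable_fun setT Y.
Proof.
apply/measurable_fun_tnthP => k; rewrite (_ : _ \o _ = X k) //.
by apply/funext => w; rewrite /= tnth_mktuple.
Qed.

HB.instance Definition _ :=
  isMeasurableFun.Build _ _ _ _ Y measurable_tuple_of_coords.

Lemma iterated_product_law A : measurable A ->
  Q (Y @^-1` A) = iterated_product m mu A.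
Proof.
have YC (C : 'I_m -> set T) : Y @^-1` rectangle C = [set w | forall k, C k (X k w)].
  by apply/seteqP; split=> w /= Cw k; have := Cw k; rewrite tnth_mktuple.
apply: (@measure_rectangle_unique m (pushforward Q Y)) => [|C mC].
  change (Q (Y @^-1` setT) < +oo); rewrite preimage_setT.
  have := XQ (fun=> measurableT); rewrite (_ : [set w | _] = setT); last first.
    by apply/seteqP; split.
  move=> ->; rewrite big1 ?ltry // => k _; exact: probability_setT.
change (Q (Y @^-1` rectangle C) = iterated_product m mu (rectangle C)).
by rewrite YC XQ // iterated_product_rectangle.
Qed.

Lemma integral_iterated_product_law (f : m.-tuple T -> \bar R) :
  measurable_fun setT f -> (forall t, 0 <= f t) ->
  \int[Q]_w f (Y w) = \int[iterated_product m mu]_t f t.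
Proof.
move=> mf f0; transitivity (\int[pushforward Q Y]_t f t).
  by rewrite (@ge0_integral_pushforward _ _ _ _ _ Y measurable_tuple_of_coords).
by apply: eq_measure_integral => A mA _; exact: iterated_product_law.
Qed.

End Law.

End IteratedProductLaw.

(** * Joint law of scaled noise columns *)

Section SubcloudLaw.
Context {R : realType}.
Local Open Scope ereal_scope.

Definition coords d (x : 'cV[R]_d) : d.-tuple (measurableTypeR R) :=
  [tuple x k 0%R | k < d].

Lemma measurable_coords d : measurable_fun setT (@coords d : borel_cV d -> _).
Proof.
apply/measurable_fun_tnthP => k.
rewrite (_ : _ \o _ = (fun x : borel_cV d => (x : 'cV[R]_d) k 0%R)); last first.
  by apply/funext => x; rewrite /= tnth_mktuple.
apply: (measurability _ (RGenOInfty.measurableE R)) => //.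
move=> _ [_ [a ->] <-]; rewrite setTI; apply: sub_sigma_algebra => /=.
apply: (@open_comp _ _ (fun x : 'cV[R]_d => x k 0%R)); last exact: interval_open.
by move=> x _; exact: coord_continuous.
Qed.

Definition scaled_gauss d (sigma : R) : probability (d.-tuple (measurableTypeR R)) R :=
  iterated_product d (fun=> normal_prob 0 sigma).

Definition scaled_coords d (sigma : R) (x : 'cV[R]_d) : d.-tuple (measurableTypeR R) :=
  [tuple (sigma * x k 0)%R | k < d].

Lemma measurable_scaled_coords d sigma :
  measurable_fun setT (@scaled_coords d sigma : borel_cV d -> _).
Proof.
apply/measurable_fun_tnthP => k.
rewrite (_ : _ \o _ = (fun x : borel_cV d => (sigma * tnth (coords x) k)%R)); last first.
  by apply/funext => x; rewrite /= !tnth_mktuple.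
apply: measurable_funM => //.
exact: measurableT_comp (measurable_tnth k) (@measurable_coords d).
Qed.

Context disp (Omega : measurableType disp) (P : probability Omega R).

Lemma scaled_column_law d (e : Omega -> 'cV[R]_d) (sigma : R) (A : set (d.-tuple (measurableTypeR R))) :
  measurable_fun setT (e : Omega -> borel_cV d) -> standard_gaussian P e ->
  (0 < sigma)%R -> measurable A ->
  P (e @^-1` (@scaled_coords d sigma @^-1` A)) = scaled_gauss d sigma A.
Proof.
move=> me ge s0 mA.
apply: (@iterated_product_law _ _ (measurableTypeR R) _ _ P d
  (fun k w => sigma * e w k 0)%R (fun=> normal_prob 0 sigma) _ _ A mA) => [k|C mC].
  apply: measurable_funM => //.
  rewrite (_ : (fun w => e w k 0%R) = (@tnth _ _ ^~ k) \o (@coords d \o e)); last first.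
    by apply/funext => x; rewrite /= tnth_mktuple.
  apply: measurableT_comp; first exact: measurable_tnth.
  exact: (measurableT_comp (@measurable_coords d) me).
have := ge (fun k => [set x | C k (sigma * x)%R]) => /= ->; last first.
  move=> k.
  rewrite (_ : [set x | _] = setT `&` (fun x : measurableTypeR R => sigma * x)%R @^-1` C k).
  have ms : measurable_fun [set: measurableTypeR R] (fun x : measurableTypeR R => sigma * x)%R.
    by apply: measurable_funM.
    by exact: (ms measurableT _ (mC k)).
  by rewrite setTI.
by apply: eq_bigr => k _; exact: (@normal_prob_scale R sigma (C k) s0 (mC k)).
Qed.

Context (n d : nat) (e : 'I_n -> Omega -> 'cV[R]_d).
Hypothesis e_iid : iid_standard_gaussian P e.
Context (m : nat) (f : 'I_m -> 'I_n) (sigma : nat -> R).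
Hypothesis f_inj : injective f.
Hypothesis sigma_gt0 : forall k, (0 < sigma k)%R.

Let X (k : 'I_m) (w : Omega) := scaled_coords (sigma k) (e (f k) w).

Lemma measurable_scaled_column k : measurable_fun setT (X k).
Proof.
have [me _ _] := e_iid.
exact: (measurableT_comp (@measurable_scaled_coords d (sigma k)) (me (f k))).
Qed.

Lemma scaled_columns_rectangle (C : 'I_m -> set (d.-tuple (measurableTypeR R))) :
  (forall k, measurable (C k)) ->
  P [set w | forall k, C k (X k w)] = \prod_(k < m) scaled_gauss d (sigma k) (C k).
Proof.
move=> mC; have [me indep ge] := e_iid.
(* For a column outside the image of [f] this is the whole space, of probability 1, which reduces
   independence of all columns to that of the chosen ones. *)
pose B (l : 'I_n) : set (borel_cV d) := [set x | forall k, f k = l -> C k (scaled_coords (sigma k) x)].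
have Bf k : B (f k) = @scaled_coords d (sigma k) @^-1` C k.
  by apply/seteqP; split=> x /= Bx; [exact: Bx|move=> k' /f_inj ->].
have BN l : (forall k, f k != l) -> B l = setT.
  by move=> fl; apply/seteqP; split=> // x _ k /eqP; rewrite (negPf (fl k)).
have mB l : measurable (B l).
  have [k /eqP <-|] := pickP (fun k => f k == l).
    rewrite Bf -[X in measurable X]setTI; exact: measurable_scaled_coords.
  by move=> fl; rewrite BN // => k; rewrite fl.
have := indep B mB; rewrite (_ : \bigcap_i _ = [set w | forall k, C k (X k w)]); last first.
  apply/seteqP; split=> w /= Bw; first by move=> k; exact: (Bw (f k) I k erefl).
  move=> l _ k flk. by rewrite -flk; exact: Bw.
move=> ->; rewrite (bigID [in f @: finset.setT]) /= [X in _ * X]big1 ?mule1; last first.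
  move=> l lf; rewrite BN; first by rewrite preimage_setT probability_setT.
  by move=> k; apply: contraNneq lf => <-; exact: imset_f.
rewrite big_imset /=; last by move=> k l _ _; exact: f_inj.
apply: eq_big => [k|k _]; first by rewrite finset.inE.
by rewrite Bf; exact: scaled_column_law.
Qed.

Lemma subcloud_law A : measurable A ->
  P [set w | A [tuple X k w | k < m]] =
  iterated_product m (fun k => scaled_gauss d (sigma k)) A.
Proof.
apply: iterated_product_law; first exact: measurable_scaled_column.
exact: scaled_columns_rectangle.
Qed.

Lemma integral_subcloud_law (g : m.-tuple (d.-tuple (measurableTypeR R)) -> \bar R) :
  measurable_fun setT g -> (forall t, 0 <= g t) ->
  \int[P]_w g [tuple X k w | k < m] =
  \int[iterated_product m (fun k => scaled_gauss d (sigma k))]_t g t.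
Proof.
apply: integral_iterated_product_law; first exact: measurable_scaled_column.
exact: scaled_columns_rectangle.
Qed.

End SubcloudLaw.

(** * Tightness and anti-concentration *)

Section Tightness.
Context {R : realType}.
Local Open Scope ereal_scope.
Local Notation v := (@gauss_moment2 R).
Local Notation k4 := (@gauss_moment4 R).
Local Notation gauss := (normal_prob (0 : R) (1 : R)).

Section Markov.
Context disp (Omega : measurableType disp) (P : probability Omega R).

Lemma markov_bound (h : Omega -> R) (a b : R) :
  measurable_fun setT h -> (forall w, 0 <= h w)%R -> (0 < a)%R ->
  \int[P]_w (h w)%:E = b%:E -> P [set w | (a < h w)%R] <= (b / a)%:E.
Proof.
move=> mh h0 a0 hb; set A := [set w | _].
have mA : measurable A.
  by rewrite -[A]setTI; apply: (@measurable_fun_ltr _ _ _ setT (fun=> a) h).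
have : a%:E * P A <= b%:E.
  rewrite -hb -[X in P X]setIT -integral_indic // -ge0_integralZl //.
  - apply: ge0_le_integral => //.
    + by move=> w _; rewrite mule_ge0 // lee_fin ltW.
    + by apply: emeasurable_funM => //; apply/measurable_EFinP; exact: measurable_indic.
    + exact/measurable_EFinP.
    + move=> w _; rewrite -EFinM lee_fin indicE.
      have [|_] := boolP (w \in A); last by rewrite mulr0.
      by rewrite inE mulr1 => /ltW.
  - by apply/measurable_EFinP; exact: measurable_indic.
  - by rewrite lee_fin ltW.
have /fineK <- : P A \is a fin_num by exact: fin_num_measure.
by rewrite -EFinM !lee_fin ler_pdivlMr // mulrC.
Qed.

End Markov.

Lemma measurable_tnth2 n d (i : 'I_n) (k : 'I_d) :
  measurable_fun setT (fun t : n.-tuple (d.-tuple (measurableTypeR R)) => tnth (tnth t i) k).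
Proof. exact: measurableT_comp (measurable_tnth k) (measurable_tnth i). Qed.

Context disp (Omega : measurableType disp) (P : probability Omega R).
Context (n d : nat) (e : 'I_n -> Omega -> 'cV[R]_d).
Hypothesis e_iid : iid_standard_gaussian P e.

Lemma measurable_entry i k : measurable_fun setT (fun w => e i w k 0%R : R).
Proof.
have [me _ _] := e_iid.
rewrite (_ : (fun w => _) = (@tnth _ _ ^~ k) \o (@coords R d \o e i)); last first.
  by apply/funext => w; rewrite /= tnth_mktuple.
apply: measurableT_comp; first exact: measurable_tnth.
exact: (measurableT_comp (@measurable_coords R d) (me i)).
Qed.

Lemma scaled_coords1 (x : 'cV[R]_d) : scaled_coords 1 x = coords x.
Proof. by apply: eq_from_tnth => k; rewrite !tnth_mktuple mul1r. Qed.

Lemma integral_column i (g : d.-tuple (measurableTypeR R) -> \bar R) :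
  measurable_fun setT g -> (forall t, 0 <= g t) ->
  \int[P]_w g (coords (e i w)) = \int[iterated_product d (fun=> gauss)]_t g t.
Proof.
move=> mg g0.
have finj : injective (fun _ : 'I_1 => i) by move=> a b _; rewrite !ord1.
have m1 : measurable_fun setT
    (fun t : 1.-tuple (d.-tuple (measurableTypeR R)) => g (tnth t ord0)).
  exact: measurableT_comp mg (measurable_tnth _).
have := integral_subcloud_law e_iid finj (fun=> ltr01) m1 (fun t => g0 _).
rewrite integral_iterated_productS //.
move=> E; transitivity (\int[P]_w g (tnth [tuple scaled_coords 1 (e i w) | k < 1] ord0)).
  by apply: eq_integral => w _; rewrite tnth_mktuple scaled_coords1.
rewrite E; apply: eq_integral => t _.
by rewrite integral_iterated_product0 // /tuple_cons tnth0.
Qed.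

Lemma integral_pair i j (g : d.-tuple (measurableTypeR R) -> d.-tuple (measurableTypeR R) -> \bar R) :
  i != j ->
  measurable_fun setT (fun p => g p.1 p.2) -> (forall s t, 0 <= g s t) ->
  \int[P]_w g (coords (e i w)) (coords (e j w)) =
  \int[iterated_product d (fun=> gauss)]_s \int[iterated_product d (fun=> gauss)]_t g s t.
Proof.
move=> ij mg g0.
pose f (k : 'I_2) := if k == ord0 then i else j.
have finj : injective f.
  move=> a b; rewrite /f; case: eqP => [->|/eqP a0]; case: eqP => [->|/eqP b0] //.
  - by move/eqP; rewrite (negPf ij).
  - by move/eqP; rewrite eq_sym (negPf ij).
  - by move=> _; apply/val_inj; move: a b a0 b0 => [[|[|a]] ?] // [[|[|b]] ?].
pose j1 : 'I_2 := lift ord0 ord0.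
have m1 : measurable_fun setT (fun t : 2.-tuple (d.-tuple (measurableTypeR R)) =>
    g (tnth t ord0) (tnth t j1)).
  apply: (measurableT_comp (f := fun p => g p.1 p.2)
    (g := fun t : 2.-tuple (d.-tuple (measurableTypeR R)) => (tnth t ord0, tnth t j1)) mg).
  by apply/measurable_fun_pairP; split; exact: measurable_tnth.
have := integral_subcloud_law e_iid finj (fun=> ltr01) m1 (fun t => g0 _ _).
rewrite integral_iterated_productS //.
move=> E; transitivity (\int[P]_w g (tnth [tuple scaled_coords 1 (e (f k) w) | k < 2] ord0)
    (tnth [tuple scaled_coords 1 (e (f k) w) | k < 2] j1)).
  by apply: eq_integral => w _; rewrite !tnth_mktuple !scaled_coords1.
rewrite E; apply: eq_integral => s _.
rewrite integral_iterated_productS //; last first.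
  have mc : measurable_fun setT (fun t : 1.-tuple (d.-tuple (measurableTypeR R)) => tuple_cons (s, t)).
    exact: measurableT_comp (@measurable_tuple_cons _ _ 1) (measurable_pair1 s).
  exact: (measurableT_comp m1 mc).
apply: eq_integral => t _.
by rewrite integral_iterated_product0 // /tuple_cons tnth0 tnthS tnth0.
Qed.

Lemma gram_entry i j w : ((noise_cloud e w)^T *m noise_cloud e w) i j =
  (\sum_(k < d) tnth (coords (e i w)) k * tnth (coords (e j w)) k)%R.
Proof. by rewrite mxE; apply: eq_bigr => k _; rewrite !mxE !tnth_mktuple. Qed.

Lemma integral_gram_diag i :
  \int[P]_w ((((noise_cloud e w)^T *m noise_cloud e w) i i - v * d%:R) ^+ 2)%:E =
  (d%:R * (k4 - v ^+ 2))%:E.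
Proof.
transitivity (\int[P]_w ((0 + \sum_(k < d) (tnth (coords (e i w)) k ^+ 2 - v)) ^+ 2)%:E).
  apply: eq_integral => w _; congr (_%:E); congr (_ ^+ 2)%R.
  by rewrite add0r gram_entry sumrB sumr_const card_ord -[(v *+ d)%R]mulr_natr; congr (_ - _)%R.
rewrite (@integral_column i (fun t => ((0 + \sum_(k < d) (tnth t k ^+ 2 - v)) ^+ 2)%:E)).
- rewrite (@integral_iterated_sqr_sum R _ (measurableTypeR R) d _ (fun _ (x : R) => x ^+ 2 - v)%R
      (fun=> k4 - v ^+ 2)%R).
  + by rewrite expr0n add0r sumr_const card_ord mulr_natl.
  + by move=> k; apply: measurable_funB => //; exact: measurable_funX.
  + by move=> k c; exact: integral_gauss_centered_sqr.
- apply/measurable_EFinP; apply: measurable_funX; apply: measurable_funD => //.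
  apply: measurable_sum => k; apply: measurable_funB => //; apply: measurable_funX.
  exact: measurable_tnth.
- by move=> t; rewrite lee_fin sqr_ge0.
Qed.

(** With column i fixed, the inner product is a linear form in column j, of second moment v |e_i|^2;
    then column i is integrated. *)
Lemma integral_gram_offdiag i j : i != j ->
  \int[P]_w ((((noise_cloud e w)^T *m noise_cloud e w) i j) ^+ 2)%:E =
  (d%:R * v ^+ 2)%:E.
Proof.
move=> ij.
transitivity (\int[P]_w ((0 + \sum_(k < d) tnth (coords (e i w)) k * tnth (coords (e j w)) k) ^+ 2)%:E).
  by apply: eq_integral => w _; rewrite add0r gram_entry.
rewrite (@integral_pair i j (fun s t => ((0 + \sum_(k < d) tnth s k * tnth t k) ^+ 2)%:E)) //.
- transitivity (\int[iterated_product d (fun=> gauss)]_s (0 + \sum_(k < d) tnth s k ^+ 2 * v)%:E).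
    apply: eq_integral => s _.
    (* The fixed column, extended by 0 to all of [nat], as the families of functions in iterated
       sums are indexed by [nat]. *)
    pose a k : R := if insub k is Some k' then tnth s k' else 0%R.
    have aE (k : 'I_d) : a k = tnth s k by rewrite /a valK.
    transitivity (\int[iterated_product d (fun=> gauss)]_t
        ((0 + \sum_(k < d) a k * tnth t k) ^+ 2)%:E).
      by apply: eq_integral => t _; congr ((_ + _) ^+ 2)%:E; apply: eq_bigr => k _; rewrite aE.
    rewrite (@integral_iterated_sqr_sum R _ (measurableTypeR R) d _ (fun k (x : R) => a k * x)%R
      (fun k => a k ^+ 2 * v)%R).
    + by rewrite expr0n; congr (_ + _)%:E; apply: eq_bigr => k _; rewrite aE.
    + by move=> k; exact: measurable_funM.
    + by move=> k c; exact: integral_gauss_affine_sqr.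
  rewrite (@integral_iterated_sum R _ (measurableTypeR R) d _ (fun _ (x : R) => x ^+ 2 * v)%R
      (fun=> v ^+ 2)%R) //.
  + by rewrite add0r sumr_const card_ord mulr_natl.
  + by move=> k; apply: measurable_funM => //; exact: measurable_funX.
  + by move=> k x; rewrite mulr_ge0 ?sqr_ge0 // ltW // gauss_moment2_gt0.
  + move=> k; under eq_integral do rewrite EFinM muleC.
    rewrite ge0_integralZl ?integral_gauss_moment2 //.
    * by apply/measurable_EFinP; exact: measurable_funX.
    * by move=> x _; rewrite lee_fin sqr_ge0.
    * by rewrite lee_fin ltW // gauss_moment2_gt0.
- apply/measurable_EFinP; apply: measurable_funX; apply: measurable_funD => //.
  apply: measurable_sum => k; apply: measurable_funM.
    exact: measurableT_comp (measurable_tnth k) measurable_fst.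
  exact: measurableT_comp (measurable_tnth k) measurable_snd.
- by move=> s t; rewrite lee_fin sqr_ge0.
Qed.

Lemma integral_entry i k : \int[P]_w ((e i w k 0) ^+ 2)%:E = v%:E.
Proof.
have [_ _ ge] := e_iid.
transitivity (\int[P]_w ((0 + \sum_(l < d) (l == k)%:R * tnth (coords (e i w)) l) ^+ 2)%:E).
  apply: eq_integral => w _; congr (_ ^+ 2)%:E; rewrite add0r (bigD1 k) //= eqxx mul1r.
  by rewrite tnth_mktuple big1 ?addr0 // => l /negPf ->; rewrite mul0r.
rewrite (@integral_column i (fun t => ((0 + \sum_(l < d) (l == k)%:R * tnth t l) ^+ 2)%:E)).
- rewrite (@integral_iterated_sqr_sum R _ (measurableTypeR R) d _ (fun l (x : R) => (l == k :> nat)%:R * x)%R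
      (fun l => (l == k :> nat)%:R ^+ 2 * v)%R).
  + rewrite expr0n add0r (bigD1 k) //= eqxx expr1n mul1r big1 ?addr0 // => l.
    by rewrite -val_eqE => /negPf /= ->; rewrite expr0n mul0r.
  + by move=> l; exact: measurable_funM.
  + by move=> l c; exact: integral_gauss_affine_sqr.
- apply/measurable_EFinP; apply: measurable_funX; apply: measurable_funD => //.
  apply: measurable_sum => l; apply: measurable_funM => //.
  exact: measurable_tnth.
- by move=> t; rewrite lee_fin sqr_ge0.
Qed.

End Tightness.

Section MeasurableMatrices.
Context {R : realType} disp (T : measurableType disp).

Definition measurable_mx m n (F : T -> 'M[R]_(m, n)) : Prop :=
  forall i j, measurable_fun setT (fun x => F x i j).

Lemma measurable_cst_mx m n (A : 'M[R]_(m, n)) : measurable_mx (fun=> A).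
Proof. by move=> i j. Qed.

Lemma measurable_mulmx m n p (F : T -> 'M[R]_(m, n)) (G : T -> 'M[R]_(n, p)) :
  measurable_mx F -> measurable_mx G -> measurable_mx (fun x => F x *m G x).
Proof.
move=> mF mG i j; under eq_fun do rewrite mxE.
by apply: measurable_sum => k; exact: measurable_funM.
Qed.

Lemma measurable_expmx n (F : T -> 'M[R]_n.+1) k :
  measurable_mx F -> measurable_mx (fun x => F x ^+ k).
Proof.
move=> mF; elim: k => [|k IH]; first by move=> i j; under eq_fun do rewrite expr0; exact: measurable_cst.
move=> i j; under eq_fun do rewrite exprS -mulmxE; exact: (measurable_mulmx mF IH).
Qed.

Lemma measurable_det n (F : T -> 'M[R]_n) :
  measurable_mx F -> measurable_fun setT (fun x => \det (F x)).
Proof.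
move=> mF; apply: measurable_sum => s; apply: measurable_funM => //.
by apply: measurable_prod => i _; exact: mF.
Qed.

Lemma measurable_discr n (F : T -> 'M[R]_n.+1) :
  measurable_mx F -> measurable_fun setT (fun x => discr (F x)).
Proof.
move=> mF; apply: measurable_det => i j; under eq_fun do rewrite mxE.
by apply: measurable_sum => k; exact: measurable_expmx.
Qed.

Lemma measurable_normalized_gram n (v r : R) (F : T -> 'M[R]_n.+1) :
  measurable_mx F -> measurable_mx (fun x => normalized_gram v r (F x)).
Proof.
move=> mF i j; under eq_fun do rewrite mxE; apply: measurable_funM => //.
apply: measurable_mulmx; last exact: measurable_cst_mx.
apply: measurable_mulmx; first exact: measurable_cst_mx.
by move=> k l; under eq_fun do rewrite mxE; apply: measurable_funD.
Qed.

End MeasurableMatrices.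

Section FiniteUnions.
Context {R : realType} disp (Omega : measurableType disp) (P : probability Omega R).
Local Open Scope ereal_scope.

Lemma measurable_superlevel (h : Omega -> R) (a : R) :
  measurable_fun setT h -> measurable [set w | (a < h w)%R].
Proof. by move=> mh; rewrite -[X in measurable X]setTI; exact: (@measurable_fun_ltr _ _ _ setT (fun=> a) h). Qed.

Lemma union_bound (I : finType) (A : I -> set Omega) (b : R) :
  (forall i, measurable (A i)) -> (forall i, P (A i) <= b%:E) ->
  measurable [set w | exists i, A i w] /\
  P [set w | exists i, A i w] <= (#|I|%:R * b)%:E.
Proof.
move=> mA Ab; rewrite cardT.
rewrite (_ : [set w | _] = [set w | exists2 i, i \in enum I & A i w]); last first.
  by apply/seteqP; split=> w /= [i]; [exists i; rewrite ?mem_enum|move=> _; exists i].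
elim: (enum I) => [|i s [mIH IH]].
  rewrite (_ : [set w | _] = set0); last by apply/seteqP; split=> w // -[].
  by split; rewrite ?measure0 ?mul0r.
rewrite (_ : [set w | _] = A i `|` [set w | exists2 j, j \in s & A j w]); last first.
  apply/seteqP; split=> w /=.
    by move=> [j]; rewrite inE => /orP[/eqP ->|js] Aj; [left|right; exists j].
  by move=> [Ai|[j js Aj]]; [exists i; rewrite ?mem_head|exists j; rewrite // inE js orbT].
split; first exact: measurableU.
apply: (le_trans (measureU2 _ _ _)) => //.
by rewrite /= -natr1 mulrDl mul1r addrC EFinD leeD.
Qed.

(** The number of events that occur is at most D outside H and at most L on H. Integrating it bounds
    the sum of the probabilities, and some term does not exceed the average. *)
Lemma counting_bound (L D : nat) (A : 'I_L -> set Omega) (H : set Omega) :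
  (0 < L)%N -> (forall j, measurable (A j)) -> measurable H ->
  (forall w, ~ H w -> (#|[set j | w \in A j]%SET| <= D)%N) ->
  exists j, P (A j) <= (D%:R / L%:R)%:E + P H.
Proof.
move=> L0 mA mH AH; apply: contrapT => /forallNP hA.
have mI (B : set Omega) : measurable B -> measurable_fun setT (fun w => (\1_B w)%:E : \bar R).
  by move=> mB; apply/measurable_EFinP; exact: measurable_indic.
have I0 (B : set Omega) w : 0 <= (\1_B w)%:E :> \bar R by rewrite lee_fin.
have sumP : \sum_(j < L) P (A j) <= D%:R%:E + L%:R%:E * P H.
  have -> : \sum_(j < L) P (A j) = \int[P]_w (\sum_(j < L) (\1_(A j) w)%:E).
    rewrite ge0_integral_sum //; last by move=> j; exact: mI.
    by apply: eq_bigr => j _; rewrite integral_indic // setIT.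
  have -> : D%:R%:E + L%:R%:E * P H = \int[P]_w (D%:R%:E + L%:R%:E * (\1_H w)%:E).
    rewrite ge0_integralD //.
    - rewrite integral_probability_cst ge0_integralZl ?lee_fin //; last exact: mI.
      by rewrite integral_indic // setIT.
    - by apply: emeasurable_funM => //; exact: mI.
  apply: ge0_le_integral => //.
  - by move=> w _; apply: sume_ge0.
  - by apply: emeasurable_sum => j; exact: mI.
  - apply: emeasurable_funD => //; apply: emeasurable_funM => //; exact: mI.
  - move=> w _; rewrite -EFinM -EFinD sumEFin lee_fin.
    have -> : (\sum_(j < L) \1_(A j) w = #|[set j | w \in A j]%SET|%:R :> R)%R.
      rewrite -sum1_card natr_sum [RHS]big_mkcond /=; apply: eq_bigr => j _.
      by rewrite finset.inE indicE; case: (w \in A j).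
    have [Hw|nHw] := pselect (H w).
      rewrite indicE mem_set // mulr1 -natrD ler_nat; apply: (leq_trans (max_card _)).
      by rewrite card_ord leq_addl.
    by rewrite indicE memNset // mulr0 addr0 ler_nat; exact: AH.
have PHfin : P H \is a fin_num by exact: fin_num_measure.
have PAE j : P (A j) = (fine (P (A j)))%:E by rewrite fineK //; exact: fin_num_measure.
move: sumP; rewrite (eq_bigr _ (fun j _ => PAE j)) -(fineK PHfin) sumEFin -EFinM -EFinD lee_fin.
apply/negP; rewrite -ltNge.
have <- : (\sum_(j < L) (D%:R / L%:R + fine (P H)) = D%:R + L%:R * fine (P H))%R.
  rewrite sumr_const card_ord -[LHS]mulr_natl mulrDr mulrCA divff ?mulr1 //.
  by rewrite pnatr_eq0 -lt0n.
apply: ltr_sum => [|j _]; first by apply/hasP; exists (Ordinal L0).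
by rewrite ltNge -lee_fin -PAE EFinD (fineK PHfin); apply/negP; exact: hA.
Qed.

End FiniteUnions.

Section Anticoncentration.
Context {R : realType}.
Local Open Scope ereal_scope.
Local Notation v := (@gauss_moment2 R).
Local Notation k4 := (@gauss_moment4 R).

Section FixedDimension.
Context disp (Omega : measurableType disp) (P : probability Omega R).
Context (n d : nat) (e : 'I_n -> Omega -> 'cV[R]_d).
Hypothesis e_iid : iid_standard_gaussian P e.

Local Notation W w := ((noise_cloud e w)^T *m noise_cloud e w).

Lemma measurable_noise_cloud : measurable_mx (noise_cloud e).
Proof. by move=> k i; under eq_fun do rewrite mxE; exact: (measurable_entry e_iid). Qed.

Lemma measurable_noise_gram : measurable_mx (fun w => W w).
Proof.
apply: measurable_mulmx; last exact: measurable_noise_cloud.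
by move=> i k; under eq_fun do rewrite mxE; exact: measurable_noise_cloud.
Qed.

Lemma gauss_moment4_ge : (0 <= v ^+ 2 <= k4)%R.
Proof.
rewrite sqr_ge0 /= -subr_ge0 -lee_fin.
have := @integral_gauss_centered_sqr R 0; rewrite expr0n add0r => <-.
by apply: integral_ge0 => x _; rewrite lee_fin sqr_ge0.
Qed.

(** Chebyshev's inequality for each entry: the variance is d (k4 - v^2) on the diagonal and d v^2
    off it, in both cases at most d k4. *)
Lemma gram_tight (K : R) : (0 < K)%R -> (0 < d)%N ->
  let bad := [set w | exists p : 'I_n * 'I_n, (K * Num.sqrt d%:R <
    `|W w p.1 p.2 - (v * (Num.sqrt d%:R) ^+ 2) *+ (p.1 == p.2)|)%R] in
  measurable bad /\ P bad <= ((n * n)%:R * (k4 / K ^+ 2))%:E.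
Proof.
move=> K0 d0 bad.
have d0' : (0 < d%:R :> R)%R by rewrite ltr0n.
pose h (p : 'I_n * 'I_n) w := ((W w p.1 p.2 - (v * d%:R) *+ (p.1 == p.2)) ^+ 2)%R.
have mh p : measurable_fun setT (h p).
  by apply: measurable_funX; apply: measurable_funB => //; exact: measurable_noise_gram.
have hE p w : (K * Num.sqrt d%:R <
    `|W w p.1 p.2 - (v * (Num.sqrt d%:R) ^+ 2) *+ (p.1 == p.2)|)%R = (K ^+ 2 * d%:R < h p w)%R.
  rewrite sqr_sqrtr ?ler0n // /h -[X in _ = (_ < X)%R]real_normK ?num_real //.
  rewrite -[X in (_ * X < _ ^+ 2)%R](@sqr_sqrtr _ (d%:R)) ?ler0n // -exprMn.
  by rewrite ltr_pXn2r // nnegrE ?mulr_ge0 ?sqrtr_ge0 // ltW.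
have -> : bad = [set w | exists p, (K ^+ 2 * d%:R < h p w)%R].
  by apply/seteqP; split=> w /= [p]; [rewrite hE; exists p|exists p; rewrite hE].
have [v2 v2k] := andP gauss_moment4_ge.
have bound p : P [set w | (K ^+ 2 * d%:R < h p w)%R] <= (k4 / K ^+ 2)%:E.
  have [q q_ge0 [qk hq]] : exists2 q : R, (0 <= q)%R & (q <= k4)%R /\
      \int[P]_w (h p w)%:E = (d%:R * q)%:E.
    case: p {mh hE} @h => i j h; rewrite /h /=; have [<-|ij] := eqVneq i j.
      exists (k4 - v ^+ 2)%R; first by rewrite subr_ge0.
      split; first by rewrite gerBl.
      by under eq_integral do rewrite mulr1n; exact: (integral_gram_diag e_iid).
    exists (v ^+ 2)%R => //; split=> //.
    by under eq_integral do rewrite mulr0n subr0; exact: (integral_gram_offdiag e_iid).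
  apply: (le_trans (markov_bound _ _ _ hq)) => //.
  - by move=> w; rewrite /h sqr_ge0.
  - by rewrite mulr_gt0 // exprn_gt0.
  - rewrite lee_fin ler_pdivrMr ?mulr_gt0 ?exprn_gt0 //.
    by rewrite mulrA divfK ?gt_eqF ?exprn_gt0 // mulrC ler_wpM2r // ltW.
have [mU U] := @union_bound _ _ _ P _ (fun p => [set w | (K ^+ 2 * d%:R < h p w)%R]) _
  (fun p => measurable_superlevel _ (mh p)) bound.
by split=> //; rewrite card_prod !card_ord in U.
Qed.

Lemma entry_tight s (sd : (s <= d)%N) (M : R) : (0 < M)%R ->
  let bad := [set w | exists p : 'I_n * 'I_s,
    (M < `|e p.1 w (widen_ord sd p.2) 0|)%R] in
  measurable bad /\ P bad <= ((n * s)%:R * (v / M ^+ 2))%:E.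
Proof.
move=> M0 bad.
pose h (p : 'I_n * 'I_s) w := ((e p.1 w (widen_ord sd p.2) 0) ^+ 2)%R.
have mh p : measurable_fun setT (h p).
  by apply: measurable_funX; exact: (measurable_entry e_iid).
have hE p w : (M < `|e p.1 w (widen_ord sd p.2) 0|)%R = (M ^+ 2 < h p w)%R.
  rewrite /h -[X in _ = (_ < X)%R]real_normK ?num_real //.
  by rewrite ltr_pXn2r // nnegrE // ltW.
have -> : bad = [set w | exists p, (M ^+ 2 < h p w)%R].
  by apply/seteqP; split=> w /= [p]; [rewrite hE; exists p|exists p; rewrite hE].
have bound p : P [set w | (M ^+ 2 < h p w)%R] <= (v / M ^+ 2)%:E.
  apply: markov_bound => //.
  - by move=> w; rewrite /h sqr_ge0.
  - by rewrite exprn_gt0.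
  - exact: (integral_entry e_iid).
have [mU U] := @union_bound _ _ _ P _ (fun p => [set w | (M ^+ 2 < h p w)%R]) _
  (fun p => measurable_superlevel _ (mh p)) bound.
by split=> //; rewrite card_prod !card_ord in U.
Qed.

Definition scaled_cloud (sigma : nat -> R) (w : Omega) :
    n.-tuple (d.-tuple (measurableTypeR R)) :=
  [tuple scaled_coords (sigma k) (e k w) | k < n].

(** Square domination applied to the indicator of B, which is its own square; the constants multiply
    over the d coordinates and the n columns. *)
Lemma scaling_contiguity (tau : nat -> R) (B : set (n.-tuple (d.-tuple (measurableTypeR R)))) :
  (forall k, 0 <= tau k <= 1)%R -> measurable B ->
  P (scaled_cloud (fun=> 1%R) @^-1` B) * P (scaled_cloud (fun=> 1%R) @^-1` B) <=
  (\prod_(k < n) (1 + 9 * tau k ^+ 2) ^+ d)%:E *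
  P (scaled_cloud (fun k => 1 + tau k)%R @^-1` B).
Proof.
move=> tau01 mB.
have id_inj : injective (fun k : 'I_n => k) by [].
have s0 k : (0 < 1 + tau k)%R by have /andP[? _] := tau01 k; rewrite ltr_pwDl.
have c0 k : (0 <= 1 + 9 * tau k ^+ 2)%R by rewrite addr_ge0 // mulr_ge0 // sqr_ge0.
rewrite (@subcloud_law _ _ _ _ _ _ _ e_iid _ _ (fun=> 1%R) id_inj (fun=> ltr01) B mB).
rewrite (@subcloud_law _ _ _ _ _ _ _ e_iid _ _ _ id_inj s0 B mB).
have dom k : square_dominated (scaled_gauss d (1 : R)) (scaled_gauss d (1 + tau k))
    ((1 + 9 * tau k ^+ 2) ^+ d)%R.
  rewrite (_ : _ ^+ d = \prod_(l < d) (1 + 9 * tau k ^+ 2))%R; last first.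
    by rewrite prodr_const card_ord.
  apply: (@square_dominated_iterated R _ _ d (fun=> normal_prob 0 1)
    (fun=> normal_prob 0 (1 + tau k)) (fun=> 1 + 9 * tau k ^+ 2)%R) => // l.
  exact: normal_square_dominated.
have cd0 k : (0 <= (1 + 9 * tau k ^+ 2) ^+ d)%R by rewrite exprn_ge0.
have mI : measurable_fun setT (fun t => (\1_B t)%:E : \bar R).
  by apply/measurable_EFinP; exact: measurable_indic.
have I0 t : 0 <= (\1_B t)%:E :> \bar R by rewrite lee_fin.
have := @square_dominated_iterated R _ _ n _ _ _ cd0 dom _ mI I0.
rewrite (integral_indic _ measurableT mB) setIT => /le_trans; apply.
apply: lee_wpmul2l; first by rewrite lee_fin prodr_ge0.
rewrite -[in leRHS](setIT B) -integral_indic //.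
rewrite le_eqVlt; apply/orP; left; apply/eqP; apply: eq_integral => t _.
by rewrite -EFinM indicE; case: (t \in B); rewrite ?mulr1 ?mulr0.
Qed.

End FixedDimension.

End Anticoncentration.

(** * Anti-concentration of the discriminant *)

Section DiscrAnticoncentration.
Context {R : realType}.
Local Notation v := (@gauss_moment2 R).
Local Notation k4 := (@gauss_moment4 R).

Definition cloud_mx n d (t : n.-tuple (d.-tuple (measurableTypeR R))) : 'M[R]_(d, n) :=
  \matrix_(k, i) tnth (tnth t i) k.

Lemma measurable_cloud_mx n d : measurable_mx (@cloud_mx n d).
Proof. by move=> k i; under eq_fun do rewrite mxE; exact: measurable_tnth2. Qed.

Lemma measurable_small_discr n d (r eta : R) :
  measurable [set t : n.+1.-tuple (d.-tuple (measurableTypeR R)) |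
    `|discr (normalized_gram v r ((cloud_mx t)^T *m cloud_mx t))| < eta].
Proof.
have mG : measurable_mx (fun t : n.+1.-tuple (d.-tuple (measurableTypeR R)) =>
    (cloud_mx t)^T *m cloud_mx t).
  apply: measurable_mulmx; last exact: measurable_cloud_mx.
  by move=> i k; under eq_fun do rewrite mxE; exact: measurable_cloud_mx.
have mh := measurable_discr (measurable_normalized_gram v r mG).
rewrite -[X in measurable X]setTI.
apply: (@measurable_fun_ltr _ _ _ setT _ (fun=> eta)) => //.
exact: measurableT_comp.
Qed.

Lemma rescale_gram disp (Omega : measurableType disp) n d
    (e : 'I_n.+1 -> Omega -> 'cV[R]_d) (r t : R) (tau : nat -> R) w :
  (forall k : 'I_n.+1, tau k = t * k.+1%:R / r) ->
  let Z := cloud_mx (scaled_cloud e (fun k => 1 + tau k) w) in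
  Z^T *m Z = rescale r t ((noise_cloud e w)^T *m noise_cloud e w).
Proof.
move=> tauE Z; apply/matrixP => i j; rewrite !mxE mulr_sumr; apply: eq_bigr => k _.
by rewrite !mxE !tnth_mktuple !tauE /dilation; ring.
Qed.

Lemma cloud_mx_scaled1 disp (Omega : measurableType disp) n d
    (e : 'I_n -> Omega -> 'cV[R]_d) w :
  cloud_mx (scaled_cloud e (fun=> 1) w) = noise_cloud e w.
Proof. by apply/matrixP => k i; rewrite !mxE !tnth_mktuple mul1r. Qed.

Lemma sqrtr_nat_ge (a : R) : exists d0 : nat, forall d : nat, (d0 <= d)%N ->
  a <= Num.sqrt d%:R.
Proof.
exists ((Num.truncn `|a|).+1 ^ 2)%N => d d0d; apply: (le_trans (ler_norm _)).
rewrite -[leLHS]sqrtr_sqr -real_normK ?num_real //; apply: ler_wsqrtr.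
apply: (@le_trans _ _ ((Num.truncn `|a|).+1 ^ 2)%N%:R); last by rewrite ler_nat.
by rewrite natrX ler_pXn2r ?nnegrE // ltW // truncnS_gt.
Qed.

Lemma small_quotient (a eps : R) : 0 <= a -> 0 < eps ->
  exists2 K : R, 0 < K & a / K ^+ 2 <= eps.
Proof.
move=> a0 eps0; have q0 : 0 <= a / eps by rewrite divr_ge0 // ltW.
exists (1 + a / eps); first by rewrite ltr_pwDl.
rewrite ler_pdivrMr ?exprn_gt0 ?ltr_pwDl // [leRHS]mulrC -ler_pdivrMr //.
nra.
Qed.

(** The bound (1 + y)^d <= exp(d y) with y = 9 tau^2, together with d tau^2 <= n^2: the right-hand
    side is free of d. *)
Lemma contiguity_constant (d n : nat) (tau : nat -> R) : (0 < d)%N ->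
  (forall k, 0 <= tau k <= n%:R / Num.sqrt d%:R) ->
  \prod_(k < n) (1 + 9 * tau k ^+ 2) ^+ d <= expR (9 * n%:R ^+ 2) ^+ n.
Proof.
move=> d0 taub; have d0' : 0 < d%:R :> R by rewrite ltr0n.
have -> : expR (9 * n%:R ^+ 2) ^+ n = \prod_(k < n) expR (9 * n%:R ^+ 2) :> R.
  by rewrite prodr_const card_ord.
apply: ler_prod => k _; have t20 : 0 <= 9 * tau k ^+ 2 by rewrite mulr_ge0 ?sqr_ge0.
rewrite exprn_ge0 ?addr_ge0 //=.
apply: (@le_trans _ _ (expR (9 * tau k ^+ 2) ^+ d)).
  by apply: lerXn2r; rewrite ?nnegrE ?expR_ge0 ?addr_ge0 ?expR_ge1Dx.
rewrite -expRM_natl ler_expR mulrCA ler_pM2l //.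
have /andP[t0 tn] := taub k.
have : tau k ^+ 2 <= (n%:R / Num.sqrt d%:R) ^+ 2.
  by apply: lerXn2r; rewrite ?nnegrE // divr_ge0 ?sqrtr_ge0.
rewrite expr_div_n sqr_sqrtr ?ler0n // ler_pdivlMr //.
by rewrite mulrC.
Qed.

Lemma discr_anticoncentration n (eps : R) : 0 < eps ->
  exists2 eta : R, 0 < eta & exists d0 : nat,
  forall d disp (Omega : measurableType disp) (P : probability Omega R)
    (e : 'I_n.+1 -> Omega -> 'cV[R]_d), iid_standard_gaussian P e -> (d0 <= d)%N ->
  let bad := [set w | `|discr (normalized_gram v (Num.sqrt d%:R)
    ((noise_cloud e w)^T *m noise_cloud e w))| < eta] in
  measurable bad /\ (P bad <= eps%:E)%E.
Proof.
move=> eps0.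
pose C : R := expR (9 * n.+1%:R ^+ 2) ^+ n.+1.
have C0 : 0 < C by rewrite exprn_gt0 // expR_gt0.
(* The dilated event will have probability at most 2 delta, so that C times this is [eps ^+ 2]. *)
pose delta := eps ^+ 2 / (2 * C).
have delta0 : 0 < delta by rewrite divr_gt0 ?exprn_gt0 ?mulr_gt0.
pose D := discr_degree n.
have [L L0 DL] : exists2 L : nat, (0 < L)%N & D%:R / L%:R <= delta.
  exists (Num.truncn (D%:R / delta)).+1 => //.
  rewrite ler_pdivrMr ?ltr0n // mulrC -ler_pdivrMr //.
  by apply: ltW; exact: truncnS_gt.
have k40 : 0 <= k4 by have /andP[a b] := @gauss_moment4_ge R; exact: le_trans b.
have [K K0 Kq] : exists2 K : R, 0 < K & (n.+1 * n.+1)%:R * (k4 / K ^+ 2) <= delta.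
  have [|K K0] := @small_quotient ((n.+1 * n.+1)%:R * k4) delta _ delta0; first exact: mulr_ge0.
  by rewrite -mulrA => Kq; exists K.
(* Distinct values in [0, 1): the contiguity constant then does not depend on L, which can be chosen
   after it. *)
pose t (j : 'I_L) : R := j%:R / L%:R.
have L0' : 0 < L%:R :> R by rewrite ltr0n.
have t_inj : injective t.
  move=> i j /(divIf (lt0r_neq0 L0')) /eqP; rewrite eqr_nat => /eqP; exact: val_inj.
have t01 j : 0 <= t j <= 1.
  by rewrite divr_ge0 //= ler_pdivrMr // mul1r ler_nat ltnW.
have [eta eta0 [c c0 count]] := card_small_discr n K (@gauss_moment2_gt0 R) t_inj.
exists eta => //.
have [d1 d1P] := sqrtr_nat_ge c; have [d2 d2P] := sqrtr_nat_ge (n.+1%:R).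
exists (maxn 1 (maxn d1 d2)) => d disp Omega P e e_iid.
rewrite !geq_max => /and3P[d_gt0 /d1P cr /d2P nr] bad.
pose r : R := Num.sqrt d%:R; rewrite -/r in cr nr bad *.
have r0 : 0 < r by exact: lt_le_trans nr.
pose B0 := [set t : n.+1.-tuple (d.-tuple (measurableTypeR R)) |
  `|discr (normalized_gram v r ((cloud_mx t)^T *m cloud_mx t))| < eta].
have mB0 : measurable B0 by exact: measurable_small_discr.
have badE : bad = scaled_cloud e (fun=> 1) @^-1` B0.
  by apply/seteqP; split=> w; rewrite /bad /B0 /= cloud_mx_scaled1.
have mscaled sigma : measurable_fun setT (scaled_cloud e sigma).
  apply: measurable_tuple_of_coords => k.
  exact: (@measurable_scaled_column R _ _ P _ _ e e_iid _ (fun k => k) sigma k).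
have mpre sigma : measurable (scaled_cloud e sigma @^-1` B0).
  by rewrite -[X in measurable X]setTI; exact: mscaled.
split; first by rewrite badE; exact: mpre.
(* The value 0 beyond the last column makes the bounds hold for every natural number k; they are at
   most 1 because r >= n + 1. *)
pose tau j k : R := if (k < n.+1)%N then t j * k.+1%:R / r else 0.
have taub j k : 0 <= tau j k <= n.+1%:R / r.
  clear -t01 r0; rewrite /tau; case: ifP => kn; last by rewrite lexx divr_ge0 ?ltW.
  have /andP[tj0 tj1] := t01 j.
  rewrite divr_ge0 ?mulr_ge0 ?(ltW r0) //= ler_pM2r ?invr_gt0 //.
  by rewrite -[leRHS]mul1r ler_pM // ler_nat.
have tau01 j k : 0 <= tau j k <= 1.
  clear -taub r0 nr.
  have /andP[-> /le_trans ->] // := taub j k.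
  by rewrite ler_pdivrMr // mul1r.
pose A j := scaled_cloud e (fun k => 1 + tau j k) @^-1` B0.
have [mH PH] := gram_tight e_iid K0 d_gt0; set H := (X in measurable X) in mH PH.
have AH w : ~ H w -> (#|[set j | w \in A j]%SET| <= D)%N.
  move=> nH; apply: leq_trans (count r _ cr (_ : forall i j,
    `|((noise_cloud e w)^T *m noise_cloud e w) i j - (v * r ^+ 2) *+ (i == j)| <= K * r)).
    apply: subset_leq_card; apply/fintype.subsetP => j.
    rewrite !finset.inE => /= Aj.
    have : A j w by rewrite inE in Aj.
    by rewrite /A /B0 /= (@rescale_gram _ _ n d e r (t j) (tau j)) // => k; rewrite /tau ltn_ord.
  by move=> i j; rewrite leNgt; apply/negP => ij; apply: nH; exists (i, j).
(* The index j may depend on d and on P; [eta], L and K do not. *)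
have [j PAj] := @counting_bound R _ _ P _ _ _ _ L0 (fun j => mpre (fun k => 1 + tau j k)) mH AH.
have PA : (P (A j) <= (2 * delta)%:E)%E.
  apply: (le_trans PAj); rewrite (_ : 2 * delta = delta + delta); last by ring.
  rewrite EFinD; apply: leeD.
    by rewrite lee_fin.
  by apply: (le_trans PH); rewrite lee_fin.
have := scaling_contiguity e_iid (tau01 j) mB0; rewrite -badE => bad2.
have : (P bad * P bad <= (eps ^+ 2)%:E)%E.
  apply: (le_trans bad2); apply: (@le_trans _ _ (C%:E * (2 * delta)%:E)%E).
    apply: lee_pmul; [|exact: measure_ge0| |exact: PA].
      clear; rewrite lee_fin prodr_ge0 // => k _.
      by rewrite exprn_ge0 // addr_ge0 // mulr_ge0 // sqr_ge0.
    rewrite lee_fin; apply: contiguity_constant; [exact: d_gt0|exact: taub].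
  by rewrite -EFinM lee_fin /delta le_eqVlt; apply/orP; left; apply/eqP; field; rewrite gt_eqF.
have /fineK <- : P bad \is a fin_num.
  by apply: fin_num_measure; rewrite badE; exact: mpre.
have : 0 <= fine (P bad) by exact/fine_ge0/measure_ge0.
move: (fine (P bad)) => p; clear -eps0 => p0.
by rewrite -EFinM !lee_fin -expr2 ler_pXn2r ?nnegrE ?(ltW eps0).
Qed.

End DiscrAnticoncentration.

(** * The event of high probability *)

Section GoodEvent.
Context {R : realType}.
Local Notation v := (@gauss_moment2 R).
Local Notation k4 := (@gauss_moment4 R).

Lemma original_cloud_widen s n d (x : 'M[R]_(s, n)) (sd : (s <= d)%N) k i :
  original_cloud d x (widen_ord sd k) i = x k i.
Proof. by rewrite mxE /= valK. Qed.

Lemma original_cloud_ge s n d (x : 'M[R]_(s, n)) (k : 'I_d) i :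
  (s <= k)%N -> original_cloud d x k i = 0.
Proof. by move=> sk; rewrite mxE insubN // -leqNgt. Qed.

(** The difference is X^T X + X^T E + E^T X, and X vanishes outside the first s rows; so d does not
    enter the bound. *)
Lemma gram_perturbation s n d (x : 'M[R]_(s, n)) (E : 'M[R]_(d, n)) (sd : (s <= d)%N)
    (b M : R) :
  (forall k i, `|x k i| <= b) -> (forall k i, `|E (widen_ord sd k) i| <= M) ->
  forall i j, `|((original_cloud d x + E)^T *m (original_cloud d x + E) - E^T *m E) i j|
    <= s%:R * (b ^+ 2 + 2 * b * M).
Proof.
move=> xb EM i j; pose X := original_cloud d x.
pose T k := X k i * X k j + X k i * E k j + E k i * X k j.
have -> : ((original_cloud d x + E)^T *m (original_cloud d x + E) - E^T *m E) i j =
    \sum_k T k.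
  have gramE (A : 'M[R]_(d, n)) : (A^T *m A) i j = \sum_k A k i * A k j.
    by rewrite mxE; apply: eq_bigr => k _; rewrite mxE.
  have addE p q (A B : 'M[R]_(p, q)) k l : (A + B) k l = A k l + B k l by rewrite mxE.
  have oppE p q (A : 'M[R]_(p, q)) k l : (- A) k l = - A k l by rewrite mxE.
  rewrite addE oppE !gramE -sumrB; apply: eq_bigr => k _.
  by rewrite !addE -/X /T; ring.
rewrite (bigID (fun k : 'I_d => (k < s)%N)) /= [X in _ + X]big1 ?addr0; last first.
  by move=> k; rewrite -leqNgt => sk; rewrite /T /X !(original_cloud_ge _ _ sk); ring.
rewrite (big_ord_narrow sd); apply: (le_trans (ler_norm_sum _ _ _)).
rewrite mulr_natl; apply: (@le_trans _ _ (\sum_(k < s) (b ^+ 2 + 2 * b * M))).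
  apply: ler_sum => k _; rewrite /T /X !original_cloud_widen.
  have b0 : 0 <= b by exact: le_trans (xb k i).
  apply: (le_trans (ler_normD _ _)); apply: (le_trans (lerD (ler_normD _ _) (lexx _))).
  rewrite !normrM (_ : b ^+ 2 + 2 * b * M = b * b + b * M + M * b); last by ring.
  by rewrite !lerD // ler_pM.
by rewrite sumr_const card_ord.
Qed.

Lemma good_event m s (x : 'M[R]_(s, m.+1)) (eps delta : R) :
  (0 < m)%N -> (s <= m)%N -> 0 < eps -> 0 < delta ->
  exists d0 : nat, forall d, (d0 <= d)%N ->
  forall disp (Omega : measurableType disp) (P : probability Omega R)
    (e : 'I_m.+1 -> Omega -> 'cV[R]_d), iid_standard_gaussian P e ->
  exists G : set Omega, [/\ measurable G, ((1 - eps)%:E <= P G)%E &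
    forall w, G w -> forall Phat Ehat : 'M[R]_(s, m.+1),
      is_normalized_pca (observed_cloud x e w) Phat ->
      is_normalized_pca (noise_cloud e w) Ehat ->
      forall i j, `|eucl_dist (col i Phat) (col j Phat) -
                   eucl_dist (col i Ehat) (col j Ehat)| <= delta].
Proof.
move=> m0 sm eps0 delta0.
(* One third for each bad event: a small discriminant, a Gram entry far from its mean, a large noise
   entry among the first s coordinates. *)
have eps3 : 0 < eps / 3 by rewrite divr_gt0.
have v0 : 0 <= v by exact: ltW gauss_moment2_gt0.
have k40 : 0 <= k4 by have /andP[a b] := @gauss_moment4_ge R; exact: le_trans b.
have [eta eta0 [d1 d1P]] := discr_anticoncentration m eps3.
have [|K K0 KP] := @small_quotient R ((m.+1 * m.+1)%:R * k4) (eps / 3) _ eps3; first exact: mulr_ge0.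
have [|M M0 MP] := @small_quotient R ((m.+1 * s)%:R * v) (eps / 3) _ eps3; first exact: mulr_ge0.
pose b := \sum_k \sum_i `|x k i|.
have xb k i : `|x k i| <= b.
  rewrite /b (bigD1 k) //= (bigD1 i) //= -!addrA lerDl addr_ge0 ?sumr_ge0 // => k' _.
  by rewrite sumr_ge0.
have b0 : 0 <= b by apply: sumr_ge0 => k _; apply: sumr_ge0.
have M'0 : 0 <= s%:R * (b ^+ 2 + 2 * b * M).
  by rewrite mulr_ge0 // addr_ge0 ?sqr_ge0 // !mulr_ge0 // ltW.
have [c close] := @distance_close R m s v K _ eta delta m0 sm (@gauss_moment2_gt0 R) (ltW K0)
  M'0 eta0 delta0.
have [d2 d2P] := sqrtr_nat_ge c.
exists (maxn m.+1 (maxn d1 d2)) => d; rewrite !geq_max => /and3P[md /d1P{}d1P /d2P cd].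
move=> disp Omega P e e_iid.
have [mB1 PB1] := d1P _ _ P e e_iid; set B1 := (X in measurable X) in mB1 PB1.
have [mB2 PB2] := gram_tight e_iid K0 (leq_ltn_trans (leq0n _) md).
set B2 := (X in measurable X) in mB2 PB2.
have sd : (s <= d)%N by apply: leq_trans sm (ltnW md).
have [mB3 PB3] := entry_tight e_iid sd M0; set B3 := (X in measurable X) in mB3 PB3.
have mB : measurable (B1 `|` B2 `|` B3) by apply: measurableU => //; exact: measurableU.
exists (~` (B1 `|` B2 `|` B3)); split; first exact: measurableC.
  rewrite probability_setC // EFinB; apply: leeB => //.
  apply: (le_trans (measureU2 _ _ _)) => //; first exact: measurableU.
  rewrite (_ : eps = eps / 3 + eps / 3 + eps / 3); last by field.
  rewrite !EFinD; apply: leeD.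
    apply: (le_trans (measureU2 _ _ _)) => //; apply: leeD => //.
    by apply: (le_trans PB2); rewrite lee_fin mulrA.
  by apply: (le_trans PB3); rewrite lee_fin mulrA.
move=> w nB Phat Ehat Phat_pca Ehat_pca.
apply: (close _ _ _ _ _ _ cd (ltnW md) _ _ _ Ehat_pca Phat_pca).
- by rewrite leNgt; apply/negP => bad; apply: nB; left; left.
- by move=> i j; rewrite leNgt; apply/negP => bad; apply: nB; left; right; exists (i, j).
- apply: gram_perturbation => // k i; rewrite mxE leNgt; apply/negP => bad.
  by apply: nB; right; exists (i, k).
Qed.

End GoodEvent.

Lemma cvg_probability_one {R : realType} (p : nat -> \bar R) :
  (forall d, (0 <= p d <= 1)%E) ->
  (forall eps : R, 0 < eps -> exists d0, forall d, (d0 <= d)%N -> ((1 - eps)%:E <= p d)%E) ->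
  p d @[d --> \oo] --> 1%E.
Proof.
move=> p01 pe.
have pfin d : p d \is a fin_num.
  by have /andP[p0 p1] := p01 d; rewrite ge0_fin_numE // (le_lt_trans p1) // ltry.
apply/fine_cvgP; split; first by near=> d; exact: pfin.
apply/cvgrPdist_le => eps /pe[d0 d0P]; near=> d.
have /andP[p0 p1] := p01 d; have := d0P d; rewrite -(fineK (pfin d)) lee_fin in p1 *.
move=> pd; rewrite /= ger0_norm; last by rewrite subr_ge0 -lee_fin.
rewrite lerBlDr addrC -lerBlDr; apply: pd; near: d; exact: nbhs_infty_ge.
Unshelve. all: by end_near.
Qed.

Theorem theorem4p15 (R : realType) (F : fieldType) (n s : nat)
    (n_gt3 : (3 < n)%N) (s_ge1 : (1 <= s)%N) (s_lt_n : (s < n)%N)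
    (x : 'M[R]_(s, n))
    (disp : nat -> measure_display)
    (Omega : forall d : nat, measurableType (disp d))
    (P : forall d : nat, probability (Omega d) R)
    (e : forall d : nat, 'I_n -> Omega d -> 'cV[R]_d)
    (e_iid : forall d : nat, (n < d)%N -> iid_standard_gaussian (P d) (e d))
    (Phat Ehat : forall d : nat, Omega d -> 'M[R]_(s, n))
    (Phat_pca : forall d : nat, (n < d)%N -> forall w : Omega d,
      is_normalized_pca (observed_cloud x (e d) w) (Phat d w))
    (Ehat_pca : forall d : nat, (n < d)%N -> forall w : Omega d,
      is_normalized_pca (noise_cloud (e d) w) (Ehat d w))
    (N : nat) (N_le : (N <= n - 2)%N) :
  oP1 P (fun (d : nat) (w : Omega d) =>
    bottleneck (persistence_diagram F (Phat d w) N)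
               (persistence_diagram F (Ehat d w) N)).
Proof.
move=> delta delta0.
have inv0 k : 0 < k.+1%:R^-1 :> R by rewrite invr_gt0 ltr0n.
have /choice[d0 good] : forall k : nat, exists d0 : nat, forall d, (d0 <= d)%N ->
    exists G : set (Omega d), [/\ measurable G, ((1 - k.+1%:R^-1)%:E <= P d G)%E &
      forall w, G w -> (`|bottleneck (persistence_diagram F (Phat d w) N)
        (persistence_diagram F (Ehat d w) N)| <= delta%:E)%E].
  move=> k; case: n n_gt3 s_lt_n x e e_iid Phat Ehat Phat_pca Ehat_pca {N_le}.
    by [].
  move=> m m2 sm x' e' e_iid' Phat' Ehat' Phat_pca' Ehat_pca'.
  have [d0 d0P] := good_event x' (ltn_trans (isT : 0 < 2)%N m2) sm (inv0 k) delta0.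
  (* There are n = m + 1 points, so [m.+2] enforces n < d. *)
  exists (maxn m.+2 d0) => d; rewrite geq_max => /andP[md /d0P{}d0P].
  have [G [mG PG GP]] := d0P _ _ _ _ (e_iid' d md).
  exists G; split=> // w Gw; apply: bottleneck_rips; first exact: ltW.
  by apply: (GP w Gw); [exact: Phat_pca'|exact: Ehat_pca'].
(* Below the threshold [d0 k] the event is empty; its inclusion is then trivial. *)
have total k d : exists G : set (Omega d), [/\ measurable G,
    (d0 k <= d)%N -> ((1 - k.+1%:R^-1)%:E <= P d G)%E &
    G `<=` [set w | (`|bottleneck (persistence_diagram F (Phat d w) N)
        (persistence_diagram F (Ehat d w) N)| <= delta%:E)%E]].
  have [/good[G [mG PG GP]]|_] := leqP (d0 k) d; first by exists G.
  exists set0; split=> //.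
pose G k d := projT1 (cid (total k d)).
have GP k d := projT2 (cid (total k d)).
(* A single sequence of events is required, whereas those at hand depend on the level 1/(k + 1).
   Their union over k is still contained in the target event and has at least the probability of
   each. *)
exists (fun d => \bigcup_k G k d).
have mG d : measurable (\bigcup_k G k d).
  by apply: bigcup_measurable => k _; have [] := GP k d.
split=> // [d w [k _]|]; first by have [_ _] := GP k d; apply.
apply: cvg_probability_one => [d|eps eps0].
  by rewrite measure_ge0 probability_le1.
have [k keps] : exists k : nat, k.+1%:R^-1 <= eps.
  exists (Num.truncn eps^-1); rewrite -[leRHS]invrK lef_pV2 ?posrE ?ltr0n ?invr_gt0 //.
  exact/ltW/truncnS_gt.
exists (d0 k) => d d0d; have [mGk PGk _] := GP k d.
apply: (@le_trans _ _ (1 - k.+1%:R^-1)%:E); first by rewrite lee_fin lerB.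
apply: (le_trans (PGk d0d)); apply: le_measure; rewrite ?inE //.
by move=> w Gw; exists k.
Qed.
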